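(* Let $\gamma:\mathbb{P}_1\times\mathbb{P}_2\to\overline{\mathbb{P}}$ be a regular embedding and let $\chi:\mathbb{P}_1\times\mathbb{P}_2\to\mathbb{P}'$ be a linear morphism such that: (i) there exist a basis $\{A_0,A_1,\ldots,A_m\}$ of $\mathbb{P}_2$ and a plane $\mathcal{E}\subset\mathcal{P}_1$ such that for every $i=1,\ldots,m$ the restriction $\chi|_{\mathcal{E}\times\{A_0,A_i\}}$ is global and has rank greater than $2$; (ii) there exists $A\in\mathcal{P}_1$ such that $\dim (A\times\mathcal{P}_2)\chi=m$. Then there are a collineation $\alpha'$ of $\mathbb{P}_2$ and a linear morphism $\varphi:\overline{\mathbb{P}}\to\mathbb{P}'$ such that, for $\alpha:=(\mathrm{id}_{\mathcal{P}_1},\alpha')$, it holds $\gamma\varphi=\alpha\chi$.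
   Context: Maps are written on the right and compositions are read from left to right; $\subset$ allows equality. A semilinear space is a pair $\Sigma=(\mathcal{P},\mathcal{G})$, with $\mathcal{P}$ a set of points and $\mathcal{G}$ a set of subsets of $\mathcal{P}$ (lines), such that every line has at least two points, the lines cover $\mathcal{P}$, and two distinct lines share at most one point. Points $X,Y$ are collinear, $X\sim Y$, if some line contains both; if moreover $X\ne Y$ that line is denoted $XY$. For $\mathcal{M}_1,\mathcal{M}_2\subset\mathcal{P}$ the join $\mathcal{M}_1\vee\mathcal{M}_2$ is the union of $\mathcal{M}_1$, $\mathcal{M}_2$ and all lines $X_1X_2$ with $X_i\in\mathcal{M}_i$, $X_1\sim X_2$, $X_1\neq X_2$. A point $X$ is often written for the set $\{X\}$. A linear morphism $\chi$ of $\Sigma$ into a projective space $(\mathcal{P}',\mathcal{G}')$ is a mapping of a subset $\mathbf{D}(\chi)\subset\mathcal{P}$ (the domain) into $\mathcal{P}'$ such that, with $X\chi=\emptyset$ for $X$ in the exceptional set $\mathbf{A}(\chi):=\mathcal{P}\setminus\mathbf{D}(\chi)$: (L1) $(X\vee Y)\chi=X\chi\vee Y\chi$ for all $X,Y\in\mathcal{P}$ with $X\sim Y$; (L2) if $X\neq Y$, $X\sim Y$ and $X\chi=Y\chi$, then there is $A\in XY$ with $A\chi=\emptyset$. For a set $M$ of points, $M\chi$ is the set of images of the points of $M\cap\mathbf{D}(\chi)$. A linear morphism is global if $\mathbf{D}(\chi)=\mathcal{P}$, and an embedding if it is global and injective. A restriction of $\chi$ to a set $M$ is global if $M\subset\mathbf{D}(\chi)$;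 its rank is the projective dimension of the subspace spanned by $M\chi$. Let $F$ be a commutative field, $n\ge2$, $m\ge1$ natural numbers, $\mathbb{P}_1=\mathrm{PG}(n,F)=(\mathcal{P}_1,\mathcal{G}_1)$, $\mathbb{P}_2=\mathrm{PG}(m,F)=(\mathcal{P}_2,\mathcal{G}_2)$, $\overline{\mathbb{P}}=\mathrm{PG}(nm+n+m,F)$ (projective spaces over $F$ of the indicated dimensions), and $\mathbb{P}'$ a further projective space. The product $\mathbb{P}_1\times\mathbb{P}_2$ is the semilinear space with point set $\mathcal{P}_1\times\mathcal{P}_2$ whose lines are the sets $X_1\times g_2$ ($X_1\in\mathcal{P}_1$, $g_2\in\mathcal{G}_2$) and $g_1\times X_2$ ($g_1\in\mathcal{G}_1$, $X_2\in\mathcal{P}_2$). An embedding $\gamma:\mathbb{P}_1\times\mathbb{P}_2\to\overline{\mathbb{P}}$ is regular if the subspace spanned by $(\mathcal{P}_1\times\mathcal{P}_2)\gamma$ has dimension $nm+n+m$. A basis of a projective space is a minimal set of points spanning it. For a collineation $\alpha'$ of $\mathbb{P}_2$, $(\mathrm{id}_{\mathcal{P}_1},\alpha')$ is the automorphism $(X,Y)\mapsto(X,Y\alpha')$ of $\mathbb{P}_1\times\mathbb{P}_2$. Equality $\gamma\varphi=\alpha\chi$ is equality of partially defined maps: same exceptional set and same values. *)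

(* Defs.v *)
From mathcomp Require Import all_boot all_order all_algebra.
From mathcomp Require Import all_classical.

Set Implicit Arguments.
Unset Strict Implicit.
Unset Printing Implicit Defensive.

Local Open Scope classical_set_scope.
Local Open Scope card_scope.

Record geometry := Geometry {
  points : Type;
  lines : set (set points)
}.

Section Geometry.
Variable S : geometry.
Implicit Types (X Y Z : points S) (g M B : set (points S)).

Definition collinear X Y := exists g, [/\ lines g, g X & g Y].

Definition is_semilinear :=
  [/\ forall g, lines g -> exists X Y, [/\ g X, g Y & X <> Y],
      forall X, exists2 g, lines g & g X
    & forall g h X Y, lines g -> lines h -> X <> Y ->
        g X -> g Y -> h X -> h Y -> g = h].

Definition join_set (M1 M2 : set (points S)) : set (points S) :=
  M1 `|` M2 `|`
  [set Z | exists X1 X2 g,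
     [/\ M1 X1, M2 X2 & X1 <> X2] /\ [/\ lines g, g X1, g X2 & g Z]].

(* The Veblen-Young axiom is required for all A, B, C, D for which the four
   lines are determined; in the cases where A, B, C, D are not distinct, or are
   all on one line, it holds trivially. *)
Definition is_projective :=
  [/\ is_semilinear,
      forall X Y, collinear X Y,
      forall (A B C D : points S) (ab cd ac bd : set (points S)),
        [/\ A <> B, C <> D, A <> C & B <> D] ->
        [/\ lines ab, lines cd, lines ac & lines bd] ->
        [/\ ab A, ab B, cd C & cd D] ->
        [/\ ac A, ac C, bd B & bd D] ->
        ab `&` cd !=set0 -> ac `&` bd !=set0
    & forall g, lines g ->
        exists X Y Z, [/\ g X, g Y & g Z] /\ [/\ X <> Y, X <> Z & Y <> Z]].

Definition subspace M :=
  forall g X Y, lines g -> X <> Y -> g X -> g Y -> M X -> M Y -> g `<=` M.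

Definition spanned M : set (points S) :=
  \bigcap_(N in [set N | subspace N /\ M `<=` N]) N.

(* B is a minimal set of points spanning the subspace M. *)
Definition is_basis M B :=
  spanned B = M /\ forall B', B' `<=` B -> spanned B' = M -> B' = B.

(* Meant for subspaces of projective spaces, where all bases of M have the same
   cardinality; dim_gt also covers the infinite-dimensional case. *)
Definition has_dim M (d : nat) :=
  exists B, is_basis M B /\ B #= `I_d.+1.

Definition dim_gt M (d : nat) :=
  exists B, is_basis M B /\ ~ (B #<= `I_d.+1).

Definition is_plane M := subspace M /\ has_dim M 2.

Definition is_collineation (f : points S -> points S) :=
  bijective f /\ forall g, lines g <-> lines (f @` g).

End Geometry.

Definition PG (n : nat) (F : fieldType) : geometry :=
  @Geometry {U : {vspace 'rV[F]_n.+1} | \dim U == 1%N}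
    [set g | exists2 L : {vspace 'rV[F]_n.+1}, \dim L = 2%N &
       g = [set P | (val P <= L)%VS]].

Definition product_geometry (S1 S2 : geometry) : geometry :=
  @Geometry (points S1 * points S2)%type
    [set g | (exists X1 g2, lines g2 /\ g = [set X1] `*` g2) \/
             (exists g1 X2, lines g1 /\ g = g1 `*` [set X2])].

(* A partially defined map is a function to an option type; None is the value
   at the points of the exceptional set. *)
Section Morphisms.
Variables S S' : geometry.
Implicit Types (chi : points S -> option (points S')) (M : set (points S)).

Definition pimage chi M : set (points S') :=
  [set Y | exists2 X, M X & chi X = Some Y].

Definition global_on chi M := forall X, M X -> chi X <> None.

Definition is_linear_morphism chi :=
  (forall X Y, collinear X Y ->
     pimage chi (join_set [set X] [set Y]) =
     join_set (pimage chi [set X]) (pimage chi [set Y])) /\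
  (forall X Y g, lines g -> g X -> g Y -> X <> Y -> chi X = chi Y ->
     exists2 A, g A & chi A = None).

Definition is_embedding chi :=
  [/\ is_linear_morphism chi, global_on chi setT & injective chi].

Definition rank_gt chi M (d : nat) := dim_gt (spanned (pimage chi M)) d.

End Morphisms.

Definition is_regular_embedding (n m : nat) (F : fieldType)
    (gamma : points (product_geometry (PG n F) (PG m F)) ->
             option (points (PG (n * m + n + m) F))) :=
  is_embedding gamma /\ has_dim (spanned (pimage gamma setT)) (n * m + n + m).

(* Main.v *)
(* The restriction of [chi] to the plane [E] times [A_0] is a collineation onto
   a plane, hence carries homogeneous coordinates over [F] into P'.  As P' is
   not a plane, these extend, one point at a time, to a subspace containing the
   image of [chi].  In these coordinates each map [X |-> (X, A_i) chi] turns out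
   to be a projectivity [f_i], linear and not only semilinear: a third point of
   the line A_0 A_i gives lines through corresponding points, so that on some
   line of [E] the maps [f_0] and [f_i] are either related by a regulus, or
   equal.  The restriction of [chi] to the point of (ii) times P_2 is a
   collineation [b] onto the span of the [f_i A], and comparing [(X, Y) chi]
   with [\sum_i b(Y)_i f_i(X)], first for Y on the lines A_0 A_i, then for all
   Y, shows that they agree.  Thus [chi] is [b] on the second factor, followed
   by the Segre map and a linear morphism.  This holds for [gamma] as well, with
   an invertible linear morphism, which yields [phi] and [alpha']. *)
Require Import Defs.
From HB Require Import structures.
From mathcomp Require Import all_boot all_order all_algebra.
From mathcomp Require Import all_classical.
From mathcomp Require Import ring zify.

Set Implicit Arguments.
Unset Strict Implicit.
Unset Printing Implicit Defensive.

Import GRing.Theory VectorInternalTheory.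
Local Open Scope classical_set_scope.
Local Open Scope card_scope.
Local Open Scope ring_scope.

(** * Proportionality and independence *)

(** Nothing beyond the axioms is known of [P']: it has no coordinates before (i) yields a plane in
    it, and that plane alone could not be extended without room outside it. Nor need [b] be
    semilinear: for m = 1 every bijection of the line P_2 is a collineation. Hence morphisms are
    treated as maps of vectors up to factors ([lmap]), a class that contains such bijections, and
    linearity in the first factor has to be detected on a single line and then spread. The rank in
    (i) enters through one point of E whose image under f_i is outside the plane of f_0. That chi
    agrees with the sum rests on a quadratic condition tested at three scalars 0, 1, t; over two
    elements a line has only three points, and its last point is determined by the other two
    instead. For [gamma], analogues of (i) and (ii) follow from globality and injectivity, and
    regularity turns a kernel vector into a loss of dimension. *)

Section V2r.
Variables (F : fieldType) (V : vectType F).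
Implicit Types u v : V.
Lemma v2rD u v : v2r (u + v) = v2r u + v2r v. Proof. exact: linearD. Qed.
Lemma v2rN u : v2r (- u) = - v2r u. Proof. exact: linearN. Qed.
Lemma v2rZ a u : v2r (a *: u) = a *: v2r u. Proof. exact: linearZ. Qed.
Lemma v2r0 : v2r (0 : V) = 0. Proof. exact: linear0. Qed.

(** Linear-combination reasoning for vectors: the multipliers are supplied by hand, and what remains
    is an identity that [vring] or [vfield] checks in coordinates. *)
Lemma lincomb1 (x y l r : V) c : l = r -> x - y = c *: (l - r) -> x = y.
Proof. by move=> -> /eqP; rewrite subrr scaler0 subr_eq0 => /eqP. Qed.

Lemma lincomb2 (x y l r l' r' : V) c c' : l = r -> l' = r' ->
  x - y = c *: (l - r) + c' *: (l' - r') -> x = y.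
Proof. by move=> -> -> /eqP; rewrite !subrr !scaler0 addr0 subr_eq0 => /eqP. Qed.
End V2r.

Ltac vnorm := apply: (can_inj v2rK);
  rewrite ?(v2rD, v2rN, v2rZ, v2r0); apply/rowP=> ?; rewrite !mxE.
Ltac vring := vnorm; ring.
Ltac vfield := vnorm; field.

Ltac nz := rewrite ?(mulf_eq0, invr_eq0, oppr_eq0, negb_or);
  repeat (apply/andP; split); assumption.

Section Par.
Variables (F : fieldType) (V : vectType F).
Implicit Types u v w : V.

(** Equality of points in homogeneous coordinates. Only 0 is related to 0, so maps that agree up to
    [par] have the same exceptional set. *)
Definition par u v := exists2 a : F, a != 0 & u = a *: v.

Lemma par_refl u : par u u.
Proof. by exists 1; rewrite ?oner_neq0 ?scale1r. Qed.

Lemma par_sym u v : par u v -> par v u.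
Proof.
by case=> a a0 ->; exists a^-1; rewrite ?invr_eq0 // scalerA mulVf ?scale1r.
Qed.

Lemma par_trans v u w : par u v -> par v w -> par u w.
Proof.
case=> a a0 -> [b b0 ->]; exists (a * b); first by rewrite mulf_neq0.
by rewrite scalerA.
Qed.

Lemma parZ a u : a != 0 -> par (a *: u) u.
Proof. by exists a. Qed.

Lemma par0 u : par u 0 -> u = 0.
Proof. by case=> a _ ->; rewrite scaler0. Qed.

Lemma par_eq0 u v : par u v -> u = 0 -> v = 0.
Proof. by move=> /par_sym + u0; rewrite u0 => /par0. Qed.

Lemma par_scale u v c : u != 0 -> u = c *: v -> par u v.
Proof.
move=> u0 uv; exists c => //; apply: contraNneq u0 => c0.
by rewrite uv c0 scale0r.
Qed.

(** Independence is stated by coefficients because the arguments below compare coefficients in two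
    expressions of one vector. *)
Definition ind2 u v := forall a b : F, a *: u + b *: v = 0 -> a = 0 /\ b = 0.
Definition ind3 u v w := forall a b c : F,
  a *: u + b *: v + c *: w = 0 -> [/\ a = 0, b = 0 & c = 0].
Definition ind4 u v w z := forall a b c d : F,
  a *: u + b *: v + c *: w + d *: z = 0 -> [/\ a = 0, b = 0, c = 0 & d = 0].

Lemma scaler_eq0_or (a : F) u : a *: u = 0 -> a = 0 \/ u = 0.
Proof. by move/eqP; rewrite scaler_eq0 => /orP[] /eqP; [left|right]. Qed.

Lemma ind2C u v : ind2 u v -> ind2 v u.
Proof. by move=> i a b; rewrite addrC => /i[]. Qed.

Lemma ind2_neq0 u v : ind2 u v -> u != 0.
Proof.
move=> i; apply/eqP => u0; have [|/eqP] := i 1 0.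
  by rewrite u0 scaler0 scale0r addr0.
by rewrite oner_eq0.
Qed.

Lemma nind2 u v : v != 0 -> ~ (exists c, u = c *: v) -> ind2 u v.
Proof.
move=> v0 H a b E.
have a0 : a = 0.
  apply/eqP/negPn/negP => a0; apply: H; exists (- b / a).
  by apply: (lincomb1 (c := a^-1) E); vfield.
split=> //; move: E; rewrite a0 scale0r add0r => /scaler_eq0_or[] // z.
by rewrite z eqxx in v0.
Qed.

Lemma ind2_nscale u v c : ind2 u v -> u <> c *: v.
Proof.
move=> i uv; have [|/eqP] := i 1 (- c); first by rewrite uv; vring.
by rewrite oner_eq0.
Qed.

Lemma ind3_comb u v w : ind2 u v -> ~ (exists a b, w = a *: u + b *: v) ->
  ind3 u v w.
Proof.
move=> i H a b c E.
have c0 : c = 0.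
  apply/eqP/negPn/negP => c0; apply: H; exists (- a / c), (- b / c).
  by apply: (lincomb1 (c := c^-1) E); vfield.
by move: E; rewrite c0 scale0r addr0 => /i[].
Qed.

Lemma ind3_ind2 u v w : ind3 u v w -> ind2 u v.
Proof.
by move=> i a b E; have [|-> ->] := i a b 0; rewrite ?scale0r ?addr0.
Qed.
Lemma ind3_ind2r u v w : ind3 u v w -> ind2 v w.
Proof.
by move=> i a b E; have [|_ -> ->] := i 0 a b; rewrite ?scale0r ?add0r.
Qed.
Lemma ind3_swap u v w : ind3 u v w -> ind3 v u w.
Proof. by move=> i a b c E; have [|-> -> ->] := i b a c; rewrite // -E; vring. Qed.
Lemma ind3_ind2s u v w : ind3 u v w -> ind2 u w.
Proof. by move=> /ind3_swap/ind3_ind2r. Qed.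

End Par.

Section Hom.
Variables (F : fieldType) (V W : vectType F).

Lemma homD (g : 'Hom(V, W)) u v : g (u + v) = g u + g v.
Proof. exact: linearD. Qed.
Lemma homZ (g : 'Hom(V, W)) a v : g (a *: v) = a *: g v.
Proof. exact: linearZ. Qed.
Lemma homN (g : 'Hom(V, W)) v : g (- v) = - g v.
Proof. exact: linearN. Qed.
Lemma hom0 (g : 'Hom(V, W)) : g 0 = 0.
Proof. exact: linear0. Qed.

Lemma hom_of_linear (g : V -> W) :
  (forall a u v, g (a *: u + v) = a *: g u + g v) ->
  exists h : 'Hom(V, W), forall x, h x = g x.
Proof.
move=> gL.
pose gl : {linear V -> W} := HB.pack g (GRing.isLinear.Build F V W _ g gL).
by exists (linfun gl) => x; rewrite lfunE.
Qed.

(** The form is the coordinate at [y] with respect to [y] followed by a basis of [U]. It serves to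
    correct a value at [y] without a change on [U]. *)
Lemma separating_form (U : {vspace V}) y : y \notin U ->
  exists2 phi : V -> F, (forall a u v, phi (a *: u + v) = a * phi u + phi v) &
    phi y = 1 /\ forall u, u \in U -> phi u = 0.
Proof.
move=> yU; pose X := [tuple of y :: vbasis U].
have fX : free X.
  rewrite free_cons (basis_free (vbasisP U)) andbT.
  by rewrite (span_basis (vbasisP U)).
exists (coord X ord0); first by move=> a u v; rewrite linearP.
split; first by have := coord_free ord0 ord0 fX; rewrite eqxx.
move=> u /coord_vbasis ->; rewrite linear_sum big1 // => i _.
rewrite linearZ /= -[(vbasis U)`_i]/(X`_(lift ord0 i)).
by rewrite (coord_free (lift ord0 i) ord0 fX) mulr0.
Qed.

End Hom.

Section Lmap.
Variables (F : fieldType) (V W : vectType F).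

(* A linear morphism between projective spaces over F, as a map of vectors: 0
   stands for the exceptional set, and the value at a vector matters only up to
   a nonzero factor. *)
Record lmap (f : V -> W) : Prop := Lmap {
  lmap0 : f 0 = 0;
  lmapZ : forall a v, a != 0 -> par (f (a *: v)) (f v);
  lmapD : forall u v, exists a b, f (u + v) = a *: f u + b *: f v;
  lmapK : forall u v c, f u = c *: f v -> exists a, f (u + a *: v) = 0;
  lmapO : forall u v c d, exists a b,
    par (f (a *: u + b *: v)) (c *: f u + d *: f v) }.

Variable f : V -> W.
Hypothesis fL : lmap f.

Lemma lmapZw a v : exists b, f (a *: v) = b *: f v.
Proof.
have [->|/(lmapZ fL v)[b _ ->]] := eqVneq a 0; last by exists b.
by exists 0; rewrite !scale0r (lmap0 fL).
Qed.

Lemma lmap_comb u v a b : exists c d, f (a *: u + b *: v) = c *: f u + d *: f v.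
Proof.
have [c [d ->]] := lmapD fL (a *: u) (b *: v).
have [a' ->] := lmapZw a u; have [b' ->] := lmapZw b v.
by exists (c * a'), (d * b'); rewrite !scalerA.
Qed.

Lemma lmapZeq0 a v : a != 0 -> f (a *: v) = 0 -> f v = 0.
Proof. by move=> a0; apply: par_eq0; apply: lmapZ. Qed.

(** From u = (z + u) - z, the value at [u] is a multiple of that at [z + u]: a kernel vector can be
    added without moving the image point. *)
Lemma lmapD0 z u : f z = 0 -> par (f (z + u)) (f u).
Proof.
move=> z0; have [u0|u0] := eqVneq (f u) 0.
  have [a [b ->]] := lmapD fL z u.
  by rewrite z0 u0 !scaler0 addr0; exists 1; rewrite ?oner_neq0 ?scaler0.
apply: par_sym.
have [a [b]] := lmap_comb (z + u) z 1 (-1).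
rewrite z0 scaler0 addr0 => E; apply: (@par_scale _ _ _ _ a u0).
by rewrite -E; congr f; vring.
Qed.

End Lmap.

Lemma hom_lmap (F : fieldType) (V W : vectType F) (g : 'Hom(V, W)) : lmap g.
Proof.
split; first exact: hom0.
- by move=> a v a0; rewrite homZ; apply: parZ.
- by move=> u v; exists 1, 1; rewrite homD !scale1r.
- by move=> u v c E; exists (- c); rewrite homD homZ E; vring.
- by move=> u v c d; exists c, d; rewrite homD !homZ; apply: par_refl.
Qed.

Lemma lmap_comp (F : fieldType) (V W Z : vectType F) (g : W -> Z) (f : V -> W) :
  lmap g -> lmap f -> lmap (fun x => g (f x)).
Proof.
have parg (gL : lmap g) u v : par u v -> par (g u) (g v).
  by case=> a a0 ->; apply: lmapZ.
move=> gL fL; split.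
- by rewrite (lmap0 fL) (lmap0 gL).
- by move=> a v a0; apply: parg => //; apply: lmapZ.
- move=> u v; have [a [b ->]] := lmapD fL u v; exact: lmap_comb.
- move=> u v c E; have [a Ea] := lmapK gL E.
  have [a' [b' P]] := lmapO fL u v 1 a; rewrite scale1r in P.
  (* If [a'] vanishes, [f u + a *: f v] is a multiple of [f v], hence so is [f u], and [lmapK] for
     [f] alone gives the zero. *)
  have [a0|a0] := eqVneq a' 0.
    rewrite a0 scale0r add0r in P.
    have [b0|b0] := eqVneq b' 0.
      move: P; rewrite b0 scale0r (lmap0 fL) => /par_sym/par0 E0.
      have [] := lmapK fL (u := u) (v := v) (c := - a).
        by apply: (lincomb1 (c := 1) E0); vring.
      by move=> x Ex; exists x; rewrite Ex (lmap0 gL).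
    have [x x0 Ex] := par_trans (par_sym (lmapZ fL v b0)) P.
    have [] := lmapK fL (u := u) (v := v) (c := x^-1 - a).
      by apply: (lincomb1 (c := - x^-1) Ex); vfield.
    by move=> y Ey; exists y; rewrite Ey (lmap0 gL).
  exists (b' / a').
  have := par_trans (lmapZ fL (a' *: u + b' *: v) (invr_neq0 a0)) P.
  by move/(parg gL); rewrite Ea => /par0 <-; congr (g (f _)); vfield.
- move=> u v c d; have [a [b P]] := lmapO gL (f u) (f v) c d.
  have [a' [b' P']] := lmapO fL u v a b; exists a', b'.
  by apply: par_trans P; apply: parg.
Qed.

(** * Linear morphisms in vector form *)

Section Agree.
Variables (F : fieldType) (V W : vectType F).
Implicit Types f g : V -> W.

Lemma lmap_nozero f u v : lmap f ->
  (forall t, f (v + t *: u) <> 0) ->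
  forall a b, f (a *: v + b *: u) = 0 -> a = 0.
Proof.
move=> fL nz a b E; apply/eqP/negPn/negP => a0; apply: (nz (b / a)).
by apply: (lmapZeq0 fL a0); rewrite -E; congr f; vfield.
Qed.

(** A zero among the [v + t *: u] reduces the claim to adding a kernel vector. Without one, if
    either map vanishes at [u], it is constant on the points [v + t *: u], and [lmapK] makes the
    other map vanish at [u] too. Otherwise the value at [u] is the one point of the image line that
    is taken nowhere else, for both maps. *)
Lemma lmap_agree_off_point f g u v : lmap f -> lmap g ->
  (forall t, par (f (v + t *: u)) (g (v + t *: u))) -> par (f u) (g u).
Proof.
move=> fL gL H.
have [[t t0]|nz] := pselect (exists t, f (v + t *: u) = 0).
  have t0' := par_eq0 (H t) t0.
  apply: par_trans (lmapD0 gL u t0').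
  apply: par_trans (par_sym (lmapD0 fL u t0)) _.
  have -> : v + t *: u + u = v + (t + 1) *: u by vring.
  exact: H.
have nzf t : f (v + t *: u) <> 0 by move=> E; apply: nz; exists t.
have nzg t : g (v + t *: u) <> 0.
  by move=> E; apply: (nzf t); apply: par_eq0 E; apply: par_sym.
have Hv : par (f v) (g v) by have := H 0; rewrite scale0r addr0.
have Hvu : par (f (v + u)) (g (v + u)) by have := H 1; rewrite scale1r.
have zz (h : V -> W) : lmap h -> (forall t, h (v + t *: u) <> 0) ->
    par (h (v + u)) (h v) -> h u = 0.
  move=> hL nzh [c c0 /(lmapK hL)[a]].
  have -> : v + u + a *: v = (1 + a) *: v + 1 *: u by vring.
  move=> E; have := lmap_nozero hL nzh E => a1.
  by move: E; rewrite a1 scale0r add0r scale1r.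
have [fu0|fu0] := eqVneq (f u) 0.
  rewrite fu0 (zz g) //; first exact: par_refl.
  apply: par_trans (par_sym Hvu) _; apply: par_trans Hv.
  by rewrite addrC; apply: lmapD0.
have [gu0|gu0] := eqVneq (g u) 0.
  rewrite gu0 (zz f) //; first exact: par_refl.
  apply: par_trans Hvu _; apply: par_trans (par_sym Hv).
  by rewrite addrC; apply: lmapD0.
have [c [d Egu]] : exists c d, g u = c *: f v + d *: f u.
  have [c [d E]] : exists c d, g u = c *: g (v + u) + d *: g v.
    have [c [d E]] := lmap_comb gL (v + u) v 1 (-1).
    by exists c, d; rewrite -E; congr g; vring.
  have [x _ Ex] := par_sym Hv; have [y _ Ey] := par_sym Hvu.
  have [p [q Epq]] := lmapD fL v u.
  exists (c * y * p + d * x), (c * y * q).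
  by rewrite E Ey Ex Epq; vring.
have [a [b]] := lmapO fL v u c d; rewrite -Egu => P.
have [a0|a0] := eqVneq a 0.
  move: P; rewrite a0 scale0r add0r => P; apply: (par_trans _ P).
  apply: par_sym; apply: lmapZ => //; apply/eqP => b0.
  move: P; rewrite b0 scale0r (lmap0 fL) => /par_sym/par0/eqP.
  by rewrite (negPf gu0).
have P' : par (g (v + (b / a) *: u)) (g u).
  apply: par_trans (par_sym (H _)) _; apply: par_trans P.
  apply: par_trans (par_sym (lmapZ fL _ a0)) _.
  have -> : a *: (v + (b / a) *: u) = a *: v + b *: u by vfield.
  exact: par_refl.
have [e e0 /(lmapK gL)[x]] := P'.
have -> : v + (b / a) *: u + x *: u = v + (b / a + x) *: u by vring.
by move/nzg.
Qed.

Lemma lmap_inj_par f : lmap f -> (forall v, f v = 0 -> v = 0) ->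
  forall u v c, f u = c *: f v -> exists c', u = c' *: v.
Proof.
move=> fL f0 u v c /(lmapK fL)[a /f0 E]; exists (- a).
by apply: (lincomb1 (c := 1) E); vring.
Qed.

Lemma lmap_span f s x : lmap f -> x \in <<s>>%VS -> f x \in <<map f s>>%VS.
Proof.
move=> fL; elim: s x => [|v s IH] x /=.
  by rewrite !span_nil memv0 => /eqP->; rewrite (lmap0 fL) mem0v.
rewrite !span_cons => /memv_addP[y /vlineP[a ->] [z zs ->]].
have [b [c]] := lmap_comb fL v z a 1; rewrite scale1r => ->.
by apply: memv_add; apply: memvZ; [apply: memv_line|apply: IH].
Qed.

Lemma lmap_span_onto f s w : lmap f -> w \in <<map f s>>%VS ->
  exists2 x, x \in <<s>>%VS & par (f x) w.
Proof.
move=> fL; elim: s w => [|v s IH] w /=.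
  rewrite span_nil memv0 => /eqP->; exists 0; rewrite ?mem0v //.
  by rewrite (lmap0 fL); apply: par_refl.
rewrite !span_cons => /memv_addP[y /vlineP[a ->] [z /IH[x xs [b b0 E]] ->]].
have [c [d P]] := lmapO fL v x a b^-1.
exists (c *: v + d *: x).
  by apply: memv_add; [apply: memvZ; apply: memv_line|apply: memvZ].
by apply: par_trans P _; rewrite E scalerA mulVf // scale1r; apply: par_refl.
Qed.

Lemma lmap_free f s : lmap f -> (forall v, f v = 0 -> v = 0) ->
  free s -> free (map f s).
Proof.
move=> fL f0; elim: s => [|v s IH] /=; first by rewrite !nil_free.
rewrite !free_cons => /andP[vs /IH ->]; rewrite andbT.
apply: contra vs => /(lmap_span_onto fL)[x xs /par_sym[c _ E]].
by have [c' ->] := lmap_inj_par fL f0 E; apply: memvZ.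
Qed.

(** The image of a basis stays free, so it spans by the equality of dimensions, and combinations of
    it are lifted by [lmapO]. *)
Lemma lmap_surj f : lmap f -> (forall v, f v = 0 -> v = 0) ->
  \dim {:V} = \dim {:W} -> forall w, exists v, par (f v) w.
Proof.
move=> fL f0 dimE w.
have fr := lmap_free fL f0 (basis_free (vbasisP {:V})).
have fw : w \in <<map f (vbasis {:V})>>%VS.
  suff -> : <<map f (vbasis {:V})>>%VS = fullv by rewrite memvf.
  apply/eqP; rewrite eqEdim subvf -dimE.
  by move: fr; rewrite /free size_map size_tuple => /eqP ->; rewrite leqnn.
by have [x _ P] := lmap_span_onto fL fw; exists x.
Qed.

End Agree.

(** Factors are not determined, so the inverse is chosen vector by vector. Passing to it exchanges
    the roles of [lmapD] and [lmapO]. *)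
Lemma lmap_inv (F : fieldType) (V W : vectType F) (f : V -> W) : lmap f ->
  (forall v, f v = 0 -> v = 0) -> (forall w, exists v, par (f v) w) ->
  exists g : W -> V, [/\ lmap g, forall w, g w = 0 -> w = 0,
    forall w, par (f (g w)) w & forall v, par (g (f v)) v].
Proof.
move=> fL f0 /choice[g fg].
have inj u v : par (f u) (f v) -> par u v.
  move=> P; have [u0|u0] := eqVneq u 0.
    move: P; rewrite u0 (lmap0 fL) => /par_sym/par0/f0 ->; exact: par_refl.
  have [c _ E] := P.
  by have [c' E'] := lmap_inj_par fL f0 E; apply: par_scale E'.
have g0 w : g w = 0 -> w = 0.
  by move=> E; have := fg w; rewrite E (lmap0 fL) => /par_sym/par0.
have gf v : par (g (f v)) v by apply: inj; apply: fg.
have gP w w' : par w w' -> par (g w) (g w').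
  by move=> P; apply: inj; apply: par_trans (fg w) _; apply: par_trans P _;
    apply: par_sym.
have gc u v a b c d : par (f (a *: g u + b *: g v)) (c *: u + d *: v) ->
    par (g (c *: u + d *: v)) (a *: g u + b *: g v).
  by move=> P; apply: par_trans (gf _); apply: gP; apply: par_sym.
have g00 : g 0 = 0 by apply: f0; apply: par0; apply: fg.
have fP w w' : par w w' -> par (f w) (f w') by case=> a a0 ->; apply: lmapZ.
have comb u v c d : exists a b, par (g (c *: u + d *: v)) (a *: g u + b *: g v).
  have [x _ Ex] := par_sym (fg u); have [y _ Ey] := par_sym (fg v).
  have [a [b P]] := lmapO fL (g u) (g v) (c * x) (d * y).
  exists a, b; apply: gc; apply: par_trans P _.
  by rewrite {2}Ex {2}Ey !scalerA; apply: par_refl.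
exists g; split=> //; split=> //.
- by move=> a v a0; apply: gP; apply: parZ.
- move=> u v; have [a [b [x _]]] := comb u v 1 1.
  rewrite !scale1r => ->; exists (x * a), (x * b); vring.
- move=> u v c E; have [u0|u0] := eqVneq (g u) 0.
    by exists 0; rewrite scale0r addr0.
  have [] : par u v.
    apply: par_trans (par_sym (fg u)) _; apply: par_trans (fg v).
    by apply: fP; apply: par_scale E.
  by move=> x _ ->; exists (- x); rewrite -[RHS]g00; congr g; vring.
- move=> u v c d; have [x [y E]] := lmap_comb fL (g u) (g v) c d.
  have [x' _ Ex] := fg u; have [y' _ Ey] := fg v.
  exists (x * x'), (y * y'); apply: gc; rewrite E Ex Ey !scalerA.
  exact: par_refl.
Qed.

(** * Spreading linearity from a subspace *)

Section Extend.
Variables (F : fieldType) (V W : vectType F) (f : V -> W).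
Hypothesis fL : lmap f.

(** As [u + y] is the sum of [u] and [y], and also of [e + y] and [u - e], its image is the meet of
    two lines, known once the image of [e + y] is. One normalization at [p] thus settles all [u]
    with [g u] independent of [g p]; for the others [q] is an intermediate stop. *)
Lemma lmap_extend_value (U : {vspace V}) (g : 'Hom(V, W)) p q y :
  (forall u, u \in U -> par (f u) (g u)) -> p \in U -> q \in U ->
  ind2 (g p) (g q) ->
  exists v, forall u, u \in U -> par (f (u + y)) (g u + v).
Proof.
move=> fg pU qU ipq.
have [[w [wU fw]]|nz] := pselect (exists w, w \in U /\ f (y + w) = 0).
  exists (- g w) => u uU.
  have -> : u + y = (y + w) + (u - w) by vring.
  apply: par_trans (lmapD0 fL _ fw) _.
  have -> : g u - g w = g (u - w) by rewrite homD homN.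
  by apply: fg; rewrite memvB.
have nzf u : u \in U -> f (u + y) != 0.
  by move=> uU; apply/eqP => E; apply: nz; exists u; rewrite addrC.
(* Otherwise [lmapK] would give a zero of [f] in [y + U], the case treated before. *)
have fyU u : u \in U -> f y <> g u.
  move=> uU E; have [c c0 Ec] := par_sym (fg _ uU).
  have [a] := lmapK fL (etrans E Ec) => Ea; apply: nz; exists (a *: u).
  by rewrite memvZ.
have gp0 := ind2_neq0 ipq.
have [a [b [a0 b0 E]]] : exists a b, [/\ a != 0, b != 0 &
    f (p + y) = a *: g p + b *: f y].
  have [a [b E]] := lmapD fL p y; have [c c0 Ec] := fg _ pU.
  exists (a * c), b; split; last by rewrite E Ec scalerA.
    apply/eqP => a0; have [x [y' E']] := lmap_comb fL (p + y) y 1 (-1).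
    have Ep : g p = (c^-1 * (x * b + y')) *: f y.
      have -> : g p = c^-1 *: f p by rewrite Ec; vfield.
      have -> : f p = x *: f (p + y) + y' *: f y by rewrite -E'; congr f; vring.
      rewrite E Ec; apply: (@lincomb1 _ _ _ _ ((a * c) *: g p) 0 (c^-1 * x)).
        by rewrite a0 scale0r.
      by vring.
    set k := c^-1 * _ in Ep; have k0 : k != 0.
      by apply: contraNneq gp0 => k0; rewrite Ep k0 scale0r.
    by apply: (fyU (k^-1 *: p)); rewrite ?memvZ // homZ Ep; vfield.
  apply/eqP => b0; move: E; rewrite b0 scale0r addr0 => /(lmapK fL)[x Ex].
  apply: nz; exists ((1 + x) *: p); rewrite memvZ //; split=> //.
  by rewrite -Ex; congr f; vring.
(* The factor is the one that makes [f (p + y)] equal to [a *: (g p + v)]. *)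
pose v := (b / a) *: f y.
have Pp : par (f (p + y)) (g p + v).
  by exists a => //; rewrite E /v; vfield.
have vU u : u \in U -> v <> g u.
  move=> uU E'; apply: (fyU ((a / b) *: u)); first by rewrite memvZ.
  by rewrite homZ -E' /v; vfield; rewrite a0 b0.
have Pyv : par (f y) v.
  by apply: par_sym; apply: parZ; rewrite mulf_neq0 ?invr_eq0.
have key e u : e \in U -> u \in U -> par (f (e + y)) (g e + v) ->
    ind2 (g e) (g u) -> par (f (u + y)) (g u + v).
  move=> eU uU [c c0 Ee] i.
  have [al [be E1]] := lmapD fL u y.
  have [x _ Ex] := fg _ uU; have [x' _ Ex'] := Pyv.
  have [ga [de E2]] := lmapD fL (e + y) (u - e).
  have [x'' _ Ex''] : par (f (u - e)) (g u - g e).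
    by rewrite -homN -homD; apply: fg; rewrite memvB.
  have i3 : ind3 (g e) (g u) v.
    apply: ind3_comb => // -[s [t Ev]]; apply: (vU (s *: e + t *: u)).
      by rewrite memvD ?memvZ.
    by rewrite homD !homZ.
  have [] : [/\ ga * c - de * x'' = 0, de * x'' - al * x = 0
       & ga * c - be * x' = 0].
    apply: i3.
    have E3 : f (u + y) = f (e + y + (u - e)) by congr f; vring.
    move: E3; rewrite E1 E2 Ee Ex Ex' Ex'' => E3.
    by apply: (lincomb1 (c := -1) E3); vring.
  move=> z1 z2 z3.
  have Ef : f (u + y) = (al * x) *: (g u + v).
    rewrite E1 Ex Ex'; apply: (lincomb1 (c := 1) (l := (be * x' - al * x) *: v) (r := 0)); last by vring.
    have -> : be * x' - al * x = (ga * c - de * x'') + (de * x'' - al * x) - (ga * c - be * x') by ring.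
    by rewrite z1 z2 z3; vring.
  by apply: par_scale Ef; apply: nzf.
exists v => u uU.
have [gu0|gu0] := eqVneq (g u) 0.
  rewrite gu0 add0r; apply: par_trans Pyv; apply: lmapD0 => //.
  by apply: par0; rewrite -gu0; apply: fg.
have [[c Ec]|H] := pselect (exists c, g p = c *: g u); last first.
  by apply: (key p) => //; apply: nind2.
(* Here [g u] is proportional to [g p], so the value is carried from [p] to [q] and from [q] to
   [u]. *)
apply: (key q) => //; first exact: (key p).
move=> s t Es; have c0 : c != 0.
  by apply: contraNneq gp0 => c0; rewrite Ec c0 scale0r.
have [|t0 s0] := ipq (t / c) s.
  by rewrite Ec -Es; vfield.
split=> //; move/eqP: t0; rewrite mulf_eq0 invr_eq0 (negPf c0) orbF.
by move/eqP.
Qed.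

Lemma lmap_extend_line (U : {vspace V}) (g : 'Hom(V, W)) p q y :
  (forall u, u \in U -> par (f u) (g u)) -> p \in U -> q \in U ->
  ind2 (g p) (g q) -> y \notin U ->
  exists2 h : 'Hom(V, W), forall u, u \in U -> h u = g u &
    forall u, u \in (U + <[y]>)%VS -> par (f u) (h u).
Proof.
move=> fg pU qU ipq yU.
have [v Pv] := lmap_extend_value y fg pU qU ipq.
have [phi phiL [phi1 phi0]] := separating_form yU.
have [h hE] : exists h : 'Hom(V, W), forall x, h x = g x + phi x *: (v - g y).
  apply: hom_of_linear => a u w.
  by rewrite phiL homD homZ; vring.
have hU u : u \in U -> h u = g u.
  by move=> uU; rewrite hE phi0 // scale0r addr0.
have hy : h y = v by rewrite hE phi1; vring.
exists h => // x /memv_addP[u uU [z /vlineP[t ->] ->]].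
have [->|t0] := eqVneq t 0; first by rewrite scale0r addr0 hU //; apply: fg.
have -> : u + t *: y = t *: (t^-1 *: u + y) by vfield.
apply: par_trans (lmapZ fL _ t0) _; rewrite homZ.
apply: par_trans (par_sym (parZ _ t0)).
rewrite homD hy hU; last by rewrite memvZ.
by apply: Pv; rewrite memvZ.
Qed.

(** Linearity on [U] with two independent images leaves no room for a field automorphism, so it
    spreads to the whole space, one vector at a time. This takes the place of the fundamental
    theorem. *)
Lemma lmap_extend (U : {vspace V}) (g : 'Hom(V, W)) p q :
  (forall u, u \in U -> par (f u) (g u)) -> p \in U -> q \in U ->
  ind2 (g p) (g q) ->
  exists2 h : 'Hom(V, W), forall u, u \in U -> h u = g u &
    forall u, par (f u) (h u).
Proof.
move=> fg pU qU ipq.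
have [k] := ubnP (\dim {:V} - \dim U).
elim: k => // k IH in U g fg pU qU ipq *; rewrite ltnS => le.
have [Uf|] := eqVneq U fullv.
  by exists g => // u; apply: fg; rewrite Uf memvf.
move=> Uf; have [y yU] : exists y, y \notin U.
  have : ~~ (fullv <= U)%VS by move: Uf; rewrite eqEsubv subvf.
  by case/subvPn=> y _; exists y.
have [h hU hP] := lmap_extend_line fg pU qU ipq yU.
have sU : (U <= U + <[y]>)%VS by apply: addvSl.
have ltU : (\dim U < \dim (U + <[y]>))%N.
  rewrite ltnNge; apply: contra yU => leU.
  have /eqP -> : U == (U + <[y]>)%VS by rewrite eqEdim sU.
  by apply: (subvP (addvSr U <[y]>)); apply: memv_line.
have [] := IH _ h hP _ _ _ _.
- by apply: (subvP sU).
- by apply: (subvP sU).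
- by rewrite !hU.
- apply: leq_trans le; apply: ltn_sub2l => //.
  by apply: leq_trans ltU (dimvS (subvf _)).
move=> h' h'U h'P; exists h' => // u uU; rewrite h'U ?hU //.
by apply: (subvP sU).
Qed.
End Extend.

(** * Collinear triples of maps *)

Section Dim3.
Variables (F : fieldType) (V : vectType F).
Implicit Types (U : {vspace V}) (u v w x : V).

Lemma ind4_comb u v w x : ind3 u v w ->
  ~ (exists a b c, x = a *: u + b *: v + c *: w) -> ind4 u v w x.
Proof.
move=> i H a b c d E.
have d0 : d = 0.
  apply/eqP/negPn/negP => d0; apply: H.
  exists (- a / d), (- b / d), (- c / d).
  by apply: (lincomb1 (c := d^-1) E); vfield.
by move: E; rewrite d0 scale0r addr0 => /i[].
Qed.

Lemma dim_pair_le u v : (\dim (<[u]> + <[v]>) <= 2)%N.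
Proof.
apply: leq_trans (dimv_add_leqif _ _).1 _.
by rewrite !dim_vline; case: (u != 0); case: (v != 0).
Qed.

Lemma notin_line_pair U u v : (2 < \dim U)%N ->
  exists2 w, w \in U & ~ (exists a b, w = a *: u + b *: v).
Proof.
move=> dU; have : ~~ (U <= <[u]> + <[v]>)%VS.
  apply/negP => /dimvS; rewrite leqNgt; move/negP; apply.
  exact: leq_ltn_trans (dim_pair_le u v) dU.
case/subvPn=> w wU H; exists w => // -[a [b E]]; case/negP: H.
by rewrite E memv_add ?memvZ ?memv_line.
Qed.

Lemma ind3_extend U x : (2 < \dim U)%N -> x != 0 ->
  exists u v, [/\ u \in U, v \in U & ind3 x u v].
Proof.
move=> dU x0; have [u uU Hu] := notin_line_pair x 0 dU.
have [v vU Hv] := notin_line_pair x u dU.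
exists u, v; split=> //; apply: ind3_comb => //.
apply: ind2C; apply: nind2 => // -[c E]; apply: Hu.
by exists c, 0; rewrite scaler0 addr0.
Qed.

Lemma ind3_free u v w : ind3 u v w -> free [:: u; v; w].
Proof.
move=> i; have i2 := ind3_ind2r i.
have w0 : w != 0 by apply: ind2_neq0 (ind2C i2).
rewrite !free_cons nil_free span_nil memv0 w0 /= andbT; apply/andP; split.
  apply/negP; rewrite !span_cons span_nil addv0.
  move=> /memv_addP[v' /vlineP[b ->] [w' /vlineP[c ->] E]].
  have [|/eqP] := i 1 (- b) (- c); last by rewrite oner_eq0.
  by rewrite E; vring.
apply/negP; rewrite !span_cons span_nil addv0 => /vlineP[c E].
have [|/eqP] := i2 1 (- c); last by rewrite oner_eq0.
by rewrite E; vring.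
Qed.

Lemma ind3_span U u v w z : \dim U = 3 -> u \in U -> v \in U -> w \in U ->
  ind3 u v w -> z \in U -> exists a b c, z = a *: u + b *: v + c *: w.
Proof.
move=> dU uU vU wU i zU; have fr := ind3_free i.
have sU : (<<[:: u; v; w]>> <= U)%VS.
  by apply/span_subvP => y; rewrite !inE => /or3P[] /eqP ->.
have /eqP eU : <<[:: u; v; w]>>%VS == U.
  by rewrite eqEdim sU dU; move/eqP: fr => ->.
move: zU; rewrite -eU !span_cons span_nil addv0.
case/memv_addP=> x /vlineP[a ->] [y /memv_addP[x' /vlineP[b ->] [y']]].
by move=> /vlineP[c ->] -> ->; exists a, b, c; rewrite addrA.
Qed.

End Dim3.

Section Skew.
Variables (F : fieldType) (V W : vectType F).
Implicit Types f g h : V -> W.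

(** All three relations are kept so that degenerate cases stay meaningful: if two of the vectors are
    independent, the third differs from both as a point, and if one vanishes, the other two are
    proportional. *)
Definition collinear_maps f g h := forall x, 
  [/\ exists a b, f x = a *: g x + b *: h x,
      exists a b, g x = a *: f x + b *: h x &
      exists a b, h x = a *: f x + b *: g x].

Lemma hom_of_pair (p q : V) (v w : W) : ind2 p q ->
  exists g : 'Hom(V, W), g p = v /\ g q = w.
Proof.
move=> i.
have np : p \notin <[q]>%VS by apply/negP => /vlineP[c]; apply: ind2_nscale.
have nq : q \notin <[p]>%VS.
  by apply/negP => /vlineP[c]; apply: ind2_nscale; apply: ind2C.
have [phi phiL [phi1 phi0]] := separating_form np.
have [psi psiL [psi1 psi0]] := separating_form nq.
have [h hE] : exists h : 'Hom(V, W), forall x, h x = phi x *: v + psi x *: w.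
  apply: hom_of_linear => a x y.
  by rewrite phiL psiL; vring.
exists h; rewrite !hE phi1 psi1 phi0 ?psi0 ?memv_line //.
by split; vring.
Qed.

(* The lines joining corresponding points of [f] and [g] form a regulus, because
   [h] maps the line <p, q> to a third transversal. *)
Lemma skew_linear f g h p q : lmap f -> lmap g -> lmap h ->
  collinear_maps f g h -> ind2 p q ->
  (forall f0 : 'Hom(V, W), (forall s t, par (f (s *: p + t *: q)) (f0 (s *: p + t *: q))) ->
   ind4 (f0 p) (f0 q) (g p) (g q) ->
   exists g0 : 'Hom(V, W), [/\ forall s t, par (g (s *: p + t *: q)) (g0 (s *: p + t *: q)),
     par (g p) (g0 p) & par (g q) (g0 q)]).
Proof.
move=> fL gL hL col ipq f0 ff0 i4.
have fp : par (f p) (f0 p) by have := ff0 1 0; rewrite scale1r scale0r addr0.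
have fq : par (f q) (f0 q) by have := ff0 0 1; rewrite scale1r scale0r add0r.
have coefs x y z (u v w : W) : par y u -> ind2 u z ->
   (exists a b, x = a *: y + b *: z) -> (exists a b, y = a *: x + b *: z) ->
   (exists a b, z = a *: y + b *: x) ->
   exists a b, [/\ a != 0, b != 0 & x = a *: u + b *: z].
  move=> [c c0 yu] i [a [b E]] [a' [b' E']] [a'' [b'' E'']].
  exists (a * c), b; split; last by rewrite E yu scalerA.
    apply/eqP => a0; apply: (@ind2_nscale _ _ u z (c^-1 * (a' * b + b'))) => //.
    have -> : u = c^-1 *: y by rewrite yu; vfield.
    rewrite E' E yu.
    apply: (@lincomb1 _ _ _ _ ((a * c) *: u) 0 (c^-1 * a')).
      by rewrite a0 scale0r.
    by vring.
  apply/eqP => b0; apply: (@ind2_nscale _ _ z u (a'' * c + b'' * a * c)).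
    exact: ind2C.
  by rewrite {1}E'' E b0 yu; vring.
have ifg : ind2 (f0 p) (g p).
  move=> a b E; have [|-> _ -> _ //] := i4 a 0 b 0.
  by rewrite -E; vring.
have ifq : ind2 (f0 q) (g q).
  move=> a b E; have [|_ -> _ -> //] := i4 0 a 0 b.
  by rewrite -E; vring.
have cc x (u : W) : par (f x) u -> ind2 u (g x) ->
    exists a b, [/\ a != 0, b != 0 & h x = a *: u + b *: g x].
  move=> P i; have [c1 c2 c3] := col x; apply: coefs P i c3 _ _ => //.
    by case: c1 => a [b E]; exists b, a; rewrite addrC.
have [a [b [a0 b0 Ep]]] := cc _ _ fp ifg.
have [a' [b' [a0' b0' Eq]]] := cc _ _ fq ifq.
(* The factor is forced: if the part of [h (p + r *: q)] in the span of [f0 p] and [f0 q] is a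
   multiple of [f0 (p + r *: q)], then the remaining part is the same multiple of
   [(b / a) *: g p + (r * b' / a') *: g q]. *)
have [g0 [g0p g0q]] := hom_of_pair (g p) ((b' / a' / (b / a)) *: g q) ipq.
have gp : par (g p) (g0 p) by rewrite g0p; apply: par_refl.
have gq : par (g q) (g0 q).
  by rewrite g0q; apply: par_sym; apply: parZ; nz.
exists g0; split=> // s t.
have [->|s0] := eqVneq s 0.
  have [->|t0] := eqVneq t 0.
    by rewrite !scale0r !addr0 (lmap0 gL) hom0; apply: par_refl.
  rewrite !scale0r !add0r homZ; apply: par_trans (lmapZ gL _ t0) _.
  by apply: par_trans gq _; apply: par_sym; apply: parZ.
pose r := t / s.
have -> : s *: p + t *: q = s *: (p + r *: q) by rewrite /r; vfield.
apply: par_trans (lmapZ gL _ s0) _; rewrite homZ.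
apply: par_trans (par_sym (parZ _ s0)).
have [k [l Eh]] : exists k l, h (p + r *: q) = k *: f0 (p + r *: q) + l *: g (p + r *: q).
  have [_ _ [k [l ->]]] := col (p + r *: q).
  have [c _] := ff0 1 r; rewrite scale1r => ->.
  by exists (k * c), l; rewrite scalerA.
have [x [y Eh']] : exists x y, h (p + r *: q) = x *: h p + y *: h q.
  by have := lmap_comb hL p q 1 r; rewrite scale1r.
have [c [d Eg]] : exists c d, g (p + r *: q) = c *: g p + d *: g q.
  by have := lmap_comb gL p q 1 r; rewrite scale1r.
have [z1 z2 z3 z4] : [/\ x * a - k = 0, y * a' - k * r = 0, x * b - l * c = 0
    & y * b' - l * d = 0].
  apply: i4; move: Eh'; rewrite Eh Eg Ep Eq homD homZ => E.
  by apply: (lincomb1 (c := -1) E); vring.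
(* For [k = 0] the vector [h (p + r *: q)] vanishes, so that [f0 (p + r *: q)] is a multiple of
   [g (p + r *: q)], against independence. *)
have k0 : k != 0.
  apply/eqP => k0; move: z1 z2; rewrite k0 !mul0r !subr0.
  move=> /eqP; rewrite mulf_eq0 (negPf a0) orbF => /eqP x0.
  move=> /eqP; rewrite mulf_eq0 (negPf a0') orbF => /eqP y0.
  have [[m [n E]] _ _] := col (p + r *: q).
  have [e e0] := ff0 1 r; rewrite scale1r E Eh' x0 y0 Eg homD homZ => E'.
  have [|/eqP] := i4 e (e * r) (- (m * c)) (- (m * d)).
    by apply: (lincomb1 (c := -1) E'); vring.
  by rewrite (negPf e0).
have Ex : x = k / a by rewrite -[k](subrK (x * a)) -opprB z1; field.
have Ey : y = k * r / a' by rewrite -[k * r](subrK (y * a')) -opprB z2; field.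
have l0 : l != 0.
  apply/eqP => l0; move: z3; rewrite l0 Ex mul0r subr0 => /eqP.
  by rewrite !mulf_eq0 invr_eq0 (negPf k0) (negPf a0) (negPf b0).
have Ec : c = k * b / (a * l).
  have E : l * c = x * b by apply/esym/eqP; rewrite -subr_eq0 z3.
  have -> : c = l^-1 * (l * c) by field.
  by rewrite E Ex; field; nz.
have Ed : d = k * r * b' / (a' * l).
  have E : l * d = y * b' by apply/esym/eqP; rewrite -subr_eq0 z4.
  have -> : d = l^-1 * (l * d) by field.
  by rewrite E Ey; field; nz.
exists (k * b / (a * l)); first by nz.
by rewrite Eg Ec Ed homD homZ g0p g0q; vfield; rewrite ?a0 ?b0 ?a0' ?l0.
Qed.

End Skew.

Section Dichotomy.
Variables (F : fieldType) (V W : vectType F).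
Variables (f0 : 'Hom(V, W)) (g : V -> W) (U : {vspace V}).
Hypotheses (gL : lmap g) (dU : \dim U = 3).
Hypothesis f0U : forall x, x \in U -> f0 x = 0 -> x = 0.
Hypothesis gU : forall x, x \in U -> g x = 0 -> x = 0.
Local Notation I := (f0 @: U)%VS.

Let f0_inj x y : x \in U -> y \in U -> f0 x = f0 y -> x = y.
Proof.
move=> xU yU E; have : x - y = 0.
  by apply: f0U; rewrite ?memvB // homD homN E subrr.
by move/eqP; rewrite subr_eq0 => /eqP.
Qed.

Let f0_ind2 x y : x \in U -> y \in U -> ind2 x y -> ind2 (f0 x) (f0 y).
Proof.
move=> xU yU i a b E; apply: i; apply: f0U; rewrite ?memvD ?memvZ //.
by rewrite homD !homZ.
Qed.

Lemma lmap_img_case x1 w : x1 \in U -> w \in U -> ind2 x1 w -> g x1 \notin I ->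
  ~ ind4 (f0 x1) (f0 w) (g x1) (g w) -> 
  exists a b c, g w = a *: f0 x1 + b *: f0 w + c *: g x1.
Proof.
move=> x1U wU i nI n4; apply: contrapT => H; apply: n4.
apply: ind4_comb => //; apply: ind3_comb; first exact: f0_ind2.
move=> [a [b E]]; case/negP: nI.
by rewrite E memvD ?memvZ ?memv_img.
Qed.

(** As the images are not skew, the line of [g x1] and [g u1] meets [I], and by [lmapO] the meeting
    point is a value of [g]. It is not taken at [x1], whence the nonzero coefficient of [u1]. *)
Lemma lmap_img_shift x1 u1 : x1 \in U -> u1 \in U -> ind2 x1 u1 -> g x1 \notin I ->
  ~ ind4 (f0 x1) (f0 u1) (g x1) (g u1) ->
  exists a b, a != 0 /\ g (a *: u1 + b *: x1) \in I.
Proof.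
move=> x1U wU i nI n4; have [a [b [c E]]] := lmap_img_case x1U wU i nI n4.
have [a' [b' P]] := lmapO gL u1 x1 1 (- c).
have [k k0 Ek] := P.
exists a', b'; split; last first.
  rewrite Ek memvZ // E scale1r.
  have -> : a *: f0 x1 + b *: f0 u1 + c *: g x1 + - c *: g x1 =
    a *: f0 x1 + b *: f0 u1 by vring.
  by rewrite memvD ?memvZ ?memv_img.
apply/eqP => a0; move: Ek; rewrite a0 scale0r add0r.
have [->|b0] := eqVneq b' 0.
  rewrite scale0r (lmap0 gL) => /esym/scaler_eq0_or[/eqP|].
    by rewrite (negPf k0).
  rewrite scale1r => Eu.
  have [] := lmapK gL (u := u1) (v := x1) (c := c).
    by apply: (lincomb1 (c := 1) Eu); vring.
  move=> d Ed; have [|_ /eqP] := i d 1; last by rewrite oner_eq0.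
  rewrite addrC scale1r; apply: gU => //.
  by rewrite memvD ?memvZ.
move=> E'; case/negP: nI; have [d d0 Ed] := lmapZ gL x1 b0.
have -> : g x1 = (d^-1 * k) *: (a *: f0 x1 + b *: f0 u1).
  have -> : g x1 = d^-1 *: g (b' *: x1) by rewrite Ed; vfield.
  by rewrite E' E; vfield.
by rewrite memvZ // memvD ?memvZ ?memv_img.
Qed.

(** If no images are skew, two lines of [U] through [x] contain points [u] and [v] that [g] maps
    into [I], and then [g] maps their whole line into [I]. For [w] on it and [g x1] outside [I], the
    vector [g w] lies in [I] and in the span of [f0 x1], [f0 w] and [g x1], hence in that of [f0 x1]
    and [f0 w]. Two choices of [x1] leave only multiples of [f0 w]. *)
Lemma lmap_dichotomy : (exists2 x, x \in U & g x \notin I) ->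
  (exists p q, [/\ p \in U, q \in U & ind4 (f0 p) (f0 q) (g p) (g q)]) \/
  (exists u v x, [/\ [/\ u \in U, v \in U & x \in U], ind3 u v x,
     forall s t, par (g (s *: u + t *: v)) (f0 (s *: u + t *: v)) &
     g x \notin I]).
Proof.
move=> [x xU gx]; have [|nex] := pselect (exists p q,
  [/\ p \in U, q \in U & ind4 (f0 p) (f0 q) (g p) (g q)]); first by left.
right; have n4 p q : p \in U -> q \in U -> ~ ind4 (f0 p) (f0 q) (g p) (g q).
  by move=> pU qU i4; apply: nex; exists p, q.
have x0 : x != 0 by apply: contraNneq gx => ->; rewrite (lmap0 gL) mem0v.
have [|u1 [v1 [u1U v1U i3]]] := @ind3_extend _ _ U x _ x0; first by rewrite dU.
have [a [b [a0 uI]]] := lmap_img_shift xU u1U (ind3_ind2 i3) gx (n4 _ _ xU u1U).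
have [c [d [c0 vI]]] := lmap_img_shift xU v1U (ind3_ind2s i3) gx (n4 _ _ xU v1U).
set u := a *: u1 + b *: x in uI; set v := c *: v1 + d *: x in vI.
have uU : u \in U by rewrite memvD ?memvZ.
have vU : v \in U by rewrite memvD ?memvZ.
have iuvx : ind3 u v x.
  move=> k l m E; have [|_ /eqP + /eqP] := i3 (k * b + l * d + m) (k * a) (l * c).
    by rewrite -E /u /v; vring.
  rewrite !mulf_eq0 (negPf a0) (negPf c0) !orbF => /eqP k0 /eqP l0.
  split=> //; move: E; rewrite k0 l0 !scale0r !add0r => /scaler_eq0_or[] // E.
  by rewrite E eqxx in x0.
exists u, v, x; split=> // s t; move Ew : (s *: u + t *: v) => w.
have [->|w0] := eqVneq w 0.
  by rewrite (lmap0 gL) hom0; apply: par_refl.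
have wU : w \in U by rewrite -Ew memvD ?memvZ.
have combI k l : g (k *: u + l *: v) \in I.
  by have [k' [l' ->]] := lmap_comb gL u v k l; rewrite memvD ?memvZ.
have wI : g w \in I by rewrite -Ew; apply: combI.
have key x1 : x1 \in U -> ind2 x1 w -> g x1 \notin I ->
    exists al be, g w = f0 (al *: x1 + be *: w).
  move=> x1U i nI; have [al [be [ga E]]] := lmap_img_case x1U wU i nI (n4 _ _ x1U wU).
  exists al, be; rewrite homD !homZ; have [ga0|ga0] := eqVneq ga 0.
    by rewrite E ga0; vring.
  case/negP: nI; have -> : g x1 = ga^-1 *: (g w - f0 (al *: x1 + be *: w)).
    by rewrite E homD !homZ; vfield.
  by rewrite memvZ // memvB // memv_img // memvD ?memvZ.
have [w' [k [l [Ew' iw]]]] : exists w' k l, w' = k *: u + l *: v /\ ind3 w w' x.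
  have [t0|t0] := eqVneq t 0.
    have s0 : s != 0.
      by apply: contraNneq w0 => s0; rewrite -Ew s0 t0 !scale0r addr0.
    exists v, 0, 1; split; first by rewrite scale0r add0r scale1r.
    move=> k l m E; have [|/eqP + E2 E3] := iuvx (k * s) (k * t + l) m.
      by rewrite -E -Ew; vring.
    rewrite mulf_eq0 (negPf s0) orbF => /eqP k0.
    by move: E2; rewrite k0 mul0r add0r.
  exists u, 1, 0; split; first by rewrite scale0r addr0 scale1r.
  move=> k l m E; have [|E1 /eqP + E3] := iuvx (k * s + l) (k * t) m.
    by rewrite -E -Ew; vring.
  rewrite mulf_eq0 (negPf t0) orbF => /eqP k0.
  by move: E1; rewrite k0 mul0r add0r.
have w'U : w' \in U by rewrite Ew' memvD ?memvZ.
have [al [be E1]] := key x xU (ind2C (ind3_ind2s iw)) gx.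
(* The second choice of [x1], outside the span of [x] and [w]. *)
have gxw : g (x + w') \notin I.
  apply: contra gx => gxw.
  have [m [n E]] := lmap_comb gL (x + w') w' 1 (-1).
  have -> : x = 1 *: (x + w') + (-1) *: w' by vring.
  by rewrite E memvD ?memvZ // Ew'.
have [] := key (x + w') _ _ gxw; first by rewrite memvD.
  by move=> m n E; have [|-> _ ->] := iw n m m; rewrite // -E; vring.
move=> al' [be' E2].
have E : al *: x + be *: w = al' *: (x + w') + be' *: w.
  by apply: f0_inj; rewrite ?memvD ?memvZ ?memvD // -E1 -E2.
have [|_ al0 E3] := iw (be - be') (- al') (al - al').
  by apply: (lincomb1 (c := 1) E); vring.
have al'0 : al = 0.
  by apply/eqP; rewrite -[al](subrK al') E3 add0r -oppr_eq0 al0.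
apply: (par_scale (c := be)); last by rewrite E1 al'0 scale0r add0r homZ.
by apply: contra_neq w0; apply: gU.
Qed.

End Dichotomy.

Lemma ind4_par (F : fieldType) (V : vectType F) (u v w z w' z' : V) :
  ind4 u v w z -> par w w' -> par z z' -> ind4 u v w' z'.
Proof.
move=> i /par_sym[c c0 ->] /par_sym[d d0 ->] a b k l E.
have [|-> -> /eqP + /eqP] := i a b (k * c) (l * d); first by rewrite -E; vring.
by rewrite !mulf_eq0 (negPf c0) (negPf d0) !orbF => /eqP -> /eqP ->.
Qed.

Lemma ind4_source (F : fieldType) (V W : vectType F) (f : 'Hom(V, W)) p q w z :
  ind4 (f p) (f q) w z -> ind2 p q.
Proof.
move=> i a b E; have [|-> -> //] := i a b 0 0.
by rewrite !scale0r !addr0 -!homZ -homD E hom0.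
Qed.

Lemma mem_line_pair (F : fieldType) (V : vectType F) (p q u : V) :
  u \in (<[p]> + <[q]>)%VS -> exists s t, u = s *: p + t *: q.
Proof. by case/memv_addP=> x /vlineP[s ->] [y /vlineP[t ->] ->]; exists s, t. Qed.

Section Linearity.
Variables (F : fieldType) (V W : vectType F).
Variables (f0 : 'Hom(V, W)) (g h : V -> W) (U : {vspace V}).
Hypotheses (gL : lmap g) (hL : lmap h) (dU : \dim U = 3).
Hypothesis col : collinear_maps f0 g h.
Hypothesis f0U : forall x, x \in U -> f0 x = 0 -> x = 0.
Hypothesis gU : forall x, x \in U -> g x = 0 -> x = 0.
Hypothesis g_out : exists2 x, x \in U & g x \notin (f0 @: U)%VS.

(** Each case of the dichotomy gives linearity on one line of [U], and [lmap_extend] spreads it. The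
    case is kept in the conclusion because the values at further points of the line A_0 A_i are
    determined differently in the two cases. *)
Lemma collinear_linear : exists g0 : 'Hom(V, W), (forall x, par (g x) (g0 x)) /\
  ((exists p q, [/\ p \in U, q \in U & ind4 (f0 p) (f0 q) (g0 p) (g0 q)]) \/
   (exists u v x, [/\ [/\ u \in U, v \in U & x \in U], ind3 u v x,
     g0 u = f0 u, g0 v = f0 v & g0 x \notin (f0 @: U)%VS])).
Proof.
have [[p [q [pU qU i4]]]|] := lmap_dichotomy gL dU f0U gU g_out.
  have ipq := ind4_source i4.
  have [|g1 [g1P g1p g1q]] := skew_linear (hom_lmap f0) gL hL col ipq _ i4.
    by move=> s t; apply: par_refl.
  have i4' := ind4_par i4 g1p g1q.
  have [||||g0 g0U g0P] := @lmap_extend _ _ _ _ gL (<[p]> + <[q]>)%VS g1 p q.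
  - by move=> u /mem_line_pair[s [t ->]].
  - by apply: (subvP (addvSl _ _)); apply: memv_line.
  - by apply: (subvP (addvSr _ _)); apply: memv_line.
  - by move=> a b E; have [|_ _ -> ->] := i4' 0 0 a b; rewrite // !scale0r !add0r.
  exists g0; split=> //; left; exists p, q; split=> //.
  rewrite !g0U //; first by apply: (subvP (addvSr _ _)); apply: memv_line.
  by apply: (subvP (addvSl _ _)); apply: memv_line.
move=> [u [v [x [[uU vU xU] i3 gf gx]]]].
have uL : u \in (<[u]> + <[v]>)%VS.
  by apply: (subvP (addvSl _ _)); apply: memv_line.
have vL : v \in (<[u]> + <[v]>)%VS.
  by apply: (subvP (addvSr _ _)); apply: memv_line.
have [|//|//||g0 g0U g0P] := @lmap_extend _ _ _ _ gL (<[u]> + <[v]>)%VS f0 u v.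
- by move=> w /mem_line_pair[s [t ->]].
- move=> a b E; apply: (ind3_ind2 i3); apply: f0U; first by rewrite memvD ?memvZ.
  by rewrite homD !homZ.
exists g0; split=> //; right; exists u, v, x; split=> //; try exact: g0U.
apply: contra gx => gx; have [c _ ->] := g0P x. by rewrite memvZ.
Qed.

End Linearity.

(** * Maps collinear with two linear maps *)

Section NoCommonDirection.
Variables (F : fieldType) (V : vectType F).
Implicit Types A B P Q D : V.

(** After substitution of [A], the coefficients of [B] in the two relations are [a1 * r + b1] and
    [a2 * r + b2]. Both are nonzero by independence, but eliminating [B] shows that [1 - t] times
    their product vanishes. *)
Lemma no_common_direction_dep A B P Q D (t r s a1 b1 a2 b2 : F) : ind3 P Q D ->
  t != 0 -> t != 1 -> A = r *: B + s *: D ->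
  D = a1 *: (A + P) + b1 *: (B + Q) ->
  D = a2 *: (A + t *: P) + b2 *: (B + t *: Q) -> False.
Proof.
move=> i t0 t1 -> E1 E2.
have [] : [/\ (a2 * r + b2) * a1 - t * (a1 * r + b1) * a2 = 0,
    (a2 * r + b2) * b1 - t * (a1 * r + b1) * b2 = 0 &
    (a2 * r + b2) * (a1 * s - 1) - (a1 * r + b1) * (a2 * s - 1) = 0].
  apply: i.
  by apply: (lincomb2 (c := - (a2 * r + b2)) (c' := (a1 * r + b1)) E1 E2); vring.
move=> e1 e2 _.
have X1 : a1 * r + b1 <> 0.
  move=> X1; have [] : [/\ a1 = 0, b1 = 0 & a1 * s - 1 = 0].
    apply: i; apply: (lincomb2 (c := -1) (c' := -1) E1 (l' := (a1 * r + b1) *: B) (r' := 0)).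
      by rewrite X1 scale0r.
    by vring.
  by move=> -> _ /eqP; rewrite mul0r sub0r oppr_eq0 oner_eq0.
have X2 : a2 * r + b2 <> 0.
  move=> X2; have [] : [/\ t * a2 = 0, t * b2 = 0 & a2 * s - 1 = 0].
    apply: i; apply: (lincomb2 (c := -1) (c' := -1) E2 (l' := (a2 * r + b2) *: B) (r' := 0)).
      by rewrite X2 scale0r.
    by vring.
  move/eqP; rewrite mulf_eq0 (negPf t0) => /eqP -> _ /eqP.
  by rewrite mul0r sub0r oppr_eq0 oner_eq0.
have /eqP : (1 - t) * ((a1 * r + b1) * (a2 * r + b2)) = 0.
  have -> : (1 - t) * ((a1 * r + b1) * (a2 * r + b2)) =
    r * ((a2 * r + b2) * a1 - t * (a1 * r + b1) * a2) +
    ((a2 * r + b2) * b1 - t * (a1 * r + b1) * b2) by ring.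
  by rewrite e1 e2; ring.
rewrite !mulf_eq0 subr_eq0 eq_sym (negPf t1).
by case/orP=> // /orP[] /eqP.
Qed.

(** Modulo [D], the bivector of [A + s *: P] and [B + s *: Q] is a quadratic polynomial in [s] whose
    leading coefficient, the bivector of [P] and [Q], is nonzero. It cannot vanish at the three
    scalars 0, 1 and [t]; the proof carries out the elimination by hand. *)
Lemma no_common_direction A B P Q D (t : F) : ind3 P Q D -> t != 0 -> t != 1 ->
  (forall s : F, exists a b : F, D = a *: (A + s *: P) + b *: (B + s *: Q)) -> False.
Proof.
move=> i t0 t1 H; have [a [b E]] := H 0; have [a1 [b1 E1]] := H 1.
have [a2 [b2 E2]] := H t; rewrite !scale1r in E1; rewrite !scale0r !addr0 in E.
have [a0|a0] := eqVneq a 0; last first.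
  apply: (@no_common_direction_dep A B P Q D t (- (b / a)) a^-1 a1 b1 a2 b2) => //.
  by apply: (lincomb1 (c := - a^-1) E); vfield.
have [b0|b0] := eqVneq b 0.
  have [|_ _ /eqP] := i 0 0 1; last by rewrite oner_eq0.
  by rewrite {1}E a0 b0; vring.
have i' : ind3 Q P D by apply: ind3_swap.
apply: (@no_common_direction_dep B A Q P D t 0 b^-1 b1 a1 b2 a2) => //.
- by apply: (lincomb1 (c := - b^-1) E); rewrite a0; vfield.
- by rewrite addrC.
- by rewrite addrC.
Qed.

End NoCommonDirection.

Section Between.
Variables (F : fieldType) (V W : vectType F) (f g : 'Hom(V, W)) (h : V -> W).
Hypotheses (hL : lmap h) (col : collinear_maps f g h).
Variable t0 : F.
Hypotheses (t00 : t0 != 0) (t01 : t0 != 1).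

Lemma strictly_between x : ind2 (f x) (g x) ->
  exists a b, [/\ a != 0, b != 0 & h x = a *: f x + b *: g x].
Proof.
move=> i; have [[a1 [b1 E1]] [a2 [b2 E2]] [a [b E]]] := col x.
exists a, b; split=> //; apply/eqP => z; move: E; rewrite z scale0r ?add0r ?addr0 => E.
  by apply: (ind2_nscale (c := a1 + b1 * b) i); rewrite {1}E1 E; vring.
by apply: (ind2_nscale (c := a2 + b2 * a) (ind2C i)); rewrite {1}E2 E; vring.
Qed.

(* If h' = a f + b g on U, then the residual vector on the left, unchanged by
   y |-> y + x, lies in the span of f (y + x) and g (y + x) for all x in U. *)
Lemma between_residual (U : {vspace V}) (h' : 'Hom(V, W)) a b y x :
  (forall x, par (h x) (h' x)) ->
  (forall x, x \in U -> h' x = a *: f x + b *: g x) -> x \in U ->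
  exists k l, h' y - (a *: f y + b *: g y) = k *: f (y + x) + l *: g (y + x).
Proof.
move=> hh' hU xU; have [_ _ [k [l E]]] := col (y + x).
have [c c0 Ec] := par_sym (hh' (y + x)).
have := hU _ xU; move: Ec; rewrite E homD => Ec E'.
exists (c * k - a), (c * l - b).
move: Ec; rewrite E' !homD => Ec.
by apply: (lincomb1 (c := 1) Ec); vring.
Qed.

(** Four independent vectors allow comparing [h (p + q)], a combination of [f (p + q)] and
    [g (p + q)], with a combination of [h p] and [h q]: the ratio of the coefficients is the same at
    all three points. *)
Lemma between_skew_step p q a b : ind4 (f p) (f q) (g p) (g q) ->
  par (h p) (a *: f p + b *: g p) ->
  par (h q) (a *: f q + b *: g q) /\
  par (h (p + q)) (a *: f (p + q) + b *: g (p + q)).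
Proof.
move=> i [c c0 Ep].
have [a' [b' [_ _ Eq]]] : exists a b, [/\ a != 0, b != 0 & h q = a *: f q + b *: g q].
  apply: strictly_between => k l E; have [|_ -> _ -> //] := i 0 k 0 l.
  by rewrite -E; vring.
have [k [l [k0 l0 E]]] : exists k l, [/\ k != 0, l != 0 &
    h (p + q) = k *: f (p + q) + l *: g (p + q)].
  apply: strictly_between => k l; rewrite !homD => E; have [|-> _ -> _ //] := i k k l l.
  by rewrite -E; vring.
have [x [y E']] := lmapD hL p q.
have [e1 e2 e3 e4] : [/\ x * c * a - k = 0, y * a' - k = 0, x * c * b - l = 0 & y * b' - l = 0].
  apply: i; move: E'; rewrite Ep Eq E !homD => E'.
  by apply: (lincomb1 (c := -1) E'); vring.
move/eqP: e1; rewrite subr_eq0 => /eqP e1; move/eqP: e2; rewrite subr_eq0 => /eqP e2.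
move/eqP: e3; rewrite subr_eq0 => /eqP e3; move/eqP: e4; rewrite subr_eq0 => /eqP e4.
have x0 : x != 0 by apply: contraNneq k0 => x0; rewrite -e1 x0 !mul0r.
have y0 : y != 0 by apply: contraNneq k0 => y0; rewrite -e2 y0 !mul0r.
split.
  exists (x * c / y); first by nz.
  have -> : h q = y^-1 *: ((y * a') *: f q + (y * b') *: g q) by rewrite Eq; vfield.
  by rewrite e2 e4 -e1 -e3; vfield.
by exists (x * c); [nz|rewrite E -e1 -e3; vring].
Qed.

(** The ratio found at [p] holds on the line of [p] and [q], so [h] is linear there and has a linear
    extension [h']. At any [y], a nonzero residual [D] would by [no_common_direction] lie in the
    span of [f x] and [g x] both for x = p and for x = q; these two spans meet in 0 only. *)
Lemma between_skew p q : ind4 (f p) (f q) (g p) (g q) ->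
  exists a b, forall x, par (h x) (a *: f x + b *: g x).
Proof.
move=> i.
have [a [b [a0 b0 Ep]]] : exists a b, [/\ a != 0, b != 0 & h p = a *: f p + b *: g p].
  apply: strictly_between => k l E; have [|-> _ -> _ //] := i k 0 l 0.
  by rewrite -E; vring.
exists a, b.
have [u uE] : exists u : 'Hom(V, W), forall x, u x = a *: f x + b *: g x.
  by apply: hom_of_linear => c x y; rewrite !homD !homZ; vring.
have hp : par (h p) (u p) by rewrite uE Ep; apply: par_refl.
have hq : par (h q) (u q).
  by rewrite uE; apply: (between_skew_step i _).1; rewrite -uE.
have pU : p \in (<[p]> + <[q]>)%VS by apply: (subvP (addvSl _ _)); apply: memv_line.
have qU : q \in (<[p]> + <[q]>)%VS by apply: (subvP (addvSr _ _)); apply: memv_line.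
have [|//|//||h' h'U h'P] := @lmap_extend _ _ _ _ hL (<[p]> + <[q]>)%VS u p q.
- move=> x /mem_line_pair[s [t ->]].
  have [->|s0] := eqVneq s 0.
    rewrite scale0r add0r homZ; have [->|t1] := eqVneq t 0.
      by rewrite !scale0r (lmap0 hL); apply: par_refl.
    by apply: par_trans (lmapZ hL _ t1) _; apply: par_trans hq (par_sym (parZ _ t1)).
  have [->|t1] := eqVneq t 0.
    rewrite scale0r addr0 homZ.
    by apply: par_trans (lmapZ hL _ s0) _; apply: par_trans hp (par_sym (parZ _ s0)).
  rewrite uE; apply: (between_skew_step _ _).2.
    move=> c1 c2 c3 c4; rewrite !homZ => E.
    have [|/eqP + /eqP + /eqP + /eqP] := i (c1 * s) (c2 * t) (c3 * s) (c4 * t).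
      by rewrite -E; vring.
    rewrite !mulf_eq0 (negPf s0) (negPf t1) !orbF.
    by move=> /eqP -> /eqP -> /eqP -> /eqP ->.
  rewrite -uE homZ; apply: par_trans (lmapZ hL _ s0) _.
  by apply: par_trans hp (par_sym (parZ _ s0)).
- move=> c d; rewrite !uE => E.
  have [|/eqP + /eqP +] := i (c * a) (d * a) (c * b) (d * b); first by rewrite -E; vring.
  by rewrite !mulf_eq0 (negPf a0) !orbF => /eqP -> /eqP ->.
move=> y; apply: par_trans (h'P y) _.
have res x := @between_residual (<[p]> + <[q]>)%VS h' a b y x h'P.
have {}res x : x \in (<[p]> + <[q]>)%VS -> exists k l,
    h' y - (a *: f y + b *: g y) = k *: f (y + x) + l *: g (y + x).
  by move=> xU; apply: res => // z zU; rewrite h'U // uE.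
set D := h' y - _ in res.
have [D0|D0] := eqVneq D 0.
  by move/eqP: D0; rewrite subr_eq0 => /eqP ->; apply: par_refl.
have dep x : x \in (<[p]> + <[q]>)%VS -> ~ ind3 (f x) (g x) D.
  move=> xU i3; apply: (no_common_direction (A := f y) (B := g y) i3 t00 t01).
  move=> s; have [k [l E]] := res _ (memvZ s xU).
  by exists k, l; rewrite E !homD !homZ.
have comb x : x \in (<[p]> + <[q]>)%VS -> ind2 (f x) (g x) ->
    exists k l, D = k *: f x + l *: g x.
  move=> xU ix; apply: contrapT => H; apply: (dep x) => //.
  by apply: ind3_comb.
have [|k [l E]] := comb p pU.
  move=> k l E; have [|-> _ -> _ //] := i k 0 l 0; by rewrite -E; vring.
have [|k' [l' E']] := comb q qU.
  move=> k' l' E'; have [|_ -> _ -> //] := i 0 k' 0 l'; by rewrite -E'; vring.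
have [|k0 _ l0 _] := i k (- k') l (- l').
  have E2 : k *: f p + l *: g p = k' *: f q + l' *: g q by rewrite -E.
  by apply: (lincomb1 (c := 1) E2); vring.
by move: D0; rewrite E k0 l0 !scale0r addr0 eqxx.
Qed.

End Between.

Lemma ind3_not_in_plane (F : fieldType) (V : vectType F) (u v w A B : V) :
  ind3 u v w -> (exists a b, u = a *: A + b *: B) ->
  (exists a b, v = a *: A + b *: B) -> (exists a b, w = a *: A + b *: B) -> False.
Proof.
move=> i Hu Hv Hw.
have pl z : (exists a b, z = a *: A + b *: B) -> z \in (<[A]> + <[B]>)%VS.
  by move=> [a [b ->]]; rewrite memv_add ?memvZ ?memv_line.
have dW : (\dim (<[A]> + <[B]>) <= 2)%N := dim_pair_le A B.
have := ind3_free i; rewrite /free => /eqP /= E.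
have : (<<[:: u; v; w]>> <= <[A]> + <[B]>)%VS.
  by apply/span_subvP => y; rewrite !inE => /or3P[] /eqP ->; apply: pl.
by move/dimvS; rewrite E => /leq_trans/(_ dW).
Qed.

Section BetweenPerspective.
Variables (F : fieldType) (V W : vectType F) (f g : 'Hom(V, W)) (h : V -> W).
Hypotheses (hL : lmap h) (col : collinear_maps f g h).
Variable t0 : F.
Hypotheses (t00 : t0 != 0) (t01 : t0 != 1).
Variables (U : {vspace V}) (u v x : V).
Hypotheses (dU : \dim U = 3) (fU : forall x, x \in U -> f x = 0 -> x = 0).
Hypotheses (uU : u \in U) (vU : v \in U) (xU : x \in U) (iuvx : ind3 u v x).
Hypotheses (gu : g u = f u) (gv : g v = f v) (gx : g x \notin (f @: U)%VS).
Hypothesis hu : h u <> 0.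

Let ifgx w : w \in U -> ind2 x w -> ind3 (f x) (f w) (g x).
Proof.
move=> wU i; apply: ind3_comb.
  move=> a b E; apply: i; apply: fU; first by rewrite memvD ?memvZ.
  by rewrite homD !homZ.
move=> [a [b E]]; case/negP: gx.
by rewrite E memvD ?memvZ ?memv_img.
Qed.

Let ind_line s t w : w = s *: u + t *: v -> w != 0 -> ind2 x w.
Proof.
move=> Ew w0; apply: nind2 => // -[c E].
have [|_ _ /eqP] := @iuvx (c * s) (c * t) (-1).
  by rewrite {1}E Ew; vring.
by rewrite oppr_eq0 oner_eq0.
Qed.

Let g_line s t w : w = s *: u + t *: v -> g w = f w.
Proof. by move=> ->; rewrite !homD !homZ gu gv. Qed.

Let line_U s t w : w = s *: u + t *: v -> w \in U.
Proof. by move=> ->; rewrite memvD ?memvZ. Qed.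

(** The coefficients are read off at [x] and carried over by comparing [h (x + w)] with [h x] and
    [h w], for [w] on the line where [f] and [g] coincide. There [z] equals [(a + b) *: f], so
    [a + b] must not vanish, which [hu] ensures. *)
Lemma between_perspective_base : exists (z : 'Hom(V, W)) a b,
  [/\ forall y, z y = a *: f y + b *: g y, a + b != 0
    & forall y, y \in U -> par (h y) (z y)].
Proof.
have x0 : x != 0 by apply: ind2_neq0 (ind2C (ind3_ind2r iuvx)).
have u0 : u != 0 by apply: ind2_neq0 (ind3_ind2 iuvx).
have Eu : u = 1 *: u + 0 *: v by vring.
have ifg := ind3_ind2s (ifgx uU (ind_line Eu u0)).
have [a [b [a0 b0 Ex]]] := strictly_between col ifg.
have [z zE] : exists z : 'Hom(V, W), forall y, z y = a *: f y + b *: g y.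
  by apply: hom_of_linear => c y y'; rewrite !homD !homZ; vring.
have hw s t w : w = s *: u + t *: v -> exists c, h w = c *: f w.
  move=> Ew; have [_ _ [k [l ->]]] := col w.
  by rewrite (g_line Ew) -scalerDl; exists (k + l).
have hxw s t w : w = s *: u + t *: v -> w != 0 ->
    par (h (x + w)) (z (x + w)).
  move=> Ew w0; have i3 := ifgx (line_U Ew) (ind_line Ew w0).
  have [|k [l [k0 l0 E]]] := strictly_between col (x := x + w).
    move=> k l; rewrite !homD (g_line Ew) => E.
    by have [|-> _ ->] := i3 k (k + l) l; rewrite // -E; vring.
  have [X [Y E']] := lmapD hL x w; have [c Ec] := hw _ _ _ Ew.
  have [] : [/\ X * a - k = 0, Y * c - (k + l) = 0 & X * b - l = 0].
    apply: i3; move: E'; rewrite E Ex Ec !homD (g_line Ew) => E'.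
    by apply: (lincomb1 (c := -1) E'); vring.
  move/eqP; rewrite subr_eq0 => /eqP e1 _ /eqP; rewrite subr_eq0 => /eqP e2.
  exists X; first by apply: contraNneq k0 => X0; rewrite -e1 X0 mul0r.
  by rewrite E zE -e1 -e2; vring.
have zx : z x != 0.
  apply/eqP; rewrite zE => E; have [a1 _] := ifg _ _ E.
  by rewrite a1 eqxx in a0.
(* For a + b = 0 all points [x + w] have the image of [x]. The zero which [lmapK] then finds on the
   line of [x] and [u] is neither some [x + w], since [z x] is nonzero, nor [u], by [hu]. *)
have ab0 : a + b != 0.
  apply/eqP => ab0; have zw s t w : w = s *: u + t *: v -> z w = 0.
    by move=> Ew; rewrite zE (g_line Ew) -scalerDl ab0 scale0r.
  have [c c0 Ec] := hxw _ _ _ Eu u0.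
  have := Ec; rewrite homD (zw _ _ _ Eu) addr0 zE -Ex => /(lmapK hL)[e Ee].
  have [e1|e1] := eqVneq (1 + e) 0.
    by apply: hu; rewrite -Ee; congr h; apply: (lincomb1 (c := - 1) (l := (1 + e) *: x) (r := 0)); [rewrite e1 scale0r|vring].
  have : h (x + (1 + e)^-1 *: u) = 0.
    by apply: (lmapZeq0 hL e1); rewrite -Ee; congr h; vfield.
  have Ew : (1 + e)^-1 *: u = (1 + e)^-1 *: u + 0 *: v by vring.
  have w0 : (1 + e)^-1 *: u != 0 by rewrite scaler_eq0 invr_eq0 negb_or e1.
  move/(par_eq0 (hxw _ _ _ Ew w0)); rewrite homD (zw _ _ _ Ew) addr0 => E.
  by rewrite E eqxx in zx.
exists z, a, b; split=> // y yU.
have [s [t [c ->]]] := ind3_span dU uU vU xU iuvx yU.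
move Ew : (s *: u + t *: v) => w; move/esym in Ew.
have [->|w0] := eqVneq w 0.
  rewrite add0r homZ; have [->|c0] := eqVneq c 0.
    by rewrite !scale0r (lmap0 hL); apply: par_refl.
  apply: par_trans (lmapZ hL _ c0) _; rewrite Ex -zE.
  by apply: par_sym; apply: parZ.
have [->|c0] := eqVneq c 0.
  rewrite scale0r addr0; have [k Ek] := hw _ _ _ Ew.
  have zw : z w = (a + b) *: f w by rewrite zE (g_line Ew) -scalerDl.
  have k0 : k != 0.
    apply/eqP => k0; have hw0 : h w = 0 by rewrite Ek k0 scale0r.
    have [m _ Em] := hxw _ _ _ Ew w0.
    have [n n0 En] := lmapD0 hL x hw0; rewrite addrC Em in En.
    have i3 := ifgx (line_U Ew) (ind_line Ew w0).
    have := En; rewrite Ex homD zw zE => E.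
    have [|_ /eqP + _] := i3 (m * a - n * a) (m * (a + b)) (m * b - n * b).
      by apply: (lincomb1 (c := 1) E); vring.
    rewrite mulf_eq0 (negPf ab0) orbF => /eqP m0; move: En; rewrite m0 scale0r Ex -zE.
    by move/esym/eqP; rewrite scaler_eq0 (negPf n0) (negPf zx).
  rewrite Ek zw; apply: par_trans (parZ _ k0) _.
  by apply: par_sym; apply: parZ.
have Ew' : c^-1 *: w = (c^-1 * s) *: u + (c^-1 * t) *: v by rewrite Ew; vring.
have -> : w + c *: x = c *: (x + c^-1 *: w) by vfield.
apply: par_trans (lmapZ hL _ c0) _; rewrite homZ.
apply: par_trans (par_sym (parZ _ c0)).
by apply: hxw Ew' _; rewrite scaler_eq0 invr_eq0 negb_or c0.
Qed.

(** A nonzero residual turns out to be a multiple of [C = g x - f x], which spans all differences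
    [g - f] on [U]. Then [C] is in the span of [f (y + x')] and [g (y + x')] for all [x'] in [U].
    Moving from [y] to a point where [f] and [g] agree makes [C] proportional to values of [f] at
    two points that differ by [u], so [f u] is a multiple of [C], a contradiction. *)
Lemma between_perspective :
  exists a b, forall y, par (h y) (a *: f y + b *: g y).
Proof.
have [z [a [b [zE ab0 hz]]]] := between_perspective_base.
have x0 : x != 0 by apply: ind2_neq0 (ind2C (ind3_ind2r iuvx)).
have u0 : u != 0 by apply: ind2_neq0 (ind3_ind2 iuvx).
have v0 : v != 0 by apply: ind2_neq0 (ind3_ind2r iuvx).
have Eu : u = 1 *: u + 0 *: v by vring.
have Ev : v = 0 *: u + 1 *: v by vring.
have ifuv : ind2 (f u) (f v).
  move=> k l E; apply: (ind3_ind2 iuvx); apply: fU.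
    by rewrite memvD ?memvZ.
  by rewrite homD !homZ.
exists a, b.
have [||||h' h'U h'P] := lmap_extend hL (U := U) (g := z) (p := u) (q := v) => //.
  move=> k l; rewrite !zE gu gv => E.
  have [|/eqP + /eqP] := ifuv (k * (a + b)) (l * (a + b)); first by rewrite -E; vring.
  by rewrite !mulf_eq0 (negPf ab0) !orbF => /eqP -> /eqP ->.
move=> y; apply: par_trans (h'P y) _.
have res x' : x' \in U -> exists k l,
    h' y - (a *: f y + b *: g y) = k *: f (y + x') + l *: g (y + x').
  move=> x'U; apply: (@between_residual _ _ _ f g h col U) => // w wU.
  by rewrite h'U // zE.
set D := h' y - _ in res.
have [D0|D0] := eqVneq D 0.
  by move/eqP: D0; rewrite subr_eq0 => /eqP ->; apply: par_refl.
have comb x' : x' \in U -> ind2 (f x') (g x') ->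
    exists k l, D = k *: f x' + l *: g x'.
  move=> x'U ix; apply: contrapT => H.
  have i3 : ind3 (f x') (g x') D by apply: ind3_comb.
  apply: (no_common_direction (A := f y) (B := g y) i3 t00 t01) => s.
  have [k [l E]] := res _ (memvZ s x'U).
  by exists k, l; rewrite E !homD !homZ.
have i3u := ifgx uU (ind_line Eu u0).
have i3v := ifgx vU (ind_line Ev v0).
have [k [l E]] := comb x xU (ind3_ind2s i3u).
have [||k' [l' E']] := comb (x + u) _ _; first by rewrite memvD.
  move=> k' l'; rewrite !homD gu => E'.
  by have [|-> _ ->] := i3u k' (k' + l') l'; rewrite // -E'; vring.
have [e1 e2 e3] : [/\ k - k' = 0, - (k' + l') = 0 & l - l' = 0].
  apply: i3u; move: E'; rewrite E !homD gu => E'.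
  by apply: (lincomb1 (c := 1) E'); vring.
(* The expressions of [D] at [x] and at [x + u] are compatible only for multiples of [g x - f x]. *)
have kl : l = - k.
  have -> : l = (l - l') - (- (k' + l')) - k' by ring.
  have -> : k = (k - k') + k' by ring.
  by rewrite e1 e2 e3; ring.
have k0 : k != 0 by apply: contraNneq D0 => k0; rewrite E kl k0 oppr0 !scale0r addr0.
pose C := g x - f x.
have CE : forall x', x' \in U -> exists m n, C = m *: f (y + x') + n *: g (y + x').
  move=> x' x'U; have [m [n Emn]] := res _ x'U; exists (- k^-1 * m), (- k^-1 * n).
  by apply: (lincomb2 (c := - k^-1) (c' := k^-1) Emn E); rewrite /C kl; vfield.
have iC : ind3 (f u) (f v) C.
  apply: (ind3_comb ifuv) => -[m1 [n1 Emn]]; rewrite /C in Emn; case/negP: gx.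
  have -> : g x = m1 *: f u + n1 *: f v + f x by apply: (lincomb1 (c := 1) Emn); vring.
  by rewrite !memvD ?memvZ ?memv_img.
have CE0 : exists m n, C = m *: f y + n *: g y.
  by have [m [n Emn]] := CE 0 (mem0v U); rewrite addr0 in Emn; exists m, n.
(* Either the coefficients at [u] or at [v] have sum zero, which gives the claim, or [f u], [f v]
   and [C] all lie in the span of [f y] and [g y]. *)
have [s Es] : exists s, g y = f y - s *: C.
  have [mu [nu Eu']] := CE u uU; have [mv [nv Ev']] := CE v vU.
  have aux w m n : g w = f w -> C = m *: f (y + w) + n *: g (y + w) ->
      m + n = 0 -> exists s, g y = f y - s *: C.
    move=> gw E3 mn; have n0 : n = - m.
      by apply/eqP; rewrite -addr_eq0 addrC mn.
    rewrite !homD gw in E3; exists m^-1.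
    have m0 : m != 0.
      apply/eqP => m0; move: E3; rewrite n0 m0 oppr0 !scale0r addr0.
      by apply/eqP; apply: ind2_neq0 (ind2C (ind3_ind2r iC)).
    by apply: (lincomb1 (c := m^-1) E3); rewrite n0; vfield.
  have [mnu|mnu] := eqVneq (mu + nu) 0; first exact: (aux u mu nu).
  have [mnv|mnv] := eqVneq (mv + nv) 0; first exact: (aux v mv nv).
  have inp w m n : g w = f w -> C = m *: f (y + w) + n *: g (y + w) ->
      m + n != 0 -> exists a b, f w = a *: f y + b *: g y.
    move=> gw E3 mn; have [m' [n' E4]] := CE0.
    exists ((m + n)^-1 * (m' - m)), ((m + n)^-1 * (n' - n)).
    rewrite !homD gw in E3.
    by apply: (lincomb2 (c := - (m + n)^-1) (c' := (m + n)^-1) E3 E4); vfield.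
  case: (ind3_not_in_plane iC (inp u mu nu gu Eu' mnu) (inp v mv nv gv Ev' mnv) CE0).
(* [g - f] takes the value [- s *: C] at [y] and [s *: C] at [s *: x], so it vanishes at their
   sum. *)
have Eg w : g w = f w -> g (y + s *: x + w) = f (y + s *: x + w).
  by move=> gw; rewrite !homD !homZ gw Es /C; vring.
have par1 w : w \in U -> g w = f w -> exists c, C = c *: f (y + s *: x + w).
  move=> wU gw; have [m [n]] := CE (s *: x + w) (memvD (memvZ _ xU) wU).
  by rewrite addrA Eg // -scalerDl; exists (m + n).
have [c1 E1] := par1 0 (mem0v U) (etrans (hom0 g) (esym (hom0 f))).
have [c2 E2] := par1 u uU gu.
rewrite addr0 in E1; rewrite homD in E2.
have C0 : C != 0 by apply: ind2_neq0 (ind2C (ind3_ind2r iC)).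
have c10 : c1 != 0 by apply: contraNneq C0 => c0; rewrite E1 c0 scale0r.
have c20 : c2 != 0 by apply: contraNneq C0 => c0; rewrite E2 c0 scale0r.
case: (@ind2_nscale _ _ (f u) C (c2^-1 - c1^-1)); first exact: ind3_ind2s iC.
by apply: (lincomb2 (c := - c2^-1) (c' := c1^-1) E2 E1); vfield; nz.
Qed.

End BetweenPerspective.

(** * Bilinear structure *)

Section AgreeStep.
Variables (F : fieldType) (V W : vectType F).
Implicit Types (f g : V -> W).

Lemma lmap_agree_kernel f g z y : lmap f -> lmap g -> f z = 0 -> g z = 0 ->
  par (f y) (g y) -> par (f (z + y)) (g (z + y)).
Proof.
move=> fL gL fz gz P; apply: par_trans (lmapD0 fL y fz) _.
by apply: par_trans P _; apply: par_sym; apply: lmapD0.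
Qed.

Lemma lmap_ker_comb f u v a b : lmap f -> f u = 0 -> f v = 0 ->
  f (a *: u + b *: v) = 0.
Proof.
move=> fL u0 v0; have [c [d ->]] := lmap_comb fL u v a b.
by rewrite u0 v0 !scaler0 addr0.
Qed.

(** Since u + b = (u + a0) + (b - a0), the image of [u + b] is the meet of two lines, distinct by
    the independence of the three images, and the ends of both lines have the same images under [f]
    and [g]. *)
Lemma lmap_agree_generic f g a0 u b : lmap f -> lmap g ->
  ind3 (f a0) (f u) (f b) ->
  (forall r s, par (f (r *: u + s *: a0)) (g (r *: u + s *: a0))) ->
  (forall r s, par (f (r *: b + s *: a0)) (g (r *: b + s *: a0))) ->
  par (f (u + b)) (g (u + b)).
Proof.
move=> fL gL i HU HB.
have [c1 c10 Gu] : par (g u) (f u).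
  by have := HU 1 0; rewrite scale1r scale0r addr0; apply: par_sym.
have [c2 c20 Gb] : par (g b) (f b).
  by have := HB 1 0; rewrite scale1r scale0r addr0; apply: par_sym.
have [c3 _ Gua] : par (g (u + a0)) (f (u + a0)).
  by have := HU 1 1; rewrite !scale1r; apply: par_sym.
have [c4 _ Gba] : par (g (b - a0)) (f (b - a0)).
  by have := HB 1 (-1); rewrite scaleN1r scale1r; apply: par_sym.
have [al [be E1]] := lmapD fL u a0.
have [ga [de E2]] : exists c d, f (b - a0) = c *: f b + d *: f a0.
  by have := lmap_comb fL b a0 1 (-1); rewrite scaleN1r scale1r.
have be0 : be != 0.
  apply/eqP => be0; have [p [q E]] := lmap_comb fL (u + a0) u 1 (-1).
  apply: (ind2_nscale (c := p * al + q) (ind3_ind2 i)).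
  have -> : a0 = 1 *: (u + a0) + (-1) *: u by vring.
  by rewrite E E1 be0; vring.
have key k x y x' y' : k = x *: f u + y *: f b ->
    k = x' *: f (u + a0) + y' *: f (b - a0) ->
    k = y' *: ((- (de / be) * al) *: f u + ga *: f b).
  move=> -> E; have [] : [/\ x' * be + y' * de = 0, x' * al - x = 0 & y' * ga - y = 0].
    by apply: i; move: E; rewrite E1 E2 => E; apply: (lincomb1 (c := -1) E); vring.
  move=> e1 /eqP + /eqP; rewrite !subr_eq0 => /eqP <- /eqP <-.
  have -> : x' = - (y' * de / be).
    have -> : x' = (x' * be + y' * de) / be - y' * de / be by field.
    by rewrite e1 mul0r sub0r.
  by vring.
have [x [y E3]] := lmapD fL u b.
have [x' [y' E4]] := lmapD fL (u + a0) (b - a0).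
have [X [Y E5]] := lmapD gL u b.
have [X' [Y' E6]] := lmapD gL (u + a0) (b - a0).
have Eub : u + a0 + (b - a0) = u + b by vring.
rewrite Eub in E4 E6.
have Ef := key _ _ _ _ _ E3 E4.
have Eg : g (u + b) = Y' * c4 *: ((- (de / be) * al) *: f u + ga *: f b).
  apply: (key _ (X * c1) (Y * c2) (X' * c3)).
    by rewrite E5 Gu Gb; vring.
  by rewrite E6 Gua Gba; vring.
have nz (h : V -> W) : lmap h -> ind2 (h u) (h b) -> h (u + b) != 0.
  move=> hL iub; apply/eqP => h0; have [p [q E]] := lmap_comb hL (u + b) b 1 (-1).
  apply: (ind2_nscale (c := q) iub); have -> : u = 1 *: (u + b) + (-1) *: b by vring.
  by rewrite E h0; vring.
have iub := ind3_ind2r i.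
have f0 := nz f fL iub.
have g0 : g (u + b) != 0.
  apply: nz => // p q; rewrite Gu Gb !scalerA => /iub[] /eqP + /eqP.
  by rewrite !mulf_eq0 (negPf c10) (negPf c20) !orbF => /eqP -> /eqP ->.
apply: par_trans (par_scale f0 Ef) _; apply: par_sym; exact: par_scale Eg.
Qed.

(* The point u + b is on the lines joining u + s a0 to b - s a0, for all s. *)
Lemma lmap_agree_step f g a0 u b : lmap f -> lmap g -> f a0 != 0 ->
  (forall r s, par (f (r *: u + s *: a0)) (g (r *: u + s *: a0))) ->
  (forall r s, par (f (r *: b + s *: a0)) (g (r *: b + s *: a0))) ->
  par (f (u + b)) (g (u + b)).
Proof.
move=> fL gL fa0 HU HB.
have ga0 : g a0 != 0.
  apply/eqP => E; case/eqP: fa0; have := HU 0 1.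
  by rewrite scale0r add0r scale1r E => /par0.
have HU1 s : par (f (u + s *: a0)) (g (u + s *: a0)) by have := HU 1 s; rewrite scale1r.
have HB1 s : par (f (b + s *: a0)) (g (b + s *: a0)) by have := HB 1 s; rewrite scale1r.
have [[s us]|nu] := pselect (exists s, f (u + s *: a0) = 0).
  have -> : u + b = (u + s *: a0) + (b + (- s) *: a0) by vring.
  exact: lmap_agree_kernel (par_eq0 (HU1 _) us) (HB1 _).
have [[s bs]|nb] := pselect (exists s, f (b + s *: a0) = 0).
  have -> : u + b = (b + s *: a0) + (u + (- s) *: a0) by vring.
  exact: lmap_agree_kernel (par_eq0 (HB1 _) bs) (HU1 _).
have iu : ind2 (f a0) (f u).
  apply: ind2C; apply: nind2 => // -[c /(lmapK fL)[s E]].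
  by apply: nu; exists s.
have [[p [q E]]|ni] := pselect (exists p q, f b = p *: f a0 + q *: f u); last first.
  by apply: (@lmap_agree_generic f g a0) => //; apply: ind3_comb.
(* Dependence of the three images yields a kernel vector of [f]; it remains to see that [g] vanishes
   there too. *)
have [r [s k0]] : exists r s, f (b + r *: u + s *: a0) = 0.
  have [k [l /par_sym[c c0 Ec]]] := lmapO fL a0 u p q.
  rewrite -E in Ec; have [e Ee] := lmapK fL Ec.
  by exists (e * l), (e * k); rewrite -Ee; congr f; vring.
have r0 : r != 0.
  by apply/eqP => r0; apply: nb; exists s; rewrite -k0 r0; congr f; vring.
(* For each [s'] the kernel vector is the sum of [r *: u + (s - s') *: a0] and [b + s' *: a0], where
   the maps agree, so these have proportional images under [g] as well. The zeros for s' = 0 and s'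
   = 1 together force the coefficient 1. *)
have gker s' : exists c, g (r *: u + (s - s') *: a0 + c *: (b + s' *: a0)) = 0.
  have P : par (f (r *: u + (s - s') *: a0)) (f (b + s' *: a0)).
    have -> : r *: u + (s - s') *: a0 = (b + r *: u + s *: a0) + (- 1) *: (b + s' *: a0) by vring.
    apply: par_trans (lmapD0 fL _ k0) _; apply: lmapZ => //.
    by rewrite oppr_eq0 oner_neq0.
  have [c _] : par (g (r *: u + (s - s') *: a0)) (g (b + s' *: a0)).
    by apply: par_trans (par_sym (HU _ _)) _; apply: par_trans P (HB1 _).
  exact: lmapK.
have [c0 E0] := gker 0; have [c1 E1] := gker 1.
have gk : g (b + r *: u + s *: a0) = 0.
  have E2 := lmap_ker_comb 1 (-1) gL E0 E1.
  have E3 : g ((c0 - c1) *: b + (1 - c1) *: a0) = 0.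
    by rewrite -E2; congr g; vring.
  have c01 : c0 = c1.
    apply/eqP; rewrite -subr_eq0; apply: contrapT => /negP c01; apply: nb.
    exists ((1 - c1) / (c0 - c1)); apply: (par_eq0 (par_sym (HB1 _))).
    by apply: (lmapZeq0 gL c01); rewrite -E3; congr g; vfield.
  have c11 : c1 = 1.
    apply/esym/eqP; rewrite -subr_eq0; apply: contrapT => /negP c11.
    case/eqP: ga0; apply: (lmapZeq0 gL c11); rewrite -E3 c01; congr g; vring.
  by rewrite -E0 c01 c11; congr g; vring.
have -> : u + b = (b + r *: u + s *: a0) + ((1 - r) *: u + (- s) *: a0) by vring.
exact: lmap_agree_kernel (HU _ _).
Qed.

(** The induction carries an arbitrary multiple of [a i0]: then the partial sum and the next [a i]
    are each joined to [a i0] by a line of agreement, as [lmap_agree_step] requires. *)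
Lemma lmap_agree_star (I : finType) (a : I -> V) (i0 : I) f g :
  lmap f -> lmap g -> f (a i0) != 0 ->
  (forall i r s, par (f (r *: a i + s *: a i0)) (g (r *: a i + s *: a i0))) ->
  forall c : I -> F, par (f (\sum_i c i *: a i)) (g (\sum_i c i *: a i)).
Proof.
move=> fL gL f0 H c.
suff gen (s : seq I) d e : par (f (d *: (\sum_(i <- s) c i *: a i) + e *: a i0))
    (g (d *: (\sum_(i <- s) c i *: a i) + e *: a i0)).
  by have := gen (index_enum I) 1 0; rewrite scale1r scale0r addr0.
elim: s d e => [|i s IH] d e.
  by rewrite big_nil scaler0; have := H i0 0 e; rewrite scale0r.
rewrite big_cons; set S := \sum_(j <- s) _ in IH *.
have -> : d *: (c i *: a i + S) + e *: a i0 = (d *: S + e *: a i0) + (d * c i) *: a i.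
  by vring.
apply: (@lmap_agree_step _ _ (a i0)) => // r t.
  have -> : r *: (d *: S + e *: a i0) + t *: a i0 = (r * d) *: S + (r * e + t) *: a i0.
    by vring.
  exact: IH.
by rewrite scalerA; apply: H.
Qed.

End AgreeStep.

Lemma lmap_lift (F : fieldType) (V W Z : vectType F) (T : 'Hom(W, Z))
    (g : V -> Z) (b : V -> W) :
  (forall w, T w = 0 -> w = 0) -> lmap g -> (forall v, T (b v) = g v) -> lmap b.
Proof.
move=> T0 gL Tb.
have Ti w w' : T w = T w' -> w = w'.
  move=> E; apply/eqP; rewrite -subr_eq0; apply/eqP; apply: T0.
  by rewrite homD homN E subrr.
split.
- by apply: T0; rewrite Tb (lmap0 gL).
- move=> a v a0; have [c c0 E] := lmapZ gL v a0; exists c => //.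
  by apply: Ti; rewrite homZ !Tb.
- move=> u v; have [c [d E]] := lmapD gL u v; exists c, d.
  by apply: Ti; rewrite homD !homZ !Tb.
- move=> u v c E; have [|a Ea] := lmapK gL (u := u) (v := v) (c := c).
    by rewrite -!Tb E homZ.
  by exists a; apply: T0; rewrite Tb.
- move=> u v c d; have [a [b' [e e0 E]]] := lmapO gL u v c d.
  exists a, b', e => //; apply: Ti.
  by rewrite homZ homD !homZ !Tb.
Qed.

Lemma hom_of_row (F : fieldType) (W : vectType F) k (w : 'I_k -> W) :
  exists T : 'Hom('rV[F]_k, W), forall c, T c = \sum_j c 0 j *: w j.
Proof.
apply: hom_of_linear => a u v; rewrite scaler_sumr -big_split /=.
by apply: eq_bigr => j _; rewrite !mxE scalerDl scalerA.
Qed.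

Lemma free_family (F : fieldType) (V : vectType F) k (v : 'I_k -> V) c :
  free [seq v j | j <- enum 'I_k] -> \sum_j c j *: v j = 0 -> forall j, c j = 0.
Proof.
move=> fr; have fr' : free (codom_tuple v) by [].
move=> E j; move/freeP: fr' => /(_ (fun i => c (cast_ord (card_ord _) i))).
move=> H; have /= := H _ (cast_ord (esym (card_ord _)) j).
rewrite cast_ordKV; apply; rewrite -[RHS]E.
rewrite (reindex (cast_ord (esym (card_ord k)))) /=; last first.
  by exists (cast_ord (card_ord k)) => i _; rewrite ?cast_ordKV ?cast_ordK.
apply: eq_bigr => i _; rewrite cast_ordKV; congr (_ *: _).
by rewrite (nth_map i) ?size_enum_ord //= nth_ord_enum.
Qed.

Section Collinear.
Variables (F : fieldType) (V1 V2 W : vectType F) (B : V1 -> V2 -> W).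
Hypothesis BL1 : forall x, lmap (B x).

Lemma bilmap_collinear (f g : V1 -> W) y z c d :
  (forall x, par (B x y) (f x)) -> (forall x, par (B x z) (g x)) ->
  c != 0 -> d != 0 -> collinear_maps f g (fun x => B x (c *: y + d *: z)).
Proof.
move=> fB gB c0 d0 x; have [k k0 Ek] := par_sym (fB x).
have [l l0 El] := par_sym (gB x).
have [k' _ Ek'] := fB x; have [l' _ El'] := gB x; split.
- have [p [q E]] := lmap_comb (BL1 x) (c *: y + d *: z) z c^-1 (- (d / c)).
  exists (k * q * l'), (k * p); have -> : f x = k *: (p *: B x (c *: y + d *: z) + q *: B x z).
    by rewrite Ek -E; congr (_ *: B x _); vfield.
  by rewrite El'; vring.
- have [p [q E]] := lmap_comb (BL1 x) (c *: y + d *: z) y d^-1 (- (c / d)).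
  exists (l * q * k'), (l * p); have -> : g x = l *: (p *: B x (c *: y + d *: z) + q *: B x y).
    by rewrite El -E; congr (_ *: B x _); vfield.
  by rewrite Ek'; vring.
- have [p [q E]] := lmap_comb (BL1 x) y z c d.
  by exists (p * k'), (q * l'); rewrite E Ek' El'; vring.
Qed.

End Collinear.

Section Structure.
Variables (F : fieldType) (V1 V2 W : vectType F) (B : V1 -> V2 -> W).
Hypotheses (BL1 : forall x, lmap (B x)) (BL2 : forall y, lmap (B^~ y)).
Variables (m : nat) (a : 'I_m.+1 -> V2).
Hypothesis a_span : forall y, exists c : 'I_m.+1 -> F, y = \sum_j c j *: a j.
Hypothesis a_free : free [seq a j | j <- enum 'I_m.+1].
Variables (U : {vspace V1}) (f0 : 'Hom(V1, W)) (A : V1).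
Hypotheses (dU : \dim U = 3) (f0P : forall x, par (B x (a ord0)) (f0 x)).
Hypothesis BU : forall j x, x \in U -> B x (a j) = 0 -> x = 0.
Hypothesis B_out : forall j, j != ord0 ->
  exists2 x, x \in U & B x (a j) \notin (f0 @: U)%VS.
Hypothesis BA : forall y, B A y = 0 -> y = 0.

Let f0U x : x \in U -> f0 x = 0 -> x = 0.
Proof. by move=> xU E; apply: (BU (j := ord0) xU); apply: par_eq0 (par_sym (f0P x)) E. Qed.

Lemma bilmap_linear : exists f : 'I_m.+1 -> 'Hom(V1, W), f ord0 = f0 /\
  forall j, (forall x, par (B x (a j)) (f j x)) /\
  (j != ord0 ->
   (exists p q, [/\ p \in U, q \in U & ind4 (f0 p) (f0 q) (f j p) (f j q)]) \/
   (exists u v x, [/\ [/\ u \in U, v \in U & x \in U], ind3 u v x,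
     f j u = f0 u, f j v = f0 v & f j x \notin (f0 @: U)%VS])).
Proof.
pose P j (g : 'Hom(V1, W)) := (forall x, par (B x (a j)) (g x)) /\
  (j != ord0 ->
   (exists p q, [/\ p \in U, q \in U & ind4 (f0 p) (f0 q) (g p) (g q)]) \/
   (exists u v x, [/\ [/\ u \in U, v \in U & x \in U], ind3 u v x,
     g u = f0 u, g v = f0 v & g x \notin (f0 @: U)%VS])).
have [j|f fP] := @choice _ _ (fun j g => (j = ord0 -> g = f0) /\ P j g).
  have [->|j0] := eqVneq j ord0; first by exists f0; do !split.
  have [||||||g [gP gD]] := @collinear_linear _ _ _ f0 (B^~ (a j))
     (B^~ (1 *: a ord0 + 1 *: a j)) U _ _ dU.
  - exact: BL2.
  - exact: BL2.
  - apply: bilmap_collinear => // [x||]; rewrite ?oner_neq0 //; exact: par_refl.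
  - exact: f0U.
  - exact: BU.
  - exact: B_out.
  by exists g; split; [move=> E; rewrite E eqxx in j0|split].
exists f; split; first by have [-> //] := fP ord0.
by move=> j; have [] := fP j.
Qed.

(** The vectors [f j A] are independent because [B A] has no zero besides 0. So [b] can be defined
    by [T (b y) = B A y], an equality of vectors and not only of points. *)
Lemma bilmap_structure : exists (f : 'I_m.+1 -> 'Hom(V1, W)) (b : V2 -> 'rV[F]_m.+1),
  [/\ lmap b, forall y, b y = 0 -> y = 0 &
    forall x y, par (B x y) (\sum_j b y 0 j *: f j x)].
Proof.
have [f [f00 fP]] := bilmap_linear; exists f.
have fB j x : par (B x (a j)) (f j x) by case: (fP j).
have [T TE] := hom_of_row (fun j => f j A).
have fr : free [seq B A y | y <- [seq a j | j <- enum 'I_m.+1]].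
  exact: lmap_free.
have T0 w : T w = 0 -> w = 0.
  rewrite TE => E; apply/rowP => j; rewrite mxE.
  have : forall j, exists c, c != 0 /\ f j A = c *: B A (a j).
    by move=> i; have [c c0 Ec] := par_sym (fB i A); exists c.
  case/choice=> c cE.
  have /free_family H : free [seq B A (a j) | j <- enum 'I_m.+1].
    by move: fr; rewrite -map_comp.
  have /eqP : w 0 j * c j = 0.
    apply: (H (fun i => w 0 i * c i)); rewrite -[RHS]E.
    by apply: eq_bigr => i _; rewrite (cE i).2 scalerA.
  by rewrite mulf_eq0 (negPf (cE j).1) orbF => /eqP.
have TB y : exists w, T w = B A y.
  suff /memv_imgP[w _ ->] : B A y \in limg T by exists w.
  have yS : y \in <<[seq a j | j <- enum 'I_m.+1]>>%VS.
    have [c ->] := a_span y; apply: memv_suml => j _; apply: memvZ.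
    by apply: memv_span; apply: map_f; rewrite mem_enum.
  apply: (subvP _ _ (lmap_span (BL1 A) yS)); apply/span_subvP => _ /mapP[_ /mapP[j _ ->] ->].
  have [c _ ->] := fB j A; apply: memvZ.
  have -> : f j A = T (delta_mx 0 j); last by rewrite memv_img ?memvf.
  rewrite TE (bigD1 j) //= big1 => [|i ij]; last by rewrite mxE (negPf ij) andbF scale0r.
  by rewrite mxE !eqxx scale1r addr0.
have [b bE] := choice TB.
have bL : lmap b by apply: lmap_lift T0 (BL1 A) bE.
have b0 y : b y = 0 -> y = 0.
  by move=> E; apply: BA; rewrite -bE E hom0.
exists b; split=> //.
pose D x y := par (B x y) (\sum_j b y 0 j *: f j x).
have MxE x : exists2 g : 'Hom('rV_m.+1, W), lmap (fun y => g (b y)) &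
    forall c, g c = \sum_j c 0 j *: f j x.
  have [g gE] := hom_of_row (fun j => f j x); exists g => //.
  by apply: lmap_comp bL; apply: hom_lmap.
have My y : exists2 g : 'Hom(V1, W), lmap g & forall x, g x = \sum_j b y 0 j *: f j x.
  have [g gE] : exists g : 'Hom(V1, W), forall x, g x = \sum_j b y 0 j *: f j x.
    apply: hom_of_linear => c u v; rewrite scaler_sumr -big_split /=.
    by apply: eq_bigr => j _; rewrite homD homZ scalerDr !scalerA mulrC.
  by exists g => //; apply: hom_lmap.
have rowE (w : 'I_m.+1 -> V1 -> W) j k c d x : j != k ->
    \sum_i (c *: delta_mx 0 j + d *: delta_mx 0 k : 'rV[F]_m.+1) 0 i *: w i x =
    c *: w j x + d *: w k x.
  move=> jk; rewrite (bigD1 j) //= (bigD1 k) 1?eq_sym //= big1 => [|i /andP[ij ik]].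
    by rewrite !mxE !eqxx (negPf jk) eq_sym (negPf jk) /=; vring.
  by rewrite !mxE (negPf ij) (negPf ik) /=; vring.
(* Evaluation at [A] shows that a coefficient vector which works for all [x] is proportional to
   [b y]. *)
have D_of_vec (w : 'rV_m.+1) y : (forall x, par (B x y) (\sum_j w 0 j *: f j x)) ->
    forall x, D x y.
  move=> H x; have [k k0 Ek] := H A.
  have byE : b y = k *: w.
    apply/eqP; rewrite -subr_eq0; apply/eqP; apply: T0.
    by rewrite homD homN bE homZ TE Ek subrr.
  apply: par_trans (H x) _; apply: par_sym; exists k => //.
  by rewrite scaler_sumr; apply: eq_bigr => i _; rewrite byE mxE scalerA.
have D_of_combo j c d y : j != ord0 ->
    (forall x, par (B x y) (c *: f0 x + d *: f j x)) -> forall x, D x y.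
  move=> j0 H; apply: (@D_of_vec (c *: delta_mx 0 ord0 + d *: delta_mx 0 j)) => x.
  by rewrite (rowE (fun j => f j)) 1?eq_sym // f00.
have Da j x : D x (a j).
  apply: (@D_of_vec (delta_mx 0 j)) => z.
  rewrite (bigD1 j) //= big1 => [|i ij]; last by rewrite mxE (negPf ij) andbF scale0r.
  by rewrite mxE !eqxx scale1r addr0.
have DZ x c y : D x y -> D x (c *: y).
  have [g gL gE] := MxE x; rewrite /D -!gE => H.
  have [->|c0] := eqVneq c 0; first by rewrite scale0r (lmap0 (BL1 x)) (lmap0 gL); apply: par_refl.
  apply: par_trans (lmapZ (BL1 x) y c0) _; apply: par_trans H _.
  by apply: par_sym; apply: (lmapZ gL).
have Doff x y z : (forall t, D x (z + t *: y)) -> D x y.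
  have [g gL gE] := MxE x; rewrite /D => H; rewrite -gE.
  apply: (lmap_agree_off_point (f := B x) (g := fun y => g (b y)) (v := z)) => // t.
  by rewrite gE; apply: H.
have Dline j c d x : D x (c *: a j + d *: a ord0).
  have [->|j0] := eqVneq j ord0; first by rewrite -scalerDl; apply: DZ.
  rewrite addrC; have [->|d0] := eqVneq d 0; first by rewrite scale0r add0r; apply: DZ.
  have [->|c0] := eqVneq c 0; first by rewrite scale0r addr0; apply: DZ.
  (* [no_common_direction] needs a third scalar. Over two elements [a ord0 + a j] is the only
     further point of the line, and [Doff] settles it from the other two. *)
  have [[t0 [t00 t01]]|F2] := pselect (exists t : F, t != 0 /\ t != 1).
    have col c' d' : c' != 0 -> d' != 0 ->
        collinear_maps f0 (f j) (fun x => B x (c' *: a ord0 + d' *: a j)).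
      by move=> ? ?; apply: bilmap_collinear.
    have [_ /(_ j0)] := fP j.
    case=> [[p [q [pU qU i4]]]|[u [v [z [[uU vU zU] i3 fu fv fz]]]]].
      have [al [be H]] := between_skew (BL2 _) (col _ _ d0 c0) t00 t01 i4.
      exact: (@D_of_combo j al be _ j0 H).
    have good c' d' : c' != 0 -> d' != 0 -> B u (c' *: a ord0 + d' *: a j) <> 0 ->
        forall x, D x (c' *: a ord0 + d' *: a j).
      move=> c0' d0' hu; have [al [be H]] := between_perspective (BL2 _) (col _ _ c0' d0')
        t00 t01 dU f0U uU vU zU i3 fu fv fz hu.
      exact: (@D_of_combo j al be _ j0 H).
    (* At most one point of the line is a zero of [B u], since [B u (a ord0)] is nonzero. If it is
       this one, all the others are covered, and [Doff] recovers it. *)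
    have [hu|/eqP hu] := eqVneq (B u (d *: a ord0 + c *: a j)) 0; last exact: good.
    apply: (Doff _ _ (a ord0)) => t.
    have -> : a ord0 + t *: (d *: a ord0 + c *: a j) = (1 + t * d) *: a ord0 + (t * c) *: a j by vring.
    have [->|e0] := eqVneq (1 + t * d) 0; first by rewrite scale0r add0r; apply: DZ.
    have [->|e1] := eqVneq (t * c) 0; first by rewrite scale0r addr0; apply: DZ.
    apply: good => // E.
    have u0 : u = 0.
      apply: (BU (j := ord0) uU).
      have := lmap_ker_comb 1 (- t) (BL1 u) E hu.
      by move=> <-; congr (B u); vring.
    have [|/eqP] := i3 1 0 0; first by rewrite u0; vring.
    by rewrite oner_eq0.
  have F2' t : t = 0 \/ t = 1 :> F.
    have [->|t00] := eqVneq t 0; first by left.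
    have [->|t01] := eqVneq t 1; first by right.
    by case: F2; exists t.
  have d1 : d = 1 by case: (F2' d) => // d0'; rewrite d0' eqxx in d0.
  have c1 : c = 1 by case: (F2' c) => // c0'; rewrite c0' eqxx in c0.
  rewrite d1 c1 !scale1r; apply: (Doff _ _ (a ord0)) => t.
  have [->|->] := F2' t; first by rewrite scale0r addr0.
  have -> : a ord0 + 1 *: (a ord0 + a j) = (1 + 1) *: a ord0 + a j by vring.
  have [->|E] := F2' (1 + 1); first by rewrite scale0r add0r.
  by move/eqP: E; rewrite -subr_eq0 addrK oner_eq0.
have D1 x : f0 x != 0 -> forall y, D x y.
  move=> fx y; have [c ->] := a_span y; have [g gL gE] := MxE x.
  rewrite /D -gE; apply: (lmap_agree_star (i0 := ord0) (f := B x) (g := fun y => g (b y))) => //.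
    apply: contra fx => /eqP E; apply/eqP; apply: par_eq0 (f0P x) E.
  by move=> j r s; rewrite gE; apply: Dline.
(* If [f0 x] vanishes, the points [x' + t *: x] with [x'] nonzero in [U] are covered, and [x] is the
   remaining point of their line. *)
move=> x y; have [fx|] := eqVneq (f0 x) 0; last by move=> fx; apply: D1.
have [|x' x'U Hx'] := @notin_line_pair _ _ U 0 0; first by rewrite dU.
have x'0 : f0 x' != 0.
  by apply/eqP => /(f0U x'U) x'0; apply: Hx'; exists 0, 0; rewrite x'0 !scaler0 addr0.
have [g gL gE] := My y; rewrite -gE.
apply: (lmap_agree_off_point (f := B^~ y) (v := x')) => // t.
by rewrite gE; apply: D1; rewrite homD homZ fx scaler0 addr0.
Qed.
End Structure.

(** * Coordinates on a projective space *)

Section Collinear.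
Variables (S : geometry).
Implicit Types p q r s t : points S.
(** Coincidences are allowed, which spares case distinctions when lines are joined and
    intersected. *)
Definition col p q r := exists g, [/\ lines g, g p, g q & g r].

Lemma colC p q r : col p q r -> col q p r.
Proof. by case=> g [? ? ? ?]; exists g. Qed.
Lemma colCr p q r : col p q r -> col p r q.
Proof. by case=> g [? ? ? ?]; exists g. Qed.
Lemma col_rot p q r : col p q r -> col q r p.
Proof. by case=> g [? ? ? ?]; exists g. Qed.

Hypothesis hS : is_projective S.

Lemma colxx p q : col p q q.
Proof. by case: hS => _ H _ _; case: (H p q) => g [? ? ?]; exists g. Qed.
Lemma colxyx p q : col p q p.
Proof. by apply: colC; apply: colxx. Qed.
Lemma colxxy p q : col p p q.
Proof. by apply: colCr; apply: colxyx. Qed.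

Lemma line_unique g h p q : lines g -> lines h -> p <> q ->
  g p -> g q -> h p -> h q -> g = h.
Proof. by case: hS => -[_ _ H] _ _ _; apply: H. Qed.

Lemma col_three p q a b c : p <> q -> col p q a -> col p q b -> col p q c ->
  col a b c.
Proof.
move=> pq [g [Lg gp gq ga]] [h [Lh hp hq hb]] [k [Lk kp kq kc]].
have E := line_unique Lg Lh pq gp gq hp hq; have E' := line_unique Lg Lk pq gp gq kp kq.
by rewrite -E in hb; rewrite -E' in kc; exists g.
Qed.

(** The axiom requires four determined lines; each coincidence of two points leaves an evident
    common point. *)
Lemma veblen A B C D Z : col A B Z -> col C D Z ->
  exists X, col A C X /\ col B D X.
Proof.
move=> [ab [Lab abA abB abZ]] [cd [Lcd cdC cdD cdZ]].
have [AB|AB] := pselect (A = B).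
  by exists A; split; [exact: colxyx|rewrite AB; exact: colxyx].
have [CD|CD] := pselect (C = D).
  by exists C; split; [exact: colxx|rewrite CD; exact: colxx].
have [AC|AC] := pselect (A = C).
  by exists B; split; [rewrite AC; exact: colxxy|exact: colxyx].
have [BD|BD] := pselect (B = D).
  by exists A; split; [exact: colxyx|rewrite BD; exact: colxxy].
have [ac [Lac acA acC _]] := colxx A C; have [bd [Lbd bdB bdD _]] := colxx B D.
case: hS => _ _ V _; have [] := V A B C D ab cd ac bd => //.
  by exists Z.
by move=> X [acX bdX]; exists X; split; [exists ac|exists bd].
Qed.

Lemma third_point p q : exists r, [/\ col p q r, r <> p & r <> q].
Proof.
have [g [Lg gp gq _]] := colxx p q; case: hS => _ _ _ H.
have [X [Y [Z [[gX gY gZ] [XY XZ YZ]]]]] := H g Lg.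
have inl r : g r -> col p q r by move=> gr; exists g.
have [Xp|Xp] := pselect (X = p).
  have [Yq|Yq] := pselect (Y = q).
    by exists Z; split; [exact: inl|move=> E; apply: XZ; rewrite E|move=> E; apply: YZ; rewrite E].
  by exists Y; split; [exact: inl|move=> E; apply: XY; rewrite E|].
have [Xq|Xq] := pselect (X = q); last by exists X; split=> //; exact: inl.
have [Yp|Yp] := pselect (Y = p).
  by exists Z; split; [exact: inl|move=> E; apply: YZ; rewrite E|move=> E; apply: XZ; rewrite E].
by exists Y; split; [exact: inl| |move=> E; apply: XY; rewrite E].
Qed.

End Collinear.

Ltac colp := first [assumption | apply: colC; assumption
  | apply: colCr; assumption | apply: col_rot; assumption
  | apply: col_rot; apply: col_rot; assumption
  | apply: colC; apply: col_rot; assumption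
  | apply: colxx; assumption | apply: colxyx; assumption | apply: colxxy; assumption].

Section Coord.
Variables (S : geometry) (F : fieldType).
Hypothesis hS : is_projective S.

(* The value of [psi] at 0 is irrelevant. *)
Record coord (V : vectType F) (psi : V -> points S) : Prop := Coord {
  coordZ : forall a v, a != 0 -> psi (a *: v) = psi v;
  coord_inj : forall u v, u != 0 -> v != 0 -> psi u = psi v ->
    exists a, u = a *: v;
  coordD : forall u v, ind2 u v -> col (psi u) (psi v) (psi (u + v));
  coord_onto : forall u v r, u != 0 -> v != 0 -> psi u <> psi v ->
    col (psi u) (psi v) r -> exists a b, a *: u + b *: v != 0 /\
      r = psi (a *: u + b *: v) }.

Definition coord_im (V : vectType F) (psi : V -> points S) r :=
  exists v, v != 0 /\ r = psi v.

Section Theory.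
Variables (V : vectType F) (psi : V -> points S).
Hypothesis psiC : coord psi.
Local Notation im := (coord_im psi).

Lemma coordN v : psi (- v) = psi v.
Proof. by rewrite -scaleN1r (coordZ psiC) // oppr_eq0 oner_neq0. Qed.

Lemma coord_neq u v : ind2 u v -> psi u <> psi v.
Proof.
move=> i E; have [] := coord_inj psiC (ind2_neq0 i) (ind2_neq0 (ind2C i)) E.
by move=> a; apply: ind2_nscale.
Qed.

Lemma coord_imP v : v != 0 -> im (psi v).
Proof. by exists v. Qed.

Lemma coord_im_closed p q r : p <> q -> im p -> im q -> col p q r -> im r.
Proof.
move=> pq [u [u0 pu]] [v [v0 qv]]; rewrite {}pu {}qv in pq * => c.
by have [a [b [n0 ->]]] := coord_onto psiC u0 v0 pq c; apply: coord_imP.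
Qed.

Lemma meet_once p q r : ~ im p -> im q -> im r -> col p q r -> q = r.
Proof.
move=> np iq ir c; apply: contrapT => qr; apply: np.
by apply: coord_im_closed qr iq ir _; apply: col_rot.
Qed.

Lemma coord_comb u v a b : ind2 u v -> (a != 0) || (b != 0) ->
  col (psi u) (psi v) (psi (a *: u + b *: v)).
Proof.
move=> i; have [->|a0] := eqVneq a 0; have [->|b0] := eqVneq b 0 => //= _.
- by rewrite scale0r add0r (coordZ psiC) //; apply: colxx.
- by rewrite scale0r addr0 (coordZ psiC) //; apply: colxyx.
rewrite -(coordZ psiC u a0) -(coordZ psiC v b0); apply: coordD => // c d.
rewrite !scalerA => /i[/eqP + /eqP].
by rewrite !mulf_eq0 (negPf a0) (negPf b0) !orbF => /eqP -> /eqP ->.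
Qed.

(** [O] and [P] are seen as points of an affine space with the image of [psi] at infinity, and [v]
    as their difference, of which only the direction is recorded. *)
Definition step O P v := O <> P /\ col O P (psi v).

Lemma step_sym O P v : step O P v -> step P O (- v).
Proof. by case=> n c; split; [move=> E; apply: n|rewrite coordN; apply: colC]. Qed.

(** The lines from [O] to [psi w] and from [P] to [psi (w - d)] meet by the Veblen-Young axiom, as
    [psi d] is on the line of [psi w] and [psi (w - d)]. *)
Lemma step_point O P d w : ~ im O -> ~ im P -> step O P d -> ind2 d w ->
  exists X, [/\ ~ im X, step O X w & step P X (w - d)].
Proof.
move=> nO nP [OP c] i.
have w0 : w != 0 by apply: ind2_neq0 (ind2C i).
have i' : ind2 d (w - d).
  move=> a b E; have [|ab b0] := i (a - b) b; first by rewrite -E; vring.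
  by split=> //; rewrite -[a](subrK b) ab b0 addr0.
have wd0 : w - d != 0 by apply: ind2_neq0 (ind2C i').
have i2 : ind2 w (w - d).
  move=> a b E; have [|/eqP + ab] := i (- b) (a + b); first by rewrite -E; vring.
  by rewrite oppr_eq0 => /eqP b0; move: ab; rewrite b0 addr0.
have dE : d = 1 *: w + (-1) *: (w - d) by vring.
have [|X [c1 c2]] := veblen hS c (C := psi w) (D := psi (w - d)).
  by rewrite {2}dE; apply: coord_comb; rewrite ?oner_neq0.
exists X; split; [move=> iX| |].
- have /(coord_neq i2) [] : psi w = psi (w - d).
  rewrite (meet_once nO (coord_imP w0) iX c1); apply/esym.
  exact: meet_once nP (coord_imP wd0) iX c2.
- split; last exact: colCr.
  move=> E; rewrite -E in c2; apply: (coord_neq i').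
  apply: (meet_once nP) (coord_imP (ind2_neq0 i')) (coord_imP wd0) _.
  by apply: (col_three hS OP); colp.
split; last exact: colCr.
move=> E; rewrite -E in c1; apply: (coord_neq i).
apply: (meet_once nO) (coord_imP (ind2_neq0 i)) (coord_imP w0) _.
by apply: (col_three hS OP); colp.
Qed.

(** Desargues in space: the line of [A] and [B] meets the image of [psi] only once, and this point
    is on the traces of the planes [O A B] and [P A B], the line of [psi w] and [psi w'] and that of
    [psi (w - d)] and [psi (w' - d)]. By independence these meet only in [psi (w - w')]. *)
Lemma step_compose O P A B d w w' : ~ im O -> ~ im P -> ~ im A -> ~ im B ->
  step O P d -> step O A w -> step O B w' -> step P A (w - d) ->
  step P B (w' - d) -> ind3 d w w' -> step A B (w - w').
Proof.
move=> nO nP nA nB [OP cOP] [OA cOA] [OB cOB] [PA cPA] [PB cPB] i.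
have iw := ind3_ind2r i.
have w0 := ind2_neq0 iw; have w'0 := ind2_neq0 (ind2C iw).
have iwd : ind2 (w - d) (w' - d).
  by move=> a b E; have [|_ -> ->] := i (- a - b) a b; rewrite // -E; vring.
have AB : A <> B.
  move=> E; rewrite -E in cOB; apply: (coord_neq iw).
  apply: (meet_once nO (coord_imP w0) (coord_imP w'0)).
  by apply: (col_three hS OA); colp.
split=> //.
have [||X [c1 c2]] := @veblen _ hS A (psi w) B (psi w') O; [colp|colp|].
have [||Y [c3 c4]] := @veblen _ hS A (psi (w - d)) B (psi (w' - d)) P; [colp|colp|].
have iX : im X.
  exact: coord_im_closed (coord_neq iw) (coord_imP w0) (coord_imP w'0) c2.
have wd0 := ind2_neq0 iwd; have w'd0 := ind2_neq0 (ind2C iwd).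
have iY : im Y.
  exact: coord_im_closed (coord_neq iwd) (coord_imP wd0) (coord_imP w'd0) c4.
have XY : X = Y.
  by apply: (meet_once nA iX iY); apply: (col_three hS AB); colp.
have [a [b [n1 E1]]] := coord_onto psiC w0 w'0 (coord_neq iw) c2.
rewrite -XY in c4.
have [a' [b' [n2 E2]]] := coord_onto psiC wd0 w'd0 (coord_neq iwd) c4.
have [|k E] := coord_inj psiC n1 n2; first by rewrite -E1 -E2.
have [] : [/\ k * (a' + b') = 0, a - k * a' = 0 & b - k * b' = 0].
  by apply: i; apply: (lincomb1 (c := 1) E); vring.
move=> e1 /eqP + /eqP; rewrite !subr_eq0 => /eqP Ea /eqP Eb.
have Eb' : b = - a.
  have -> : b = (a + b) - a by ring.
  by rewrite {1}Ea Eb -mulrDr e1 sub0r.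
have a0 : a != 0 by apply: contraNneq n1 => a0; rewrite Eb' a0 oppr0 !scale0r addr0.
have -> : psi (w - w') = X; last by [].
rewrite E1 Eb' -(coordZ psiC (w - w') a0); congr psi; vring.
Qed.
End Theory.
End Coord.

(** * Translations, and extension of coordinates by one point *)

Section Translations.
Variables (S : geometry) (F : fieldType).
Hypothesis hS : is_projective S.
Variables (V : vectType F) (psi : V -> points S).
Hypothesis psiC : coord psi.
Local Notation im := (coord_im psi).
Local Notation step := (step psi).

(** Dimension at least three, in the form in which it supplies the auxiliary directions for
    Desargues in space. *)
Definition unplanar := forall u v : V, exists w, ~ (exists a b : F, w = a *: u + b *: v).

Hypothesis big : unplanar.
Variable Q : points S.
Hypothesis nQ : ~ im Q.

Lemma step_opp O P v : step O P v -> step O P (- v).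
Proof. by case=> n c; split=> //; rewrite (coordN psiC). Qed.

Lemma unplanar_ind3 e u : ind2 e u -> exists w : V, ind3 e u w.
Proof. by move=> i; have [w H] := big e u; exists w; apply: ind3_comb. Qed.

Lemma unplanar_ind2 e : e != 0 -> exists u : V, ind2 e u.
Proof.
move=> e0; have [u H] := big e 0; exists u; apply: ind2C; apply: nind2 => //.
by move=> [c E]; apply: H; exists c, 0; rewrite scaler0 addr0.
Qed.

Section Closure.
Variable Th : V -> points S.
Hypothesis nTh : forall w, ~ im (Th w).
Local Notation T := (fun w w' => step (Th w) (Th w') (w' - w)).

Lemma trans_sym w w' : T w w' -> T w' w.
Proof. by move/(step_sym psiC); rewrite opprB. Qed.

Lemma trans_compose d w w' : T 0 d -> T 0 w -> T 0 w' -> T d w -> T d w' ->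
  ind3 d w w' -> T w w'.
Proof.
rewrite /= !subr0 => T1 T2 T3 T4 T5 i.
have := step_compose hS psiC (@nTh _) (@nTh _) (@nTh _) (@nTh _) T1 T2 T3 T4 T5 i.
by move/step_opp; rewrite opprB.
Qed.

(** The direction of [w' - w] is that of [w], and both translates are on one line through [Th 0];
    the auxiliary [u] shows that they differ. *)
Lemma trans_par u w w' c : T 0 w -> T 0 w' -> T u w -> T u w' -> w' = c *: w ->
  ind2 u w -> w <> w' -> w' != 0 -> T w w'.
Proof.
rewrite /= !subr0 => -[n1 c1] [n2 c2] [n3 c3] [n4 c4] E i ww' w'0.
have c0 : c != 0 by apply: contraNneq w'0 => c0; rewrite E c0 scale0r.
have c10 : c - 1 != 0.
  by rewrite subr_eq0; apply/eqP => c1'; apply: ww'; rewrite E c1' scale1r.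
split.
  move=> Eth; rewrite -Eth in c4.
  have i' : ind2 (w - u) (w' - u).
    move=> a b Eab; have [|/eqP + /eqP] := i (- a - b) (a + b * c).
      by rewrite -Eab E; vring.
    rewrite -opprD oppr_eq0 addr_eq0 => /eqP ->.
    have -> : - b + b * c = b * (c - 1) by ring.
    by rewrite mulf_eq0 (negPf c10) orbF => /eqP ->; rewrite oppr0.
  apply: (coord_neq psiC i'); apply: (meet_once psiC (@nTh u)).
  - exact: coord_imP (ind2_neq0 i').
  - exact: coord_imP (ind2_neq0 (ind2C i')).
  - by apply: (col_three hS n3); colp.
have -> : psi (w' - w) = psi w.
  by rewrite -(coordZ psiC w c10) E; congr psi; vring.
have Ew' : psi w' = psi w by rewrite E (coordZ psiC).
rewrite Ew' in c2.
have nw : Th 0 <> psi w.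
  by move=> Ew; apply: (@nTh 0); rewrite Ew; apply: coord_imP (ind2_neq0 (ind2C i)).
by apply: (col_three hS nw); colp.
Qed.

End Closure.

(* Fixing the translation that takes Q to a third point R of the line Q psi(e),
   the translate of Q by w has to be the intersection of the lines Q psi(w) and
   R psi(w - e); on the line Q psi(e) itself another direction replaces e. *)
Lemma translations : exists Th : V -> points S, [/\ Th 0 = Q,
  forall w, ~ im (Th w) & forall w w', w <> w' -> step (Th w) (Th w') (w' - w)].
Proof.
have [e He] := big 0 0.
have e0 : e != 0 by apply/eqP => e0; apply: He; exists 0, 0; rewrite e0 !scaler0 addr0.
have [R [cR RQ Re]] := third_point hS Q (psi e).
have nR : ~ im R.
  move=> iR; apply: Re; apply/esym; apply: (meet_once psiC nQ (coord_imP _ e0) iR cR).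
have QR : step Q R e by split; [exact/nesym|apply: colCr].
have ind_e w : ~ (exists c, w = c *: e) -> ind2 e w.
  by move=> nw; apply: ind2C; apply: nind2.
have nind_e w : ind2 e w -> ~ (exists c, w = c *: e).
  by move=> i [c]; apply: ind2_nscale; apply: ind2C.
have [u0 iu0] := unplanar_ind2 e0.
have [w|Th1 Th1P] := @choice _ _ (fun w X =>
    ind2 e w -> [/\ ~ im X, step Q X w & step R X (w - e)]).
  have [i|] := pselect (ind2 e w); last by exists Q.
  by have [X HX] := step_point hS psiC nQ nR QR i; exists X.
have [nU0 QU0 RU0] := Th1P _ iu0.
(* Multiples of [e] are located from [Q] and the translate by [u0]. At [e] itself this is consistent
   with [R], by [RU0] reversed. *)
pose spec w X := ~ im X /\ [/\ w = 0 -> X = Q, w = e -> X = R,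
  ind2 e w -> X = Th1 w &
  (exists c, w = c *: e) -> w <> 0 -> step Q X w /\ step (Th1 u0) X (w - u0)].
have [w|Th ThP] := @choice _ _ spec.
  have [->|/eqP w0] := eqVneq w 0.
    exists Q; split=> //; split=> //; first by move=> E; rewrite -E eqxx in e0.
    by move=> i; have := ind2_neq0 (ind2C i); rewrite eqxx.
  have [->|/eqP we] := eqVneq w e.
    exists R; split=> //; split=> //; first by move=> E; rewrite E eqxx in e0.
      by case/nind_e; exists 1; rewrite scale1r.
    by move=> _ _; split=> //; rewrite -opprB; apply: (step_sym psiC).
  have [cw|nw] := pselect (exists c, w = c *: e).
    have [|X [nX QX UX]] := step_point hS psiC nQ nU0 QU0 (w := w).
      case: cw => c E a b Eab; have [|/eqP + ->] := iu0 (b * c) a.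
        by rewrite -Eab E; vring.
      rewrite mulf_eq0 => /orP[/eqP -> //|/eqP c0].
      by case: w0; rewrite E c0 scale0r.
    by exists X; split=> //; split=> // /nind_e.
  have [nX QX UX] := Th1P _ (ind_e _ nw).
  by exists (Th1 w); split.
have nTh w : ~ im (Th w) by case: (ThP w).
have Th0 : Th 0 = Q by case: (ThP 0) => _ [-> //].
have The : Th e = R by case: (ThP e) => _ [_ -> //].
have ThE w : ind2 e w -> Th w = Th1 w by case: (ThP w) => _ [].
have T0e : step (Th 0) (Th e) (e - 0) by rewrite subr0 Th0 The.
have T0n w : ind2 e w -> step (Th 0) (Th w) (w - 0).
  by move=> i; rewrite subr0 Th0 (ThE _ i); case: (Th1P _ i).
have Ten w : ind2 e w -> step (Th e) (Th w) (w - e).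
  by move=> i; rewrite The (ThE _ i); case: (Th1P _ i).
have Tc w : (exists c, w = c *: e) -> w <> 0 ->
    step (Th 0) (Th w) (w - 0) /\ step (Th u0) (Th w) (w - u0).
  by rewrite subr0 Th0 (ThE _ iu0); case: (ThP w) => _ [].
have T2 w w' : ind3 e w w' -> step (Th w) (Th w') (w' - w).
  move=> i; have i1 := ind3_ind2 i; have i2 := ind3_ind2s i.
  by apply: (trans_compose nTh (d := e)) => //; [apply: T0n|apply: T0n|apply: Ten|apply: Ten].
(* If [w'] is in the span of [e] and [w], the translate by some [u] outside this span replaces that
   by [e] in the composition. *)
have T3 w w' : ind2 e w -> ind2 e w' -> w <> w' -> step (Th w) (Th w') (w' - w).
  move=> i1 i2 ww'; have [i|ni] := pselect (ind3 e w w'); first exact: T2.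
  have [a [b E]] : exists a b, w' = a *: e + b *: w.
    by apply: contrapT => H; apply: ni; apply: ind3_comb.
  have b0 : b != 0.
    apply/eqP => b0; apply: (nind_e _ i2); exists a.
    by rewrite E b0 scale0r addr0.
  have [u iu] := unplanar_ind3 i1.
  have iu' : ind3 e w' u.
    move=> x y z Exyz; have [|e1 /eqP + ->] := iu (x + y * a) (y * b) z.
      by rewrite -Exyz E; vring.
    rewrite mulf_eq0 (negPf b0) orbF => /eqP y0.
    by move: e1; rewrite y0 mul0r addr0.
  have Tuw := trans_sym (T2 _ _ iu); have Tuw' := trans_sym (T2 _ _ iu').
  have [[c Ec]|nc] := pselect (exists c, w' = c *: w).
    apply: (trans_par nTh (T0n _ i1) (T0n _ i2) Tuw Tuw' Ec) => //.
      exact: ind2C (ind3_ind2r iu).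
    exact: ind2_neq0 (ind2C i2).
  apply: (trans_compose nTh (T0n _ _) (T0n _ i1) (T0n _ i2) Tuw Tuw').
    exact: ind3_ind2s iu.
  have a0 : a != 0.
    by apply/eqP => a0; apply: nc; exists b; rewrite E a0 scale0r add0r.
  move=> x y z Exyz; have [|/eqP + e2 ->] := iu (z * a) (y + z * b) x.
    by rewrite -Exyz E; vring.
  rewrite mulf_eq0 (negPf a0) orbF => /eqP z0.
  by move: e2; rewrite z0 mul0r addr0.
(* At first [w] is related only to 0 and [u0]. [K] passes from [u] to any [w2] independent of [u]
   and [e]; applied twice, it also reaches the span of [u0] and [e]. *)
have T4 w w' : (exists c, w = c *: e) -> w <> 0 -> ind2 e w' ->
    step (Th w) (Th w') (w' - w).
  move=> cw w0 i'; have [T0w Tuw] := Tc _ cw w0; have [c E] := cw.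
  have c0 : c != 0 by apply/eqP => c0; apply: w0; rewrite E c0 scale0r.
  have K u w2 : step (Th u) (Th w) (w - u) -> ind3 u e w2 ->
      step (Th w) (Th w2) (w2 - w).
    move=> Tu i; have iu : ind2 e u := ind2C (ind3_ind2 i).
    have iw2 : ind2 e w2 := ind3_ind2r i.
    apply: (trans_compose nTh (T0n _ iu) T0w (T0n _ iw2) Tu).
      apply: T3 => // uw2; have [|/eqP] := i 1 0 (-1).
        by rewrite uw2; vring.
      by rewrite oner_eq0.
    move=> x y z Exyz; have [|-> /eqP + ->] := i x (y * c) z.
      by rewrite -Exyz E; vring.
    by rewrite mulf_eq0 (negPf c0) orbF => /eqP ->.
  have [i|ni] := pselect (ind3 u0 e w'); first exact: K i.
  have [a [b Eab]] : exists a b, w' = a *: u0 + b *: e.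
    by apply: contrapT => H; apply: ni; apply: ind3_comb => //; apply: ind2C.
  have a0 : a != 0.
    by apply/eqP => a0; apply: (nind_e _ i'); exists b; rewrite Eab a0 scale0r add0r.
  have [u iu] := unplanar_ind3 (ind2C iu0).
  apply: (K u); first exact/trans_sym/(K u0).
  move=> x y z Exyz; have [|/eqP + e1 ->] := iu (z * a) (y + z * b) x.
    by rewrite -Exyz Eab; vring.
  rewrite mulf_eq0 (negPf a0) orbF => /eqP z0.
  by move: e1; rewrite z0 mul0r addr0.
have T0all w : w <> 0 -> step (Th 0) (Th w) (w - 0).
  move=> w0; have [cw|/ind_e i] := pselect (exists c, w = c *: e); last exact: T0n.
  by have [] := Tc _ cw w0.
exists Th; split=> // w w' ww'.
have [w0|/eqP w0] := eqVneq w 0; first by rewrite w0; apply: T0all => w'0; apply: ww'; rewrite w0 w'0.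
have [w'0|/eqP w'0] := eqVneq w' 0; first by rewrite w'0; apply: trans_sym; apply: T0all.
have [cw|/ind_e i] := pselect (exists c, w = c *: e); last first.
  have [cw'|/ind_e i'] := pselect (exists c, w' = c *: e); last exact: T3.
  by apply: trans_sym; apply: T4.
have [cw'|/ind_e i'] := pselect (exists c, w' = c *: e); last exact: T4.
have [T1 T2'] := Tc _ cw w0; have [T3' T4'] := Tc _ cw' w'0.
have [[c E] [c' E']] := (cw, cw').
have c0 : c != 0 by apply/eqP => c0; apply: w0; rewrite E c0 scale0r.
apply: (trans_par nTh T1 T3' T2' T4' (c := c' / c)) => //.
- by rewrite E' E; vfield.
- move=> a b Eab; have [|/eqP + ->] := iu0 (b * c) a; first by rewrite -Eab E; vring.
  by rewrite mulf_eq0 (negPf c0) orbF => /eqP ->.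
- exact/eqP.
Qed.
End Translations.

Section Extension.
Variables (S : geometry) (F : fieldType).
Hypothesis hS : is_projective S.
Variables (V : vectType F) (psi : V -> points S).
Hypothesis psiC : coord psi.
Local Notation im := (coord_im psi).
Hypothesis big : unplanar V.
Variable Th : V -> points S.
Hypothesis nTh : forall w, ~ im (Th w).
Hypothesis ThT : forall w w', w <> w' -> step psi (Th w) (Th w') (w' - w).

Lemma affine_neq w v : v != 0 -> Th w <> psi v.
Proof. by move=> v0 E; apply: (@nTh w); rewrite E; apply: coord_imP. Qed.

Lemma affine_inj w w' : Th w = Th w' -> w = w'.
Proof. by move=> E; apply: contrapT => /ThT[]. Qed.

Lemma affine_col w v t : v != 0 -> t != 0 -> col (Th w) (Th (w + t *: v)) (psi v).
Proof.
move=> v0 t0; have [|_] := @ThT w (w + t *: v).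
  move=> E; have := lincomb1 (x := t *: v) (y := 0) (c := -1) E; rewrite subr0 => H.
  have /eqP : t *: v = 0 by apply: H; vring.
  by rewrite scaler_eq0 (negPf t0) (negPf v0).
have -> : w + t *: v - w = t *: v by vring.
by rewrite (coordZ psiC).
Qed.

(** A second affine point [Th (w + v')] projects [r] to infinity, onto the line of [psi v'] and
    [psi v]. The coordinates on that line are onto, so the projection is [psi (v' + c *: v)] for
    some scalar c, and then [r] is [Th (w - c *: v)]. *)
Lemma affine_onto w v r : v != 0 -> col (Th w) (psi v) r ->
  r = psi v \/ exists t, r = Th (w + t *: v).
Proof.
move=> v0 c; have [|rv] := pselect (r = psi v); first by left.
right; have nr : ~ im r.
  move=> ir; apply: rv; apply/esym; exact: (meet_once psiC (@nTh w) (coord_imP _ v0) ir c).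
have [rw|rw] := pselect (r = Th w); first by exists 0; rewrite rw scale0r addr0.
have [v' i] := unplanar_ind2 big v0.
have v'0 : v' != 0 := ind2_neq0 (ind2C i).
have c1 : col (Th w) (Th (w + v')) (psi v').
  by rewrite -{1}(scale1r v'); apply: affine_col; rewrite ?oner_neq0.
have ww' : Th w <> Th (w + v').
  move/affine_inj => E; move/eqP: v'0; apply.
  by apply: (lincomb1 (c := -1) E); vring.
have wv := affine_neq (w := w) v0.
have rw' : r <> Th (w + v').
  move=> E; rewrite E in c; apply: (coord_neq psiC i).
  apply: (meet_once psiC (@nTh w) (coord_imP _ v0) (coord_imP _ v'0)).
  by apply: (col_three hS ww'); colp.
have [||X [cX1 cX2]] := @veblen _ hS (Th (w + v')) (psi v') r (psi v) (Th w); [colp|colp|].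
have iX : im X.
  apply: (coord_im_closed psiC (coord_neq psiC (ind2C i))) cX2; exact: coord_imP.
have Xv : X <> psi v.
  move=> E; rewrite E in cX1; apply: (coord_neq psiC i).
  apply: (meet_once psiC (@nTh (w + v')) (coord_imP _ v0) (coord_imP _ v'0)).
  apply: (col_three hS ww'); [colp| |colp].
  have : col (psi v) (Th w) (Th (w + v')).
    by apply: (col_three hS rv); colp.
  by move=> ?; colp.
have Xv' : X <> psi v'.
  move=> E; rewrite E in cX1; apply: (coord_neq psiC i).
  apply: (meet_once psiC nr (coord_imP _ v0) (coord_imP _ v'0)).
  have wv'' := affine_neq (w := w + v') v'0.
  have : col r (Th w) (psi v') by apply: (col_three hS wv''); colp.
  by move=> ?; apply: (col_three hS rw); colp.
have [a [b [n0 EX]]] := coord_onto psiC v'0 v0 (coord_neq psiC (ind2C i)) cX2.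
have a0 : a != 0.
  apply/eqP => a0; apply: Xv; move: n0 EX; rewrite a0 scale0r add0r.
  by rewrite scaler_eq0 negb_or => /andP[b0 _] ->; rewrite (coordZ psiC).
have b0 : b != 0.
  apply/eqP => b0; apply: Xv'; move: n0 EX; rewrite b0 scale0r addr0 => _ ->.
  by rewrite (coordZ psiC).
pose d := v' + (b / a) *: v.
have Ed : X = psi d.
  by rewrite EX -(coordZ psiC d a0) /d; congr psi; vfield.
have id : ind2 v d.
  move=> x y E; have [|/eqP + y0] := i (x + y * (b / a)) y.
    by rewrite -E /d; vring.
  by rewrite y0 mul0r addr0 => /eqP ->.
have d0 := ind2_neq0 (ind2C id).
exists (- (b / a)); apply: contrapT => rS; set S'' := Th _ in rS.
have cS1 : col (Th w) S'' (psi v).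
  by apply: affine_col => //; rewrite oppr_eq0 mulf_neq0 ?invr_eq0.
have cS2 : col (Th (w + v')) S'' (psi d).
  have -> : S'' = Th (w + v' + (-1) *: d) by congr Th; rewrite /d; vring.
  by apply: affine_col; rewrite ?oppr_eq0 ?oner_neq0.
apply: (coord_neq psiC id); apply: (meet_once psiC nr (coord_imP _ v0) (coord_imP _ d0)).
have k1 : col r S'' (psi v) by apply: (col_three hS wv); colp.
have wd := affine_neq (w := w + v') d0; rewrite Ed in cX1.
have k2 : col r S'' (psi d) by apply: (col_three hS wd); colp.
by apply: (col_three hS rS); colp.
Qed.

(** Homogeneous coordinates of the affine space of translates, with last coordinate 0 at
    infinity. *)
Definition psi_ext (p : (V * F^o)%type) : points S :=
  if p.2 == 0 then psi p.1 else Th (p.2^-1 *: p.1).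

Local Notation "<| v , s |>" := ((v, s) : (V * F^o)%type) (at level 0).

Lemma psi_ext0 v : psi_ext (v, 0) = psi v.
Proof. by rewrite /psi_ext eqxx. Qed.

Lemma psi_extN v s : s != 0 -> psi_ext (v, s) = Th (s^-1 *: v).
Proof. by rewrite /psi_ext => /negPf ->. Qed.

Lemma pairZ a v (s : F) : a *: ((v, s) : (V * F^o)%type) = (a *: v, a * s).
Proof. by []. Qed.
Lemma pairD v v' (s s' : F) : ((v, s) : (V * F^o)%type) + (v', s') = (v + v', s + s').
Proof. by []. Qed.

Lemma psi_ext_coord : coord psi_ext.
Proof.
have pair0 (v : V) : ((v, 0 : F^o) != 0 :> V * F^o) = (v != 0).
  by rewrite -[0 in RHS]/((0 : V * F^o).1) xpair_eqE eqxx andbT.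
have onto1 (v v' : V) (s' : F) r : v != 0 -> s' != 0 ->
   col (psi v) (Th (s'^-1 *: v')) r ->
   exists a b : F, (a *: <|v, 0|> + b *: <|v', s'|> != 0) /\
      r = psi_ext (a *: <|v, 0|> + b *: <|v', s'|>).
  move=> v0 s0 c; have [->|[t ->]] := affine_onto v0 (colC c).
    exists 1, 0; rewrite !pairZ pairD !mul0r mulr0 addr0 scale0r addr0 scale1r.
    by rewrite psi_ext0 pair0.
  exists (t * s'), 1; rewrite !pairZ pairD mulr0 mul1r add0r; split.
    by rewrite xpair_eqE negb_and s0 orbT.
  by rewrite psi_extN //; congr Th; vfield.
have D1 (v v' : V) (s' : F) : v != 0 -> s' != 0 -> 
   col (psi v) (Th (s'^-1 *: v')) (psi_ext (v + v', s')).
  move=> v0 s0; rewrite psi_extN //.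
  have : col (Th (s'^-1 *: v')) (Th (s'^-1 *: v' + s'^-1 *: v)) (psi v).
    by apply: affine_col; rewrite ?invr_eq0.
  by rewrite -scalerDr addrC => ?; colp.
split.
- move=> a [v s] a0; rewrite pairZ /psi_ext /= mulf_eq0 (negPf a0) /=.
  have [s0|s0] := eqVneq s 0; first by rewrite (coordZ psiC).
  by congr Th; vfield; nz.
- move=> [v s] [v' s']; have [->|s0] := eqVneq s 0.
    rewrite pair0 psi_ext0 => v0.
    have [->|s'0] := eqVneq s' 0.
      rewrite pair0 psi_ext0 => v'0 E; have [a ->] := coord_inj psiC v0 v'0 E.
      by exists a; rewrite pairZ mulr0.
    by rewrite psi_extN // => _ /esym/affine_neq[].
  rewrite psi_extN // => _; have [->|s'0] := eqVneq s' 0.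
    by rewrite pair0 psi_ext0 => v'0 /affine_neq[].
  rewrite psi_extN // => _ /affine_inj E; exists (s / s').
  rewrite pairZ divfK //; congr (_, _).
  by apply: (lincomb1 (c := s) E); vfield; nz.
- move=> [v s] [v' s'] i.
  have [s0|s0] := eqVneq s 0.
    have v0 : v != 0 by rewrite -pair0 -s0; apply: ind2_neq0 i.
    rewrite s0 psi_ext0; have [s'0|s'0] := eqVneq s' 0.
      rewrite s'0 pairD addr0 !psi_ext0; apply: (coordD psiC) => a b E.
      by apply: i; rewrite !pairZ pairD E s0 s'0 !mulr0 addr0.
    by rewrite psi_extN // pairD add0r; apply: D1.
  have [s'0|s'0] := eqVneq s' 0.
    have v'0 : v' != 0 by rewrite -pair0 -s'0; apply: ind2_neq0 (ind2C i).
    rewrite s'0 psi_ext0 psi_extN // pairD addr0 addrC.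
    by apply: colC; apply: D1.
  set w := s^-1 *: v; set w' := s'^-1 *: v'.
  have ww' : w' - w != 0.
    apply/eqP => E; case: (@ind2_nscale _ _ _ _ (s / s') i).
    rewrite pairZ divfK //; congr (_, _).
    by apply: (lincomb1 (c := - s) E); rewrite /w /w'; vfield; nz.
  rewrite pairD (psi_extN v s0) (psi_extN v' s'0) -/w -/w'.
  have c1 : col (Th w) (Th w') (psi (w' - w)).
    have {1}-> : w' = w + 1 *: (w' - w) by vring.
    by apply: affine_col; rewrite ?oner_neq0.
  have [ss0|ss0] := eqVneq (s + s') 0.
    rewrite ss0 psi_ext0; have -> : v + v' = s' *: (w' - w).
      have -> : s' = - s by apply/eqP; rewrite -addr_eq0 addrC ss0.
      have Es' : s' = - s by apply/eqP; rewrite -addr_eq0 addrC ss0.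
      by rewrite /w /w' Es'; vfield; rewrite ?oppr_eq0 s0.
    by rewrite (coordZ psiC).
  rewrite psi_extN //.
  have -> : (s + s')^-1 *: (v + v') = w + (s' / (s + s')) *: (w' - w).
    by rewrite /w /w'; vfield; nz.
  have c2 : col (Th w) (Th (w + (s' / (s + s')) *: (w' - w))) (psi (w' - w)).
    by apply: affine_col => //; nz.
  have nw := affine_neq (w := w) ww'.
  by apply: (col_three hS nw); colp.
move=> [v s] [v' s'] r; have [->|s0] := eqVneq s 0.
  rewrite pair0 psi_ext0 => v0; have [->|s'0] := eqVneq s' 0.
    rewrite pair0 psi_ext0 => v'0 vv' c.
    have [a [b [n0 ->]]] := coord_onto psiC v0 v'0 vv' c.
    by exists a, b; rewrite !pairZ pairD !mulr0 addr0 pair0 psi_ext0.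
  by rewrite psi_extN // => _ _ c; apply: onto1.
rewrite psi_extN // => _; have [->|s'0] := eqVneq s' 0.
  rewrite pair0 psi_ext0 => v'0 _ c.
  have [a [b [n0 ->]]] := onto1 v' v s r v'0 s0 (colC c).
  by exists b, a; rewrite addrC.
rewrite psi_extN // => _; set w := s^-1 *: v; set w' := s'^-1 *: v' => ww' c.
have d0 : w' - w != 0.
  by rewrite subr_eq0; apply/eqP => E; apply: ww'; rewrite E.
have c1 : col (Th w) (Th w') (psi (w' - w)).
  have {1}-> : w' = w + 1 *: (w' - w) by vring.
  by apply: affine_col; rewrite ?oner_neq0.
have [|->|[t ->]] := affine_onto (r := r) (w := w) d0.
- by apply: (col_three hS ww'); colp.
- exists (- s^-1), s'^-1; rewrite !pairZ pairD mulNr !mulVf // addNr pair0 psi_ext0.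
  have -> : - s^-1 *: v + s'^-1 *: v' = w' - w by rewrite /w /w'; vring.
  by [].
exists ((1 - t) * s^-1), (t * s'^-1); rewrite !pairZ pairD -!mulrA !mulVf // !mulr1 subrK.
split; first by rewrite xpair_eqE negb_and oner_neq0 orbT.
by rewrite psi_extN ?oner_neq0 // invr1 scale1r; congr Th; rewrite /w /w'; vring.
Qed.

End Extension.

Lemma coord_extend (S : geometry) (F : fieldType) (V : vectType F)
    (psi : V -> points S) Q : is_projective S -> coord psi -> unplanar V ->
  ~ coord_im psi Q ->
  exists psi' : (V * F^o)%type -> points S, [/\ coord psi',
    forall v, psi' (v, 0) = psi v & psi' (0, 1) = Q].
Proof.
move=> hS psiC big nQ; have [Th [Th0 nTh ThT]] := translations hS psiC big nQ.
exists (psi_ext psi Th); split; first exact: psi_ext_coord.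
  by move=> v; rewrite psi_ext0.
by rewrite psi_extN ?oner_neq0 // scaler0.
Qed.

Section Cover.
Variables (S : geometry) (F : fieldType).
Hypothesis hS : is_projective S.

Lemma unplanar_pair (V : vectType F) : unplanar V -> unplanar (V * F^o)%type.
Proof.
move=> big [u s] [v t]; have [w H] := big u v; exists (w, 0) => -[a [b E]].
by apply: H; exists a, b; have := f_equal fst E.
Qed.

(** Each point not yet covered enlarges the vector space by a factor [F^o], so the space itself is
    quantified, and [iota] keeps track of the original one. *)
Lemma coord_cover (I : eqType) (s : I -> points S) (r : seq I) (V : vectType F)
    (psi : V -> points S) : coord psi -> unplanar V ->
  exists (W : vectType F) (psi' : W -> points S) (iota : 'Hom(V, W)),
    [/\ coord psi', forall v, psi' (iota v) = psi v, forall v, iota v = 0 -> v = 0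
      & forall i, i \in r -> coord_im psi' (s i)].
Proof.
elim: r V psi => [|i r IH] V psi psiC big.
  by exists V, psi, (\1%VF); split=> // v; rewrite id_lfunE.
have [[v [v0 sv]]|ni] := pselect (coord_im psi (s i)).
  have [W [psi' [iota [C' E inj cov]]]] := IH V psi psiC big.
  exists W, psi', iota; split=> // j; rewrite inE => /orP[/eqP ->|/cov //].
  exists (iota v); rewrite E; split=> //; apply: contra_neq v0; exact: inj.
have [psi1 [C1 E1 E1']] := coord_extend hS psiC big ni.
have [W [psi' [iota [C' E inj cov]]]] := IH _ psi1 C1 (unplanar_pair big).
have [h hE] : exists h : 'Hom(V, W), forall v, h v = iota (v, 0).
  apply: hom_of_linear => a u v; rewrite -homZ -homD; congr (iota _).
  by congr (_, _); rewrite /= scaler0 addr0.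
exists W, psi', h; split=> //.
- by move=> v; rewrite hE E E1.
- by move=> v; rewrite hE => /inj [].
move=> j; rewrite inE => /orP[/eqP ->|/cov //].
exists (iota (0, 1)); rewrite E E1'; split=> //.
by apply/eqP => /inj [] /eqP; rewrite oner_eq0.
Qed.

End Cover.

(** * Linear morphisms on homogeneous coordinates *)

Section Alm.
Variables (S : geometry) (F : fieldType).
Implicit Types (p q : option (points S)).

(** [join_set] for sets of at most one point, [None] being the empty set. *)
Definition jn p q r := [\/ p = Some r, q = Some r |
  exists x y, [/\ p = Some x, q = Some y, x <> y & col x y r]].

(* A linear morphism into S in homogeneous coordinates, with None at 0. *)
Record alm (V : vectType F) (f : V -> option (points S)) : Prop := Alm {
  alm0 : f 0 = None;
  almZ : forall a v, a != 0 -> f (a *: v) = f v;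
  almD : forall u v r, f (u + v) = Some r -> jn (f u) (f v) r;
  almK : forall u v, f u = f v -> f u <> None -> exists a, f (u + a *: v) = None;
  almO : forall u v r, jn (f u) (f v) r -> exists a b, f (a *: u + b *: v) = Some r }.

Section Opt.
Hypothesis hS : is_projective S.
Variables (W : vectType F) (psi : W -> points S).
Hypothesis psiC : coord psi.
Implicit Types w z : W.

Definition opt w := if w == 0 then None else Some (psi w).

Lemma opt0 : opt 0 = None. Proof. by rewrite /opt eqxx. Qed.
Lemma optN w : w != 0 -> opt w = Some (psi w).
Proof. by rewrite /opt => /negPf ->. Qed.
Lemma opt_eq0 w : opt w = None -> w = 0.
Proof. by rewrite /opt; case: eqVneq. Qed.

Lemma opt_some w r : opt w = Some r -> w != 0 /\ r = psi w.
Proof. by rewrite /opt; case: eqVneq => // w0 [->]. Qed.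

Lemma par_opt w z : par w z -> opt w = opt z.
Proof.
case=> a a0 ->; rewrite /opt scaler_eq0 (negPf a0) /=.
by rewrite (coordZ psiC).
Qed.

Lemma opt_par w z : opt w = opt z -> par w z.
Proof.
have [->|w0] := eqVneq w 0; first by rewrite opt0 => /esym/opt_eq0 ->; apply: par_refl.
rewrite (optN w0) => /esym/opt_some[z0 E]; have [a Ea] := coord_inj psiC w0 z0 E.
exact: par_scale Ea.
Qed.

Lemma opt_jn w z c d : c *: w + d *: z != 0 ->
  jn (opt w) (opt z) (psi (c *: w + d *: z)).
Proof.
move=> n0; have [w0|w0] := eqVneq w 0.
  constructor 2; rewrite -optN //; apply: par_opt; apply: par_sym.
  apply: (par_scale (c := d)) => //.
  by rewrite w0 scaler0 add0r.
have [[a Ea]|na] := pselect (exists a, z = a *: w).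
  constructor 1; rewrite -optN //; apply: par_opt; apply: par_sym.
  by apply: (par_scale (c := c + d * a)) => //; rewrite Ea; vring.
have i : ind2 w z by apply: ind2C; apply: nind2.
constructor 3; exists (psi w), (psi z); split.
- exact: optN.
- exact/optN/(ind2_neq0 (ind2C i)).
- exact: coord_neq.
apply: coord_comb => //; apply: contraNT n0; rewrite negb_or !negbK.
by move=> /andP[/eqP -> /eqP ->]; rewrite !scale0r addr0.
Qed.

Lemma jn_opt w z r : jn (opt w) (opt z) r ->
  exists c d, c *: w + d *: z != 0 /\ r = psi (c *: w + d *: z).
Proof.
case=> [/opt_some[w0 ->]|/opt_some[z0 ->]|].
- by exists 1, 0; rewrite scale1r scale0r addr0.
- by exists 0, 1; rewrite scale1r scale0r add0r.
case=> x [y [/opt_some[w0 ->] /opt_some[z0 ->] n c]].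
exact: coord_onto.
Qed.

Lemma lmap_alm (V : vectType F) (L : V -> W) : lmap L -> alm (fun v => opt (L v)).
Proof.
move=> LL; split.
- by rewrite (lmap0 LL) opt0.
- by move=> a v a0; apply: par_opt; apply: lmapZ.
- move=> u v r /opt_some[n0 ->]; have [a [b E]] := lmapD LL u v.
  by rewrite E in n0 *; apply: opt_jn.
- move=> u v /opt_par[c _ /(lmapK LL)[a E]] _.
  by exists a; rewrite E opt0.
- move=> u v r /jn_opt[c [d [n0 ->]]]; have [a [b P]] := lmapO LL u v c d.
  by exists a, b; rewrite (par_opt P) optN.
Qed.

(** Together with [lmap_alm] this makes both notions equivalent once the values have coordinates, so
    the results on maps of vectors apply to morphisms into [S]. *)
Lemma alm_lmap (V : vectType F) (L : V -> W) f : alm f ->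
  (forall v, f v = opt (L v)) -> lmap L.
Proof.
move=> fA fL; split.
- by apply: opt_eq0; rewrite -fL (alm0 fA).
- by move=> a v a0; apply: opt_par; rewrite -!fL (almZ fA).
- move=> u v; have [E|n0] := eqVneq (L (u + v)) 0.
    by exists 0, 0; rewrite E !scale0r addr0.
  have := almD fA (u := u) (v := v) (r := psi (L (u + v))).
  rewrite !fL optN // => /(_ erefl)/jn_opt[c [d [n1 E]]].
  have [x _ Ex] : par (L (u + v)) (c *: L u + d *: L v).
    by apply: opt_par; rewrite !optN // E.
  by exists (x * c), (x * d); rewrite Ex; vring.
- move=> u v c E; have [u0|u0] := eqVneq (L u) 0.
    by exists 0; rewrite scale0r addr0.
  have [||a Ea] := almK fA (u := u) (v := v).
  + by rewrite !fL; apply: par_opt; apply: par_scale E.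
  + by rewrite fL optN.
  by exists a; apply: opt_eq0; rewrite -fL.
- move=> u v c d; have [E|n0] := eqVneq (c *: L u + d *: L v) 0.
    exists 0, 0; rewrite E !scale0r addr0; have -> : L 0 = 0.
      by apply: opt_eq0; rewrite -fL (alm0 fA).
    exact: par_refl.
  have [|a [b E]] := almO fA (u := u) (v := v) (r := psi (c *: L u + d *: L v)).
    by rewrite !fL; apply: opt_jn.
  exists a, b; apply: opt_par; rewrite -fL E optN //.
Qed.

End Opt.

Lemma alm_comp (U V : vectType F) (f : V -> option (points S)) (g : 'Hom(U, V)) :
  (forall u, g u = 0 -> u = 0) -> alm f -> alm (fun u => f (g u)).
Proof.
move=> g0 fA; split.
- by rewrite hom0 (alm0 fA).
- by move=> a v a0; rewrite homZ (almZ fA).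
- by move=> u v r; rewrite homD; apply: almD.
- by move=> u v E n; have [a] := almK fA E n; exists a; rewrite homD homZ.
- by move=> u v r /(almO fA)[a [b E]]; exists a, b; rewrite homD !homZ.
Qed.

End Alm.

Section Closure.
Variables (S : geometry) (F : fieldType) (V : vectType F) (f : V -> option (points S)).
Hypothesis fA : alm f.

Lemma subspace_jn (N : set (points S)) p q r : subspace N ->
  (forall x, p = Some x -> N x) -> (forall x, q = Some x -> N x) -> jn p q r -> N r.
Proof.
move=> sN Np Nq [/Np //|/Nq //|[x [y [Ex Ey xy [g [Lg gx gy gr]]]]]].
by apply: (sN g x y) gr => //; [apply: Np|apply: Nq].
Qed.

Lemma alm_span (N : set (points S)) (s : seq V) v p : subspace N ->
  (forall w x, w \in s -> f w = Some x -> N x) -> v \in <<s>>%VS ->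
  f v = Some p -> N p.
Proof.
move=> sN; elim: s v p => [|w s IH] v p Hs.
  by rewrite span_nil memv0 => /eqP ->; rewrite (alm0 fA).
rewrite span_cons => /memv_addP[u /vlineP[a ->] [z zs ->]] /(almD fA).
apply: (subspace_jn sN) => x.
  have [->|a0] := eqVneq a 0; first by rewrite scale0r (alm0 fA).
  by rewrite (almZ fA) //; apply: Hs; rewrite mem_head.
by apply: IH => // w' y w's; apply: Hs; rewrite inE w's orbT.
Qed.

Definition alm_image (U : {vspace V}) := [set p | exists2 v, v \in U & f v = Some p].

Lemma alm_image_subspace U : subspace (alm_image U).
Proof.
move=> g X Y Lg XY gX gY [u uU Eu] [v vU Ev] r gr.
have [|a [b E]] := almO fA (u := u) (v := v) (r := r).
  by constructor 3; exists X, Y; split=> //; exists g.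
by exists (a *: u + b *: v) => //; rewrite memvD ?memvZ.
Qed.

Hypothesis hS : is_projective S.

(** This is how [F] enters [S]: a morphism without exceptional points is injective on points by
    [almK] and carries the coordinates of its source along. *)
Lemma alm_coord (psi : V -> points S) : (forall v, f v = opt psi v) -> coord psi.
Proof.
move=> fE; split.
- move=> a v a0; have [->|v0] := eqVneq v 0; first by rewrite scaler0.
  apply: Some_inj; rewrite -optN ?scaler_eq0 ?negb_or ?a0 // -fE (almZ fA) //.
  by rewrite fE optN.
- move=> u v u0 v0 E; have [||a] := almK fA (u := u) (v := v).
  + by rewrite !fE !optN // E.
  + by rewrite fE optN.
  rewrite fE => /opt_eq0 Ea; exists (- a).
  by apply: (lincomb1 (c := 1) Ea); vring.
- move=> u v i; have u0 := ind2_neq0 i; have v0 := ind2_neq0 (ind2C i).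
  have n0 : u + v != 0.
    apply/eqP => E; have [|/eqP] := i 1 1; first by rewrite !scale1r.
    by rewrite oner_eq0.
  have := almD fA (u := u) (v := v) (r := psi (u + v)).
  rewrite !fE !optN // => /(_ erefl)[[->]|[->]|[x [y [[->] [->] _ //]]]].
    exact: colxyx.
  exact: colxx.
move=> u v r u0 v0 n c; have [|a [b]] := almO fA (u := u) (v := v) (r := r).
  by constructor 3; exists (psi u), (psi v); rewrite !fE !optN.
by rewrite fE => /opt_some[]; exists a, b.
Qed.

End Closure.

Lemma coord_im_subspace (S : geometry) (F : fieldType) (V : vectType F)
  (psi : V -> points S) : coord psi -> subspace (coord_im psi).
Proof.
move=> psiC g X Y Lg XY gX gY iX iY r gr.
by apply: (coord_im_closed psiC XY iX iY); exists g.
Qed.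

Section Main.
Variables (S : geometry) (F : fieldType) (V1 V2 : vectType F).
Hypothesis hS : is_projective S.
Variable b : V1 -> V2 -> option (points S).
Hypotheses (bA1 : forall x, alm (b x)) (bA2 : forall y, alm (b^~ y)).
Variables (m : nat) (a : 'I_m.+1 -> V2) (U : {vspace V1}) (A : V1).
Hypothesis a_span : forall y, exists c : 'I_m.+1 -> F, y = \sum_j c j *: a j.
Hypothesis a_free : free [seq a j | j <- enum 'I_m.+1].
Hypothesis dU : \dim U = 3.
Hypothesis bU : forall j x, x \in U -> x != 0 -> b x (a j) <> None.
Hypothesis b_out : forall j, j != ord0 ->
  exists2 x, x \in U & forall x', x' \in U -> b x (a j) <> b x' (a ord0).
Hypothesis bA : forall y, y != 0 -> b A y <> None.

(** All values lie in the span of those at pairs of basis vectors, so finitely many points have to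
    be covered by coordinates. In these, [b] becomes a map [B] of vectors. On [U] the map
    [B^~ (a ord0)] is linear by the choice of the coordinates, hence everywhere by [lmap_extend]. *)
Lemma alm_structure : exists (W : vectType F) (psi : W -> points S)
    (f : 'I_m.+1 -> 'Hom(V1, W)) (be : V2 -> 'rV[F]_m.+1),
  [/\ coord psi, lmap be, forall y, be y = 0 -> y = 0
    & forall x y, b x y = opt psi (\sum_j be y 0 j *: f j x)].
Proof.
have dU2 : (2 < \dim U)%N by rewrite dU.
have [p1 p1U Hp1] := notin_line_pair 0 0 dU2.
have p10 : p1 != 0.
  by apply/eqP => p10; apply: Hp1; exists 0, 0; rewrite p10 !scaler0 addr0.
have [q1 [_ [q1U _ /ind3_ind2 ipq]]] := ind3_extend dU2 p10.
case E0 : (b p1 (a ord0)) => [P0|]; last by case: (bU p1U p10 E0).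
(* The default [P0] is taken only at v = 0. *)
pose psi0 (v : subvs_of U) := odflt P0 (b (vsval v) (a ord0)).
have [j jE] : exists j : 'Hom(subvs_of U, V1), forall v, j v = vsval v.
  by apply: hom_of_linear => c u v; rewrite linearP.
have j0 v : j v = 0 -> v = 0.
  by rewrite jE => E; apply: val_inj; rewrite /= E.
have f0A : alm (fun v => b (j v) (a ord0)) := alm_comp j0 (bA2 (a ord0)).
have f0E v : b (j v) (a ord0) = opt psi0 v.
  have [->|v0] := eqVneq v 0; first by rewrite hom0 opt0 (alm0 (bA2 _)).
  have v1 : vsval v != 0 by rewrite -jE; apply: contra_neq v0; apply: j0.
  have := bU (j := ord0) (subvsP v) v1.
  by rewrite optN // /psi0 jE; case: (b _ _).
have psi0C : coord psi0 by apply: alm_coord f0A hS _ f0E.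
have big0 : unplanar (subvs_of U).
  move=> u v; have [w wU Hw] := notin_line_pair (vsval u) (vsval v) dU2.
  exists (vsproj U w) => -[c [d E]]; apply: Hw; exists c, d.
  by rewrite -(vsprojK wU) E linearD !linearZ.
pose s (ij : 'I_(\dim {:V1}) * 'I_(\dim {:V2})) :=
  odflt P0 (b (vbasis {:V1})`_ij.1 (vbasis {:V2})`_ij.2).
have [W [psi [iota [psiC psiE iota0 cov]]]] :=
  coord_cover hS s (enum {: 'I_(\dim {:V1}) * 'I_(\dim {:V2})}) psi0C big0.
have imS := coord_im_subspace psiC.
have nthP (V : vectType F) (w : V) : w \in vbasis {:V} ->
    exists i : 'I_(\dim {:V}), w = (vbasis {:V})`_i.
  move=> wV; have lt : (index w (vbasis {:V}) < \dim {:V})%N.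
    by rewrite -[X in (_ < X)%N](size_tuple (vbasis {:V})) index_mem.
  by exists (Ordinal lt); rewrite /= nth_index.
have full (V : vectType F) (w : V) : w \in <<vbasis {:V}>>%VS.
  by rewrite (span_basis (vbasisP _)) memvf.
have b_im x y p : b x y = Some p -> coord_im psi p.
  apply: (alm_span (bA1 x) imS (s := vbasis {:V2})) (full _ y) => w' {}p w'V.
  apply: (alm_span (bA2 w') imS (s := vbasis {:V1})) (full _ x) => w q wV Ew.
  have [i Ei] := nthP _ _ wV; have [i' Ei'] := nthP _ _ w'V.
  have := cov (i, i'); rewrite mem_enum => /(_ isT).
  by rewrite /s /= -Ei -Ei' Ew.
have [B BE] : exists B : V1 -> V2 -> W, forall x y, b x y = opt psi (B x y).
  have H x y : exists w, b x y = opt psi w.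
    case E : (b x y) => [p|]; last by exists 0; rewrite opt0.
    by have [w [w0 ->]] := b_im _ _ _ E; exists w; rewrite optN.
  exists (fun x y => projT1 (cid (H x y))) => x y.
  exact: projT2 (cid (H x y)).
have BL1 x : lmap (B x) by apply: (alm_lmap hS psiC (bA1 x)); apply: BE.
have BL2 y : lmap (B^~ y) by apply: (alm_lmap hS psiC (bA2 y)) => x; apply: BE.
have [g gE] : exists g : 'Hom(V1, W), forall x, g x = iota (vsproj U x).
  by apply: hom_of_linear => c u v; rewrite linearP homD homZ.
have gU x : x \in U -> par (B x (a ord0)) (g x).
  move=> xU; apply: (opt_par psiC); rewrite -BE.
  have -> : x = j (vsproj U x) by rewrite jE vsprojK.
  rewrite f0E gE jE vsvalK; have [->|v0] := eqVneq (vsproj U x) 0.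
    by rewrite hom0 !opt0.
  by rewrite !optN ?psiE //; apply: contra_neq v0; apply: iota0.
have g0 x : x \in U -> g x = 0 -> x = 0.
  by rewrite gE => xU /iota0 E; rewrite -(vsprojK xU) E linear0.
have [|h hU hP] := lmap_extend (BL2 (a ord0)) gU p1U q1U.
  move=> c d E; apply: ipq; apply: g0; first by rewrite memvD ?memvZ.
  by rewrite homD !homZ.
have [|||f [be [beL be0 H]]] := bilmap_structure BL1 BL2 a_span a_free (A := A) dU hP.
- move=> i x xU E; apply/eqP/negPn/negP => x0; apply: (bU (j := i) xU x0).
  by rewrite BE E opt0.
- move=> i i0; have [x xU Hx] := b_out i0; exists x => //.
  apply/negP => /memv_imgP[x' x'U E]; apply: (Hx x' x'U).
  rewrite !BE E; apply/esym; apply: par_opt => //; exact: hP.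
- move=> y E; apply/eqP/negPn/negP => y0; apply: (bA y0).
  by rewrite BE E opt0.
exists W, psi, f, be; split=> // x y.
by rewrite BE; apply: par_opt.
Qed.

End Main.

(** * The projective spaces over a field *)

Section PG.
Variables (F : fieldType) (k : nat).
Local Notation V := 'rV[F]_k.+1.
Local Notation pnt := {U : {vspace V} | \dim U == 1%N}.
Implicit Types (u v w : V) (P : points (PG k F)) (g : set (points (PG k F))).

Lemma const_row_neq0 : (const_mx 1 : V) != 0.
Proof. by apply/eqP => /rowP/(_ ord0)/eqP; rewrite !mxE oner_eq0. Qed.

Lemma dim_line1 v : v != 0 -> \dim <[v]> == 1%N.
Proof. by move=> v0; rewrite dim_vline v0. Qed.

(* [mkpt 0] is an arbitrary point. *)
Definition mkpt v : points (PG k F) :=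
  insubd (exist _ <[const_mx 1 : V]>%VS (dim_line1 const_row_neq0) : pnt) <[v]>%VS.

Definition rep P : V := vpick (val (P : pnt)).

Lemma val_mkpt v : v != 0 -> val (mkpt v : pnt) = <[v]>%VS.
Proof. by move=> v0; rewrite /mkpt val_insubd dim_line1. Qed.

Lemma rep_neq0 P : rep P != 0.
Proof.
rewrite /rep vpick0; have := valP (P : pnt).
by apply: contraTneq => ->; rewrite dimv0.
Qed.

Lemma mkpt_rep P : mkpt (rep P) = P.
Proof.
apply: (@val_inj _ _ pnt); rewrite val_mkpt ?rep_neq0 //.
apply/eqP; rewrite eqEdim dim_vline rep_neq0 (eqP (valP (P : pnt))) leqnn andbT.
exact: memv_pick.
Qed.

Lemma mem_mkpt v (L : {vspace V}) : v != 0 ->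
  (val (mkpt v : pnt) <= L)%VS = (v \in L).
Proof. by move=> v0; rewrite val_mkpt. Qed.

Lemma mkpt_inj u v : u != 0 -> v != 0 -> mkpt u = mkpt v ->
  exists a, u = a *: v.
Proof.
move=> u0 v0 /(congr1 (fun P : points (PG k F) => val (P : pnt))).
rewrite !val_mkpt // => E; apply/vlineP; rewrite -E; exact: memv_line.
Qed.

Lemma mkptZ a v : a != 0 -> mkpt (a *: v) = mkpt v.
Proof.
move=> a0; congr (insubd _ _); apply/eqP; rewrite eqEdim !dim_vline.
rewrite scaler_eq0 (negPf a0) /= leqnn andbT.
by rewrite -[(_ <= _)%VS]/(a *: v \in <[v]>%VS) memvZ ?memv_line.
Qed.

Lemma ind2_dim u v : ind2 u v -> \dim (<[u]> + <[v]>) = 2.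
Proof.
move=> i; have fr : free [:: u; v].
  rewrite free_cons free_cons nil_free span_nil memv0 andbT span_cons span_nil addv0.
  rewrite (ind2_neq0 (ind2C i)) andbT; apply/negP => /vlineP[c].
  exact: ind2_nscale.
move/eqP: fr => /=; by rewrite !span_cons span_nil addv0.
Qed.

Lemma ind2_eqv u v (L : {vspace V}) : ind2 u v -> \dim L = 2 ->
  u \in L -> v \in L -> L = (<[u]> + <[v]>)%VS.
Proof.
move=> i dL uL vL; apply/esym/eqP; rewrite eqEdim ind2_dim // dL leqnn andbT.
by rewrite subv_add; apply/andP.
Qed.

Lemma dim2_pair (L : {vspace V}) : \dim L = 2 ->
  exists u v, [/\ ind2 u v, u \in L & v \in L].
Proof.
move=> dL; have u0 : vpick L != 0.
  by rewrite vpick0; apply/eqP => L0; move: dL; rewrite L0 dimv0.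
have : ~~ (L <= <[vpick L]>)%VS.
  by apply/negP => /dimvS; rewrite dL dim_vline u0.
case/subvPn => v vL nv; exists (vpick L), v; rewrite memv_pick; split=> //.
apply: ind2C; apply: nind2 => // -[c E].
by case/negP: nv; rewrite E memvZ ?memv_line.
Qed.

Lemma mkpt_neq u v : ind2 u v -> mkpt u <> mkpt v.
Proof.
move=> i E; have [] := mkpt_inj (ind2_neq0 i) (ind2_neq0 (ind2C i)) E.
by move=> a; apply: ind2_nscale.
Qed.

Lemma mkpt_ind2 u v : u != 0 -> v != 0 -> mkpt u <> mkpt v -> ind2 u v.
Proof.
move=> u0 v0 n; apply: nind2 => // -[c E]; apply: n; rewrite E mkptZ //.
by apply: contraNneq u0 => c0; rewrite E c0 scale0r.
Qed.

Lemma pg_line u v : ind2 u v -> exists g, [/\ lines g, g (mkpt u), g (mkpt v) &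
  forall a b, a *: u + b *: v != 0 -> g (mkpt (a *: u + b *: v))].
Proof.
move=> i; exists [set P | (val (P : pnt) <= <[u]> + <[v]>)%VS].
have mem w : w != 0 -> w \in (<[u]> + <[v]>)%VS ->
    (val (mkpt w : pnt) <= <[u]> + <[v]>)%VS by move=> ? ?; rewrite mem_mkpt.
split.
- by exists (<[u]> + <[v]>)%VS => //; rewrite ind2_dim.
- apply: mem; first exact: ind2_neq0 i.
  by apply: (subvP (addvSl _ _)); apply: memv_line.
- apply: mem; first exact: ind2_neq0 (ind2C i).
  by apply: (subvP (addvSr _ _)); apply: memv_line.
by move=> a b n0; apply: mem => //; rewrite memv_add ?memvZ ?memv_line.
Qed.

Lemma pg_line_mem u v g P : ind2 u v -> lines g -> g (mkpt u) -> g (mkpt v) ->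
  g P <-> exists a b, a *: u + b *: v != 0 /\ P = mkpt (a *: u + b *: v).
Proof.
move=> i [L dL ->] /=; rewrite !mem_mkpt; last 2 first.
- exact: ind2_neq0 (ind2C i).
- exact: ind2_neq0 i.
move=> uL vL; rewrite (ind2_eqv i dL uL vL); split.
  rewrite -{1}(mkpt_rep P) mem_mkpt ?rep_neq0 // => /mem_line_pair[a [b E]].
  by exists a, b; rewrite -E mkpt_rep rep_neq0.
by move=> [a [b [n0 ->]]]; rewrite mem_mkpt // memv_add ?memvZ ?memv_line.
Qed.

Hypothesis k0 : (0 < k)%N.

Lemma ind2_exists u : u != 0 -> exists v, ind2 u v.
Proof.
move=> u0; have : ~~ (fullv <= <[u]>)%VS.
  apply/negP => /dimvS; rewrite dim_vline u0 dimvf /dim /= mul1n.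
  by rewrite ltnS leqNgt k0.
case/subvPn => v _ nv; exists v; apply: ind2C; apply: nind2 => // -[c E].
by case/negP: nv; rewrite E memvZ ?memv_line.
Qed.

Lemma pg_semilinear : is_semilinear (PG k F).
Proof.
split.
- move=> g [L dL ->]; have [u [v [i uL vL]]] := dim2_pair dL.
  exists (mkpt u), (mkpt v); split; last exact: mkpt_neq.
    by rewrite /= mem_mkpt // (ind2_neq0 i).
  by rewrite /= mem_mkpt // (ind2_neq0 (ind2C i)).
- move=> X; have [v i] := ind2_exists (rep_neq0 X).
  by have [g [Lg gX _ _]] := pg_line i; exists g => //; rewrite -(mkpt_rep X).
move=> g h X Y Lg Lh; rewrite -(mkpt_rep X) -(mkpt_rep Y) => XY.
have i := mkpt_ind2 (rep_neq0 X) (rep_neq0 Y) XY.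
move=> gX gY hX hY; apply/seteqP; split=> P.
  by move/(pg_line_mem P i Lg gX gY)/(pg_line_mem P i Lh hX hY).
by move/(pg_line_mem P i Lh hX hY)/(pg_line_mem P i Lg gX gY).
Qed.

Lemma pg_collinear (X Y : points (PG k F)) : collinear X Y.
Proof.
have [XY|XY] := pselect (X = Y).
  by case: pg_semilinear => _ /(_ X)[g Lg gX] _; exists g; rewrite -XY.
rewrite -(mkpt_rep X) -(mkpt_rep Y) in XY *.
have [g [Lg gX gY _]] := pg_line (mkpt_ind2 (rep_neq0 X) (rep_neq0 Y) XY).
by exists g.
Qed.

Lemma pg_projective : is_projective (PG k F).
Proof.
split.
- exact: pg_semilinear.
- exact: pg_collinear.
- move=> A B C D ab cd ac bd; rewrite -(mkpt_rep A) -(mkpt_rep B).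
  rewrite -(mkpt_rep C) -(mkpt_rep D).
  move: (rep A) (rep B) (rep C) (rep D) (rep_neq0 A) (rep_neq0 B) (rep_neq0 C) (rep_neq0 D).
  move=> a b c d a0 b0 c0 d0 [AB CD AC BD] [Lab Lcd Lac Lbd].
  move=> [abA abB cdC cdD] [acA acC bdB bdD] [Z [abZ cdZ]].
  have iab := mkpt_ind2 a0 b0 AB; have icd := mkpt_ind2 c0 d0 CD.
  have iac := mkpt_ind2 a0 c0 AC; have ibd := mkpt_ind2 b0 d0 BD.
  have [x [y [n0 E]]] := (pg_line_mem Z iab Lab abA abB).1 abZ.
  have [x' [y' [n0' E']]] := (pg_line_mem Z icd Lcd cdC cdD).1 cdZ.
  have [e Ee] := mkpt_inj n0 n0' (etrans (esym E) E').
  (* The point [Z] is [x *: a + y *: b] and also [e] times [x' *: c + y' *: d]; rearranged, this is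
     a vector both in the span of [a], [c] and in that of [b], [d]. *)
  pose w := x *: a + (- (e * x')) *: c.
  have Ew : w = (- y) *: b + (e * y') *: d.
    by apply: (lincomb1 (c := 1) Ee); rewrite /w; vring.
  have w0 : w != 0.
    apply/eqP => w0; have [x0 _] := iac _ _ w0.
    rewrite Ew in w0; have [/eqP + _] := ibd _ _ w0; rewrite oppr_eq0 => /eqP y0.
    by move: n0; rewrite x0 y0 !scale0r addr0 eqxx.
  exists (mkpt w); split.
    by apply/(pg_line_mem _ iac Lac acA acC); exists x, (- (e * x')).
  apply/(pg_line_mem _ ibd Lbd bdB bdD); exists (- y), (e * y').
  by rewrite -Ew.
move=> g [L dL ->]; have [u [v [i uL vL]]] := dim2_pair dL.
have i1 : ind2 u (u + v).
  move=> a b E; have [|/eqP + b0] := i (a + b) b; first by rewrite -E; vring.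
  by rewrite b0 addr0 => /eqP ->.
have i2 : ind2 v (u + v).
  move=> a b E; have [|b0 /eqP] := i b (a + b); first by rewrite -E; vring.
  by rewrite b0 addr0 => /eqP ->.
exists (mkpt u), (mkpt v), (mkpt (u + v)); split; split; try exact: mkpt_neq.
- by rewrite /= mem_mkpt // (ind2_neq0 i).
- by rewrite /= mem_mkpt // (ind2_neq0 (ind2C i)).
- by rewrite /= mem_mkpt ?memvD // (ind2_neq0 (ind2C i1)).
Qed.

Lemma mkpt_coord : coord mkpt.
Proof.
split; [exact: mkptZ|exact: mkpt_inj| |].
  move=> u v i; have [g [Lg gu gv H]] := pg_line i; exists g; split=> //.
  have := H 1 1; rewrite !scale1r; apply.
  apply/eqP => E; have [|/eqP] := i 1 1; first by rewrite !scale1r.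
  by rewrite oner_eq0.
move=> u v r u0 v0 n [g [Lg gu gv gr]].
by apply/(pg_line_mem r (mkpt_ind2 u0 v0 n) Lg gu gv).
Qed.

Lemma opt_rep P : opt mkpt (rep P) = Some P.
Proof. by rewrite optN ?rep_neq0 // mkpt_rep. Qed.

Section Morphism.
Variable S : geometry.
Hypothesis hS : is_projective S.

Definition lift (c : points (PG k F) -> option (points S)) v :=
  if v == 0 then None else c (mkpt v).

Lemma linear_morphism_alm c : is_linear_morphism c -> alm (lift c).
Proof.
move=> [c1 c2]; have f0 : lift c 0 = None by rewrite /lift eqxx.
have fN v : v != 0 -> lift c v = c (mkpt v) by rewrite /lift => /negPf ->.
have fZ a v : a != 0 -> lift c (a *: v) = lift c v.
  by move=> a0; rewrite /lift scaler_eq0 (negPf a0) /= mkptZ.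
have fS v p : lift c v = Some p -> v != 0 /\ c (mkpt v) = Some p.
  by rewrite /lift; case: eqVneq.
split=> //.
- move=> u v r E; have [u0|u0] := eqVneq u 0.
    by constructor 2; rewrite -E u0 add0r.
  have [[a Ea]|nv] := pselect (exists a, v = a *: u).
    constructor 1; rewrite -E; have := fS _ _ E; rewrite Ea => -[n0 _].
    have E1 : u + a *: u = (1 + a) *: u by vring.
    rewrite E1 fZ //; apply: contraNneq n0 => a0.
    by rewrite E1 a0 scale0r.
  have i : ind2 u v by apply: ind2C; apply: nind2.
  have v0 := ind2_neq0 (ind2C i).
  have [n0 Ec] := fS _ _ E; have [g [Lg gu gv H]] := pg_line i.
  have : pimage c (join_set [set mkpt u] [set mkpt v]) r.
    exists (mkpt (u + v)) => //; right; exists (mkpt u), (mkpt v), g.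
    split; split=> //; first exact: mkpt_neq.
    by have := H 1 1; rewrite !scale1r; apply.
  rewrite c1; last exact: pg_collinear.
  case=> [[[X /= -> EX]|[X /= -> EX]]|].
  + by constructor 1; rewrite fN.
  + by constructor 2; rewrite fN.
  move=> [X1 [X2 [h [[[A /= -> EA] [B /= -> EB] X12] [Lh hX1 hX2 hr]]]]].
  constructor 3; exists X1, X2; rewrite !fN //; split=> //.
  by exists h.
- move=> u v E n; have u0 : u != 0 by apply/eqP => u0; apply: n; rewrite u0.
  have v0 : v != 0 by apply/eqP => v0; apply: n; rewrite E v0.
  have [[a Ea]|nv] := pselect (exists a, u = a *: v).
    by exists (- a); rewrite Ea -scalerDl subrr scale0r.
  have i : ind2 u v by apply: nind2.
  have [g [Lg gu gv _]] := pg_line i.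
  rewrite !fN // in E; have [A gA cA] := c2 _ _ _ Lg gu gv (mkpt_neq i) E.
  have [a [b [n0 EA]]] := (pg_line_mem A i Lg gu gv).1 gA.
  have a0 : a != 0.
    apply/eqP => a0; apply: n; rewrite fN // E.
    move: n0 EA; rewrite a0 scale0r add0r scaler_eq0 negb_or => /andP[b0 _] EA.
    by rewrite -cA EA mkptZ.
  exists (b / a); rewrite -(fZ a) //.
  have -> : a *: (u + (b / a) *: v) = a *: u + b *: v by vfield.
  by rewrite fN // -EA.
move=> u v r J.
have [[a Ea]|nv] := pselect (exists a, v = a *: u).
  have : lift c u = Some r.
    case: J => // [E|[x [y [Ex Ey xy _]]]].
      have [v0 _] := fS _ _ E; rewrite Ea fZ // in E.
      by apply: contraNneq v0 => a0; rewrite Ea a0 scale0r.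
    case: xy; have [v0 _] := fS _ _ Ey; rewrite Ea fZ ?Ex in Ey; first by case: Ey.
    by apply: contraNneq v0 => a0; rewrite Ea a0 scale0r.
  by exists 1, 0; rewrite scale1r scale0r addr0.
have [u0|u0] := eqVneq u 0.
  exists 0, 1; rewrite scale0r add0r scale1r; case: J => //.
    by rewrite u0 f0.
  by move=> [x [y [+ _ _ _]]]; rewrite u0 f0.
have i : ind2 u v by apply: ind2C; apply: nind2.
have v0 := ind2_neq0 (ind2C i); rewrite !fN // in J.
have : pimage c (join_set [set mkpt u] [set mkpt v]) r.
  rewrite c1; last exact: pg_collinear.
  case: J => [E|E|[x [y [Ex Ey xy [g [Lg gx gy gr]]]]]].
  - by left; left; exists (mkpt u).
  - by left; right; exists (mkpt v).
  right; exists x, y, g; split; split=> //; first by exists (mkpt u).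
  by exists (mkpt v).
case=> Z [[->|->] EZ|].
- by exists 1, 0; rewrite scale1r scale0r addr0 fN.
- by exists 0, 1; rewrite scale1r scale0r add0r fN.
move=> [X1 [X2 [g [[/= -> -> _] [Lg gu gv gZ]]]]] EZ.
have [a [b [n0 EA]]] := (pg_line_mem Z i Lg gu gv).1 gZ.
by exists a, b; rewrite fN // -EA.
Qed.

Lemma alm_linear_morphism (f : V -> option (points S)) : alm f ->
  is_linear_morphism (fun P : points (PG k F) => f (rep P)).
Proof.
move=> fA.
have fmk v : v != 0 -> f (rep (mkpt v)) = f v.
  move=> v0; have [a Ea] := mkpt_inj (rep_neq0 _) v0 (mkpt_rep (mkpt v)).
  rewrite Ea (almZ fA) //; apply: contraNneq (rep_neq0 (mkpt v)) => a0.
  by rewrite Ea a0 scale0r.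
split.
- move=> X Y _; rewrite -(mkpt_rep X) -(mkpt_rep Y).
  move: (rep X) (rep Y) (rep_neq0 X) (rep_neq0 Y) => u v u0 v0.
  have fu := fmk _ u0; have fv := fmk _ v0.
  apply/seteqP; split=> r.
    case=> Z [[->|->] EZ|].
    + by left; left; exists (mkpt u).
    + by left; right; exists (mkpt v).
    move=> [X1 [X2 [g [[/= -> -> uv] [Lg gu gv gZ]]]]] EZ.
    have i := mkpt_ind2 u0 v0 uv.
    have [a [b [n0 E]]] := (pg_line_mem Z i Lg gu gv).1 gZ.
    rewrite E fmk // in EZ; have := almD fA EZ.
    have jnZ p q c w : jn (f (c *: w)) q p -> jn (f w) q p.
      have [->|c0] := eqVneq c 0; last by rewrite (almZ fA).
      rewrite scale0r (alm0 fA) => -[//|E1|[x [y []//]]].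
      by constructor 2.
    have jnZ' p q c w : jn q (f (c *: w)) p -> jn q (f w) p.
      have [->|c0] := eqVneq c 0; last by rewrite (almZ fA).
      rewrite scale0r (alm0 fA) => -[E1|//|[x [y []//]]].
      by constructor 1.
    move/jnZ/jnZ'; case=> [E1|E1|[x [y [Ex Ey xy [h [Lh hx hy hr]]]]]].
    + by left; left; exists (mkpt u); rewrite ?fu.
    + by left; right; exists (mkpt v); rewrite ?fv.
    right; exists x, y, h; split; split=> //.
      by exists (mkpt u); rewrite ?fu.
    by exists (mkpt v); rewrite ?fv.
  move=> J; have : jn (f u) (f v) r.
    case: J => [[[X' /= -> E]|[X' /= -> E]]|].
    + by constructor 1; rewrite -fu.
    + by constructor 2; rewrite -fv.
    move=> [x [y [h [[[X' /= -> Ex] [Y' /= -> Ey] xy] [Lh hx hy hr]]]]].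
    constructor 3; exists x, y; rewrite -fu -fv; split=> //.
    by exists h.
  case/(almO fA)=> a [b E].
  have [[c Ec]|nuv] := pselect (exists c, v = c *: u).
    exists (mkpt u); first by left; left.
    rewrite fu -E Ec.
    have E1 : a *: u + b *: (c *: u) = (a + b * c) *: u by vring.
    rewrite E1 (almZ fA) //; apply/eqP => z; move: E.
    by rewrite Ec E1 z scale0r (alm0 fA).
  have i : ind2 u v by apply: ind2C; apply: nind2.
  have [g [Lg gu gv H]] := pg_line i.
  have n0 : a *: u + b *: v != 0 by apply/eqP => z; rewrite z (alm0 fA) in E.
  exists (mkpt (a *: u + b *: v)); last by rewrite fmk.
  right; exists (mkpt u), (mkpt v), g; split; split=> //; first exact: mkpt_neq.
  exact: H.
move=> X Y g Lg gX gY XY E.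
have [fX|fX] := pselect (f (rep X) = None); first by exists X.
have [a Ea] := almK fA E fX; exists (mkpt (rep X + a *: rep Y)).
  rewrite -(mkpt_rep X) -(mkpt_rep Y) in XY gX gY.
  have i := mkpt_ind2 (rep_neq0 X) (rep_neq0 Y) XY.
  apply/(pg_line_mem _ i Lg gX gY); exists 1, a; rewrite scale1r; split=> //.
  apply/eqP => z; have [|/eqP] := i 1 a; first by rewrite scale1r.
  by rewrite oner_eq0.
have [z|n0] := eqVneq (rep X + a *: rep Y) 0; last by rewrite fmk.
rewrite -(mkpt_rep X) -(mkpt_rep Y) in XY.
have i := mkpt_ind2 (rep_neq0 X) (rep_neq0 Y) XY.
have [|/eqP] := i 1 a; first by rewrite scale1r.
by rewrite oner_eq0.
Qed.

End Morphism.
End PG.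

(** * Spans, bases and dimension *)

Section Spanned.
Variable S : geometry.
Implicit Types M N B : set (points S).

Lemma sub_spanned M : M `<=` spanned M.
Proof. by move=> p Mp N [_]; apply. Qed.

Lemma spanned_min M N : subspace N -> M `<=` N -> spanned M `<=` N.
Proof. by move=> sN MN p; apply. Qed.

Lemma spanned_subspace M : subspace (spanned M).
Proof.
move=> g X Y Lg XY gX gY MX MY r gr N [sN MN].
by apply: (sN g X Y) gr => //; [apply: MX|apply: MY].
Qed.

Lemma spanned_id N : subspace N -> spanned N = N.
Proof.
by move=> sN; apply/seteqP; split; [apply: spanned_min|apply: sub_spanned].
Qed.

End Spanned.

Section AlmDim.
Variables (S : geometry) (F : fieldType) (V : vectType F) (f : V -> option (points S)).
Hypothesis fA : alm f.

(** Rank and nullity as a bound of cardinality. Take as many vectors of [U] with values in [B] as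
    can be independent together with [t]. By maximality their values span the image, so by
    minimality of [B] they are all of [B]. *)
Lemma alm_basis_card (U : {vspace V}) (t : seq V) B :
  free t -> (forall v, v \in t -> v \in U /\ f v = None) ->
  is_basis (alm_image f U) B -> B #<= `I_(\dim U - size t).
Proof.
move=> ft tU [sB minB].
pose Q s := [/\ free (s ++ t), forall v, v \in s -> v \in U &
  forall v, v \in s -> exists2 p, B p & f v = Some p].
have Qle s : Q s -> (size s + size t <= \dim U)%N.
  move=> [fs sU _]; rewrite -size_cat; move/eqP: (fs) => <-; apply: dimvS.
  apply/span_subvP => v; rewrite mem_cat => /orP[/sU //|/tU[]//].
have ex : exists n, `[< exists2 s, Q s & size s = n >].
  by exists 0; apply/asboolP; exists [::].
have ub n : `[< exists2 s, Q s & size s = n >] -> (n <= \dim U)%N.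
  by move=> /asboolP[s /Qle le <-]; apply: leq_trans le; apply: leq_addr.
case: (ex_maxnP ex ub) => n /asboolP[s Qs sz] maxn.
have [fs sU sB'] := Qs.
pose B' := [set p | exists2 v, v \in s & f v = Some p].
have B'B : B' `<=` B.
  by move=> p [v vs E]; have [q Bq Eq] := sB' _ vs; move: E; rewrite Eq => -[<-].
have BM : B `<=` alm_image f U by rewrite -sB; apply: sub_spanned.
have inspan v p : v \in U -> B p -> f v = Some p -> v \in <<s ++ t>>%VS.
  move=> vU Bp Ev; apply: contrapT => /negP nv.
  have := maxn (size s).+1; rewrite -sz => H.
  suff /H : `[< exists2 s0, Q s0 & size s0 = (size s).+1 >] by rewrite ltnn.
  apply/asboolP; exists (v :: s) => //; split.
  - by rewrite cat_cons free_cons nv.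
  - by move=> w; rewrite inE => /orP[/eqP ->|/sU].
  by move=> w; rewrite inE => /orP[/eqP ->|/sB' //]; exists p.
have EB : B' = B.
  apply: minB => //; apply/seteqP; split.
    apply: spanned_min; first exact: alm_image_subspace.
    by apply: (subset_trans B'B).
  rewrite -sB; apply: spanned_min; first exact: spanned_subspace.
  move=> p Bp; have [v vU Ev] := BM _ Bp.
  apply: (alm_span fA (@spanned_subspace S B') _ (inspan _ _ vU Bp Ev) Ev) => w x.
  rewrite mem_cat => /orP[ws Ew|/tU[_ ->]//].
  by apply: sub_spanned; exists w.
have [->|/set0P[p0 Bp0]] := eqVneq B set0; first exact: card_ge0.
pose g i := odflt p0 (f (nth 0 s i)).
have sub : B `<=` g @` `I_(size s).
  rewrite -EB => p [v vs Ev]; exists (index v s); first by rewrite /= index_mem.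
  by rewrite /g nth_index // Ev.
apply: (card_le_trans (subset_card_le sub)); apply: (card_le_trans (card_image_le _ _)).
by rewrite card_le_II leq_subRL ?(leq_trans (leq_addl _ _) (Qle _ Qs)) // addnC Qle.
Qed.

End AlmDim.

Section PGDim.
Variables (F : fieldType) (k : nat).
Hypothesis k0 : (0 < k)%N.
Local Notation V := 'rV[F]_k.+1.

Lemma opt_mkpt_alm : alm (opt (@mkpt F k)).
Proof.
have := lmap_alm (pg_projective F k0) (mkpt_coord F k) (hom_lmap (\1%VF : 'End(V))).
by congr alm; apply/funext => v; rewrite id_lfunE.
Qed.

Lemma pg_image (U : {vspace V}) P : alm_image (opt (@mkpt F k)) U P <-> rep P \in U.
Proof.
split=> [[v vU /opt_some[v0 ->]]|PU]; last by exists (rep P); rewrite ?opt_rep.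
have [a ->] := mkpt_inj (rep_neq0 (mkpt v)) v0 (mkpt_rep _).
by rewrite memvZ.
Qed.

Lemma pg_spanned_card (B : set (points (PG k F))) n : B #<= `I_n ->
  exists2 U : {vspace V}, (\dim U <= n)%N &
   spanned B = alm_image (opt (@mkpt F k)) U.
Proof.
have aA := opt_mkpt_alm; move=> Bn.
have [s [sn sB Bs]] : exists s : seq V, [/\ (size s <= n)%N,
    forall w, w \in s -> w != 0 /\ B (mkpt w) &
    forall P, B P -> exists2 w, w \in s & P = mkpt w].
  case/pfcard_geP: Bn => [->|/surjfunPex[g ->]]; first by exists [::].
  exists [seq rep (g i) | i <- iota 0 n]; split.
  - by rewrite size_map size_iota.
  - move=> w /mapP[i]; rewrite mem_iota add0n => i_n ->.
    by rewrite rep_neq0 mkpt_rep; split=> //; exists i.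
  move=> _ [i /= i_n <-]; exists (rep (g i)); last by rewrite mkpt_rep.
  by apply: map_f; rewrite mem_iota.
exists <<s>>%VS; first exact: leq_trans (dim_span _) sn.
apply/seteqP; split.
  apply: spanned_min; first exact: alm_image_subspace.
  move=> P /Bs[w ws ->]; exists w; first exact: memv_span.
  by have [w0 _] := sB _ ws; rewrite optN.
move=> P [v vs Ev]; apply: (alm_span aA (@spanned_subspace _ B) _ vs Ev) => w x ws.
by have [w0 Bw] := sB _ ws; rewrite optN // => -[<-]; apply: sub_spanned.
Qed.

(** A basis of three points spans a [U] of dimension at most 3, and [alm_basis_card] without kernel
    vectors gives the other inequality. *)
Lemma pg_plane (E : set (points (PG k F))) : is_plane E ->
  exists2 U : {vspace V}, \dim U = 3 & E = alm_image (opt (@mkpt F k)) U.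
Proof.
move=> [sE [B [bB cB]]]; have /card_eqPle[B3 le3] := cB.
have [U dU EU] := pg_spanned_card B3; have [sB _] := bB.
exists U; last by rewrite -EU sB.
apply/eqP; rewrite eqn_leq dU /=.
have := @alm_basis_card _ _ _ _ opt_mkpt_alm U [::] B (nil_free _).
rewrite -EU sB subn0 => /(_ _ bB) => H.
by rewrite -card_le_II; apply: card_le_trans le3 (H _).
Qed.

Lemma pg_basis (A : 'I_k.+1 -> points (PG k F)) : spanned (range A) = setT ->
  free [seq rep (A j) | j <- enum 'I_k.+1] /\
  forall y : V, exists c : 'I_k.+1 -> F, y = \sum_j c j *: rep (A j).
Proof.
move=> sA; set s := [seq rep (A j) | j <- enum 'I_k.+1].
have full : <<s>>%VS = fullv.
  apply/eqP; rewrite eqEsubv subvf; apply/subvP => v _.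
  have [->|v0] := eqVneq v 0; first exact: mem0v.
  have : spanned (range A) (mkpt v) by rewrite sA.
  have := @spanned_min _ (range A) (alm_image (opt (@mkpt F k)) <<s>>%VS).
  move=> /(_ (alm_image_subspace opt_mkpt_alm (U := _))) H /H[].
    move=> _ [j _ <-]; apply/pg_image; apply: memv_span.
    by apply: map_f; rewrite mem_enum.
  move=> w ws /opt_some[w0 E]; have [a ->] := mkpt_inj v0 w0 E.
  by rewrite memvZ.
have dimV : \dim {:V} = k.+1 by rewrite dimvf /dim /= mul1n.
split; first by rewrite /free full dimV size_map size_enum_ord.
move=> y; have : y \in <<s>>%VS by rewrite full memvf.
rewrite span_def big_map big_enum /= => /memv_sumP[v vP ->].
have /choice[c cE] : forall j, exists c, v j = c *: rep (A j).
  by move=> j; apply/vlineP; apply: vP.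
by exists c; apply: eq_bigr => j _; apply: cE.
Qed.

End PGDim.

(** * Products *)

Section Product.
Variables (S1 S2 S : geometry).
Variable chi : points (product_geometry S1 S2) -> option (points S).
Hypothesis hchi : is_linear_morphism chi.

Lemma product_morphism_right X : is_linear_morphism (fun Y => chi (X, Y)).
Proof.
have [c1 c2] := hchi.
have L g2 : lines g2 -> lines (g := product_geometry S1 S2) ([set X] `*` g2).
  by move=> Lg; left; exists X, g2.
have single Y : pimage (fun Y => chi (X, Y)) [set Y] = pimage chi [set (X, Y)].
  apply/seteqP; split=> r [Z /= -> E]; first by exists (X, Y).
  by exists Y.
split.
- move=> Y Y' [g [Lg gY gY']]; rewrite !single -c1; last first.
    by exists ([set X] `*` g); split; [exact: L| |].
  apply/seteqP; split=> r.
    case=> Z [[/= ->|/= ->] EZ|].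
    + by exists (X, Y) => //; left; left.
    + by exists (X, Y') => //; left; right.
    move=> [X1 [X2 [h [[/= -> -> n] [Lh hY hY' hZ]]]]] EZ.
    exists (X, Z) => //; right; exists (X, Y), (X, Y'), ([set X] `*` h).
    by split; split=> //; [move=> [] | exact: L].
  case=> Z [[/= ->|/= ->] EZ|].
  + by exists Y => //; left; left.
  + by exists Y' => //; left; right.
  move=> [X1 [X2 [h [[/= -> -> n] [Lh hY hY' hZ]]]]] EZ.
  case: Lh => [[X0 [g2 [Lg2 Eh]]]|[g1 [X0 [Lg1 Eh]]]]; rewrite Eh in hY hY' hZ.
    move: hY hY' hZ => [/= XX0 g2Y] [_ g2Y'] [/= E1 E2]; case: Z E1 E2 EZ => Z1 Z2 /= E1 E2 EZ.
    rewrite E1 -XX0 in EZ; exists Z2 => //; right; exists Y, Y', g2.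
    by split; split=> //= YY'; apply: n; rewrite YY'.
  (* A line of the other kind has a constant second component, which would force [Y = Y']. *)
  move: hY hY' => [_ /= E1] [_ /= E2]; case: n; by rewrite E1 E2.
move=> Y Y' g Lg gY gY' n E.
have [||||A [A1 gA] EA] := c2 (X, Y) (X, Y') _ (L _ Lg) => //.
  by case.
by exists A.2 => //; rewrite -EA; case: A A1 {gA EA} => A1 A2 /= ->.
Qed.

Lemma product_morphism_left Y : is_linear_morphism (fun X => chi (X, Y)).
Proof.
have [c1 c2] := hchi.
have L g1 : lines g1 -> lines (g := product_geometry S1 S2) (g1 `*` [set Y]).
  by move=> Lg; right; exists g1, Y.
have single X : pimage (fun X => chi (X, Y)) [set X] = pimage chi [set (X, Y)].
  apply/seteqP; split=> r [Z /= -> E]; first by exists (X, Y).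
  by exists X.
split.
- move=> X X' [g [Lg gX gX']]; rewrite !single -c1; last first.
    by exists (g `*` [set Y]); split; [exact: L| |].
  apply/seteqP; split=> r.
    case=> Z [[/= ->|/= ->] EZ|].
    + by exists (X, Y) => //; left; left.
    + by exists (X', Y) => //; left; right.
    move=> [X1 [X2 [h [[/= -> -> n] [Lh hX hX' hZ]]]]] EZ.
    exists (Z, Y) => //; right; exists (X, Y), (X', Y), (h `*` [set Y]).
    by split; split=> //; [move=> [] | exact: L].
  case=> Z [[/= ->|/= ->] EZ|].
  + by exists X => //; left; left.
  + by exists X' => //; left; right.
  move=> [X1 [X2 [h [[/= -> -> n] [Lh hX hX' hZ]]]]] EZ.
  case: Lh => [[X0 [g2 [Lg2 Eh]]]|[g1 [X0 [Lg1 Eh]]]]; rewrite Eh in hX hX' hZ.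
    move: hX hX' => [/= E1 _] [/= E2 _]; case: n; by rewrite E1 E2.
  move: hX hX' hZ => [g1X /= YY0] [g1X' _] [/= E1 E2]; case: Z E1 E2 EZ => Z1 Z2 /= E1 E2 EZ.
  rewrite E2 -YY0 in EZ; exists Z1 => //; right; exists X, X', g1.
  by split; split=> //= XX'; apply: n; rewrite XX'.
move=> X X' g Lg gX gX' n E.
have [||||A [gA A2] EA] := c2 (X, Y) (X', Y) _ (L _ Lg) => //.
  by case.
by exists A.1 => //; rewrite -EA; case: A A2 {gA EA} => A1 A2 /= ->.
Qed.

End Product.

Lemma alm_none (S : geometry) (F : fieldType) (V : vectType F) :
  alm (fun _ : V => None : option (points S)).
Proof.
split=> //.
by move=> u v r [//|//|[x [y []]]].
Qed.

(** * Collineations induced by maps of vectors *)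

Section Collineation.
Variables (F : fieldType) (k : nat).
Hypothesis k0 : (0 < k)%N.
Local Notation V := 'rV[F]_k.+1.

Lemma par_mkpt (u v : V) : par u v -> mkpt u = mkpt v.
Proof. by case=> a a0 ->; apply: mkptZ. Qed.

Lemma rep_mkpt (v : V) : v != 0 -> par (rep (mkpt v)) v.
Proof.
move=> v0; have [a Ea] := mkpt_inj (rep_neq0 _) v0 (mkpt_rep (mkpt v)).
by apply: par_scale Ea; apply: rep_neq0.
Qed.

Lemma lmap_par (W W' : vectType F) (f : W -> W') u v : lmap f -> par u v -> par (f u) (f v).
Proof. by move=> fL [a a0 ->]; apply: lmapZ. Qed.

Definition induced (al : V -> V) (P : points (PG k F)) := mkpt (al (rep P)).

Lemma induced_line al g : lmap al -> (forall v, al v = 0 -> v = 0) ->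
  lines g -> lines (induced al @` g).
Proof.
move=> aL a0 Lg; have [L dL Eg] := Lg; have [u [v [i uL vL]]] := dim2_pair dL.
have u0 := ind2_neq0 i; have v0 := ind2_neq0 (ind2C i).
have gu : g (mkpt u) by rewrite Eg /= mem_mkpt.
have gv : g (mkpt v) by rewrite Eg /= mem_mkpt.
have ai : ind2 (al u) (al v).
  apply: nind2; first by apply: contra_neq v0; apply: a0.
  by move=> [c /(lmap_inj_par aL a0)[c']]; apply: ind2_nscale.
have [h [Lh hu hv _]] := pg_line ai.
suff -> : induced al @` g = h by [].
have amk w : w != 0 -> induced al (mkpt w) = mkpt (al w).
  by move=> w0; apply: par_mkpt; apply: lmap_par => //; apply: rep_mkpt.
have aN w : w != 0 -> al w != 0 by move=> w0; apply: contra_neq w0; apply: a0.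
apply/seteqP; split=> P.
  move=> [Q gQ <-]; have [a [b [n0 ->]]] := (pg_line_mem Q i Lg gu gv).1 gQ.
  rewrite amk //; apply/(pg_line_mem _ ai Lh hu hv).
  have [c [d E]] := lmap_comb aL u v a b.
  by exists c, d; rewrite -E; split=> //; apply: aN.
move=> /(pg_line_mem _ ai Lh hu hv)[c [d [n0 ->]]].
have [a [b p]] := lmapO aL u v c d.
have w0 : a *: u + b *: v != 0.
  apply/eqP => E; rewrite E (lmap0 aL) in p; move/eqP: n0; apply.
  exact: par_eq0 p _.
exists (mkpt (a *: u + b *: v)); last by rewrite amk //; apply: par_mkpt.
by apply/(pg_line_mem _ i Lg gu gv); exists a, b.
Qed.

Lemma induced_collineation (al al' : V -> V) : lmap al -> lmap al' ->
  (forall v, al v = 0 -> v = 0) -> (forall v, al' v = 0 -> v = 0) ->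
  (forall v, par (al (al' v)) v) -> (forall v, par (al' (al v)) v) ->
  is_collineation (induced al).
Proof.
move=> aL aL' a0 a0' aK aK'.
have K (f g : V -> V) : lmap f -> lmap g -> (forall v, g v = 0 -> v = 0) ->
    (forall v, par (f (g v)) v) -> cancel (induced g) (induced f).
  move=> fL gL g0 fg P; rewrite /induced -[RHS]mkpt_rep; apply: par_mkpt.
  apply: par_trans (fg _); apply: lmap_par => //; apply: rep_mkpt.
  by apply: contra_neq (rep_neq0 P); apply: g0.
have K1 := K _ _ aL' aL a0 aK'; have K2 := K _ _ aL aL' a0' aK.
split; first by exists (induced al').
move=> g; split; first exact: induced_line.
move/(induced_line aL' a0').
suff -> : induced al' @` (induced al @` g) = g by [].
apply/seteqP; split=> P; first by move=> [_ [Q gQ <-] <-]; rewrite K1.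
by move=> gP; exists (induced al P); [exists P|apply: K1].
Qed.

End Collineation.

(** * Structure of morphisms of the product *)

Section MorphismStructure.
Variables (F : fieldType) (n m : nat).
Hypotheses (hn : (2 <= n)%N) (hm : (1 <= m)%N).
Variable S : geometry.
Hypothesis hS : is_projective S.
Variable chi : points (product_geometry (PG n F) (PG m F)) -> option (points S).
Hypothesis hchi : is_linear_morphism chi.
Let n0 : (0 < n)%N := ltnW hn.

Definition bilift (x : 'rV[F]_n.+1) (y : 'rV[F]_m.+1) :=
  if (x == 0) || (y == 0) then None else chi (mkpt x, mkpt y).

Lemma bilift_neq0 x y : x != 0 -> y != 0 -> bilift x y = chi (mkpt x, mkpt y).
Proof. by move=> /negPf x0 /negPf y0; rewrite /bilift x0 y0. Qed.

Lemma bilift_rep X Y : chi (X, Y) = bilift (rep X) (rep Y).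
Proof. by rewrite bilift_neq0 ?rep_neq0 // !mkpt_rep. Qed.

Lemma bilift_alm_right x : alm (bilift x).
Proof.
have [x0|x0] := eqVneq x 0.
  by have := alm_none S 'rV[F]_m.+1; congr alm; apply/funext => y; rewrite /bilift x0 eqxx.
have := linear_morphism_alm hm (product_morphism_right hchi (mkpt x)).
by congr alm; apply/funext => y; rewrite /bilift (negPf x0).
Qed.

Lemma bilift_alm_left y : alm (bilift^~ y).
Proof.
have [y0|y0] := eqVneq y 0.
  by have := alm_none S 'rV[F]_n.+1; congr alm; apply/funext => x; rewrite /bilift y0 eqxx orbT.
have := linear_morphism_alm n0 (product_morphism_left hchi (mkpt y)).
by congr alm; apply/funext => x; rewrite /bilift (negPf y0) orbF.
Qed.

(** The matrix product is the Segre map: its [j]-th row is a multiple of [rep X] by the [j]-th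
    coordinate of [be (rep Y)]. So [L] gathers the linear maps [f j] into a single one on
    matrices. *)
Lemma morphism_structure (A : 'I_m.+1 -> points (PG m F)) (U : {vspace 'rV[F]_n.+1})
    (X0 : points (PG n F)) :
  spanned (range A) = setT -> \dim U = 3 ->
  (forall X j, rep X \in U -> chi (X, A j) <> None) ->
  (forall j, j != ord0 -> exists2 X, rep X \in U &
     forall X', rep X' \in U -> chi (X, A j) <> chi (X', A ord0)) ->
  (forall Y, chi (X0, Y) <> None) ->
  exists (W : vectType F) (psi : W -> points S)
    (L : 'Hom('M[F]_(m.+1, n.+1), W)) (be : 'rV[F]_m.+1 -> 'rV[F]_m.+1),
    [/\ coord psi, lmap be, forall y, be y = 0 -> y = 0 &
      forall X Y, chi (X, Y) = opt psi (L ((be (rep Y))^T *m rep X))].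
Proof.
move=> sA dU HU Hout HX0.
have [fr sp] := pg_basis hm sA.
have chiE x j : x != 0 -> bilift x (rep (A j)) = chi (mkpt x, A j).
  by move=> x0; rewrite bilift_neq0 ?rep_neq0 // mkpt_rep.
have repU x : x \in U -> x != 0 -> rep (mkpt x) \in U.
  by move=> xU x0; have [a _ ->] := rep_mkpt x0; rewrite memvZ.
have [|||W [psi [f [be [psiC beL be0 H]]]]] :=
  @alm_structure S F _ _ hS bilift bilift_alm_right bilift_alm_left m
    (fun j => rep (A j)) U (rep X0) sp fr dU.
- by move=> j x xU x0; rewrite chiE //; apply: HU; apply: repU.
- move=> j j0; have [X XU HX] := Hout j j0; exists (rep X) => //.
  move=> x' x'U; rewrite chiE ?rep_neq0 // mkpt_rep.
  have [->|x'0] := eqVneq x' 0; last by rewrite chiE //; apply: HX; apply: repU.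
  by rewrite /bilift eqxx; apply: HU.
- by move=> y y0; rewrite bilift_neq0 ?rep_neq0 // mkpt_rep.
have [L LE] : exists L : 'Hom('M[F]_(m.+1, n.+1), W), forall M, L M = \sum_j f j (row j M).
  apply: hom_of_linear => a M N; rewrite scaler_sumr -big_split /=.
  by apply: eq_bigr => j _; rewrite linearP homD homZ.
exists W, psi, L, be; split=> // X Y; rewrite bilift_rep H LE; congr (opt psi _).
apply: eq_bigr => j _; rewrite -homZ; congr (f j _).
by apply/rowP => i; rewrite !mxE big_ord1 !mxE.
Qed.

End MorphismStructure.

Section Hypotheses.
Variables (F : fieldType) (n m : nat).
Hypotheses (hn : (2 <= n)%N) (hm : (1 <= m)%N).
Let n0 : (0 < n)%N := ltnW hn.

Lemma dim_row k : \dim {: 'rV[F]_k.+1} = k.+1.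
Proof. by rewrite dimvf /dim /= mul1n. Qed.

Lemma exists_dim3 : exists U : {vspace 'rV[F]_n.+1}, \dim U = 3.
Proof.
have dV : (2 < \dim {: 'rV[F]_n.+1})%N by rewrite dim_row ltnS.
have [u [v [_ _ i]]] := ind3_extend dV (const_row_neq0 F n).
by exists <<[:: const_mx 1; u; v]>>%VS; have /eqP := ind3_free i.
Qed.

Section RankHypotheses.
Variable S : geometry.
Hypothesis hS : is_projective S.
Variable chi : points (product_geometry (PG n F) (PG m F)) -> option (points S).
Hypothesis hchi : is_linear_morphism chi.

(** An exceptional point is a kernel vector, and then a basis of the image has at most [m] points
    instead of [m.+1]. *)
Lemma full_rank_global (A : points (PG n F)) :
  has_dim (spanned (pimage chi ([set A] `*` [set: points (PG m F)]))) m ->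
  forall Y, chi (A, Y) <> None.
Proof.
move=> [B [bB cB]] Y E.
pose f := bilift chi (rep A); have fA : alm f := bilift_alm_right hm hchi _.
have fN y : y != 0 -> f y = chi (A, mkpt y).
  by move=> y0; rewrite /f bilift_neq0 ?rep_neq0 // mkpt_rep.
have img : spanned (pimage chi ([set A] `*` [set: points (PG m F)])) = alm_image f fullv.
  have -> : pimage chi ([set A] `*` [set: points (PG m F)]) = alm_image f fullv.
    apply/seteqP; split=> p.
      move=> [[A' Y'] [/= -> _] EY]; exists (rep Y'); first exact: memvf.
      by rewrite fN ?rep_neq0 // mkpt_rep.
    move=> [y _ Ey]; have [y0|y0] := eqVneq y 0.
      by move: Ey; rewrite y0 (alm0 fA).
    by exists (A, mkpt y) => //; rewrite -fN.
  by apply: spanned_id; apply: alm_image_subspace.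
rewrite img in bB.
have := alm_basis_card fA (t := [:: rep Y]) _ _ bB.
rewrite /= dim_row subn1 /= => H.
have : `I_m.+1 #<= `I_m.
  apply: card_le_trans (H _ _); first by move/card_eqPle: cB => [].
    by rewrite free_cons nil_free span_nil memv0 rep_neq0.
  move=> v; rewrite inE => /eqP ->; split; first exact: memvf.
  by rewrite fN ?rep_neq0 // mkpt_rep.
by rewrite card_le_II ltnn.
Qed.

(** Otherwise every value over [A1] is also one over [A0], and the image has no basis of more than
    three points. *)
Lemma rank_gt_outside (U : {vspace 'rV[F]_n.+1}) (A0 A1 : points (PG m F)) :
  \dim U = 3 ->
  (rank_gt chi (alm_image (opt (@mkpt F n)) U `*` [set A0; A1]) 2) ->
  exists2 X, rep X \in U &
     forall X', rep X' \in U -> chi (X, A1) <> chi (X', A0).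
Proof.
move=> dU [B [bB cB]]; apply: contrapT => H; apply: cB.
pose f := (bilift chi)^~ (rep A0); have fA : alm f := bilift_alm_left hn hchi _.
have fN x : x != 0 -> f x = chi (mkpt x, A0).
  by move=> x0; rewrite /f bilift_neq0 ?rep_neq0 // mkpt_rep.
have img : spanned (pimage chi (alm_image (opt (@mkpt F n)) U `*` [set A0; A1]))
    = alm_image f U.
  have -> : pimage chi (alm_image (opt (@mkpt F n)) U `*` [set A0; A1]) = alm_image f U.
    apply/seteqP; split=> p.
      move=> [[X Y] [/= /pg_image XU [->|->]] E].
        by exists (rep X) => //; rewrite fN ?rep_neq0 // mkpt_rep.
      have [X' X'U EX'] : exists2 X', rep X' \in U & chi (X, A1) = chi (X', A0).
        apply: contrapT => H'; apply: H; exists X => // X' X'U EX'.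
        by apply: H'; exists X'.
      by exists (rep X') => //; rewrite fN ?rep_neq0 // mkpt_rep -EX'.
    move=> [x xU Ex]; have [x0|x0] := eqVneq x 0.
      by move: Ex; rewrite x0 (alm0 fA).
    exists (mkpt x, A0); last by rewrite -fN.
    split=> /=; last by left.
    by exists x => //; rewrite optN.
  by apply: spanned_id; apply: alm_image_subspace.
rewrite img in bB.
have := alm_basis_card fA (t := [::]) (nil_free _) _ bB.
by rewrite dU subn0; apply.
Qed.

End RankHypotheses.

Section Regular.
Variable gamma : points (product_geometry (PG n F) (PG m F)) ->
  option (points (PG (n * m + n + m)%N F)).
Hypothesis hgamma : is_regular_embedding gamma.
Local Notation N := (n * m + n + m)%N.
Local Notation "'Mx" := 'M[F]_(m.+1, n.+1).

Let N0 : (0 < N)%N. Proof. by move: n0; lia. Qed.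

Lemma dim_tensor : \dim {: 'M[F]_(m.+1, n.+1)} = N.+1.
Proof. by rewrite dimvf /dim /=; lia. Qed.

Lemma outer_span (v : 'M[F]_(m.+1, n.+1)) (P : 'M[F]_(m.+1, n.+1) -> Prop) :
  (forall u w, P u -> P w -> P (u + w)) -> P 0 ->
  (forall (y : 'rV_m.+1) (x : 'rV_n.+1), P (y^T *m x)) -> P v.
Proof.
move=> PD P0 PM; rewrite (matrix_sum_delta v).
elim/big_ind: _ => // i _; elim/big_ind: _ => // j _.
have -> : v i j *: delta_mx i j = (v i j *: delta_mx 0 i)^T *m (delta_mx 0 j : 'rV_n.+1) :> 'M[F]_(m.+1, n.+1).
  by rewrite linearZ /= trmx_delta -scalemxAl mul_delta_mx.
exact: PM.
Qed.

(** An embedding is global and injective, so the structure of morphisms applies with any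
    three-dimensional [U] and any first point. Matrices of rank one span all matrices, so the span
    of the image of [gamma] consists of all values of [G]; a kernel vector of [G] would lower its
    dimension. *)
Lemma regular_structure (A : 'I_m.+1 -> points (PG m F)) : spanned (range A) = setT ->
  exists (G : 'M[F]_(m.+1, n.+1) -> 'rV[F]_N.+1) (be : 'rV[F]_m.+1 -> 'rV[F]_m.+1),
  [/\ lmap G /\ (forall M, G M = 0 -> M = 0), lmap be, forall y, be y = 0 -> y = 0 &
    forall X Y, gamma (X, Y) = opt (@mkpt F N) (G ((be (rep Y))^T *m rep X))].
Proof.
move=> sA; have [[gL gG gI] hdim] := hgamma.
have hP := pg_projective F N0; have kC := mkpt_coord F N.
have [U dU] := exists_dim3.
have [fr _] := pg_basis hm sA.
have [|||W [psi [L [be [psiC beL be0 H]]]]] :=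
  morphism_structure hn hm hP gL (X0 := mkpt (const_mx 1)) sA dU.
- by move=> X j _; apply: gG.
- move=> j j0; have [x xU Hx] := @notin_line_pair _ _ U 0 0 (eq_leq (esym dU)).
  have x0 : x != 0 by apply/eqP => x0; apply: Hx; exists 0, 0; rewrite x0 !scaler0 addr0.
  exists (mkpt x); first by have [a _ ->] := rep_mkpt x0; rewrite memvZ.
  move=> X' _ /gI[_ E]; have inj : injective (fun j => rep (A j)).
    by apply/injectiveP; exact: free_uniq fr.
  by move/eqP: j0; apply; apply: inj; rewrite /= E.
- by move=> Y; apply: gG.
(* [T] passes from the coordinates constructed on the image to the given ones. It is chosen
   pointwise, hence shown to be an [lmap] only. *)
have [T TE] : exists T : W -> 'rV[F]_N.+1, forall w, opt psi w = opt (@mkpt F N) (T w).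
  exists (fun w => if w == 0 then 0 else rep (psi w)) => w.
  by rewrite {1}/opt; case: eqVneq => w0; rewrite ?opt0 ?opt_rep.
have TL : lmap T.
  apply: (alm_lmap hP kC) TE.
  have := lmap_alm hP psiC (hom_lmap (\1%VF : 'End(W))).
  by congr alm; apply/funext => v; rewrite id_lfunE.
have GL : lmap (fun M => T (L M)) := lmap_comp TL (hom_lmap L).
exists (fun M => T (L M)), be; split=> //; last by move=> X Y; rewrite H TE.
split=> // K EK; apply/eqP/negPn/negP => K0.
pose f M := opt (@mkpt F N) (T (L M)); have fA : alm f := lmap_alm hP kC GL.
have gE X Y : gamma (X, Y) = f ((be (rep Y))^T *m rep X) by rewrite H TE.
(* [be] is onto up to factors, so every matrix of rank one is proportional to the one of a pair of
   points. *)
have [be' [_ _ be'K _]] := lmap_inv beL be0 (lmap_surj beL be0 erefl).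
have fP M M' : par M M' -> f M = f M' by case=> a a0 ->; apply: almZ.
have img : spanned (pimage gamma setT) = alm_image f fullv.
  apply/seteqP; split.
    apply: spanned_min; first exact: alm_image_subspace.
    by move=> p [[X Y] _ E]; exists ((be (rep Y))^T *m rep X); rewrite ?memvf // -gE.
  move=> p [M _]; move: p; apply: (@outer_span M (fun M => forall p, f M = Some p ->
      spanned (pimage gamma setT) p)) => [M1 M2 H1 H2 p /(almD fA)|p|y x p].
  - exact: (subspace_jn (@spanned_subspace _ _)).
  - by rewrite (alm0 fA).
  have [->|x0] := eqVneq x 0; first by rewrite mulmx0 (alm0 fA).
  have [->|y0] := eqVneq y 0; first by rewrite linear0 mul0mx (alm0 fA).
  have b0 : be' y != 0.
    by apply/eqP => E; have := be'K y; rewrite E (lmap0 beL) => /par_sym/par0/eqP; rewrite (negPf y0).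
  have P : par ((be (rep (mkpt (be' y))))^T *m rep (mkpt x)) (y^T *m x : 'M[F]_(m.+1, n.+1)).
    have [a a0 ->] := rep_mkpt x0.
    have [c c0 ->] := par_trans (lmap_par beL (rep_mkpt b0)) (be'K y).
    exists (a * c); first by rewrite mulf_neq0.
    by rewrite -scalemxAr [(_ *: _)^T]linearZ /= -scalemxAl scalerA.
  rewrite -(fP _ _ P) -gE => E; apply: sub_spanned.
  by exists (mkpt x, mkpt (be' y)).
case: hdim => B [bB cB]; rewrite img in bB.
have := alm_basis_card fA (t := [:: K]) _ _ bB.
rewrite /= dim_tensor subn1 /= => HB.
have : `I_N.+1 #<= `I_N.
  apply: card_le_trans (HB _ _); first by move/card_eqPle: cB => [].
    by rewrite free_cons nil_free span_nil memv0 K0.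
  move=> v; rewrite inE => /eqP ->; split; first exact: memvf.
  by rewrite /f EK opt0.
by rewrite card_le_II ltnn.
Qed.

End Regular.
End Hypotheses.

(* Composition of the two structures *)
Local Close Scope card_scope.
Local Close Scope ring_scope.

Theorem theorem2p8 (F : fieldType) (n m : nat) (hn : (2 <= n)%N) (hm : (1 <= m)%N)
  (P' : geometry) (hP' : is_projective P')
  (gamma : points (product_geometry (PG n F) (PG m F)) ->
           option (points (PG (n * m + n + m) F)))
  (hgamma : is_regular_embedding gamma)
  (chi : points (product_geometry (PG n F) (PG m F)) -> option (points P'))
  (hchi : is_linear_morphism chi)
  (hi : exists (A : 'I_m.+1 -> points (PG m F)) (E : set (points (PG n F))),
     [/\ is_basis setT (range A), is_plane E
       & forall i : 'I_m.+1, i != ord0 ->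
           global_on chi (E `*` [set A ord0; A i]) /\
           rank_gt chi (E `*` [set A ord0; A i]) 2])
  (hii : exists A : points (PG n F),
     has_dim (spanned (pimage chi ([set A] `*` [set: points (PG m F)]))) m) :
  exists (alpha' : points (PG m F) -> points (PG m F))
         (phi : points (PG (n * m + n + m) F) -> option (points P')),
    [/\ is_collineation alpha', is_linear_morphism phi
      & forall X Y, obind phi (gamma (X, Y)) = chi (X, alpha' Y)].
Proof.
have [A [E [[sA _] pE hE]]] := hi; have [X0 hX0] := hii.
have n0 : (0 < n)%N := ltnW hn.
have N0 : (0 < n * m + n + m)%N by move: n0; lia.
have [U dU EU] := pg_plane n0 pE; rewrite EU in hE.
have glob X j : rep X \in U -> chi (X, A j) <> None.
  move=> XU; have [j0|j0] := eqVneq j ord0; last first.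
    have [g _] := hE j j0; apply: (g (X, A j)); split; last by right.
    exact/pg_image.
  (* (i) speaks of indices other than 0; for [A ord0] one such index is enough, and [ord_max] is one
     as [m] is positive. *)
  have [|g _] := hE ord_max; first by rewrite -val_eqE /= -lt0n.
  rewrite j0; apply: (g (X, A ord0)); split; last by left.
  exact/pg_image.
have [|||W [psi [L [b [psiC bL b0 chiE]]]]] :=
  morphism_structure hn hm hP' hchi (X0 := X0) sA dU.
- exact: glob.
- move=> j j0; have [_ r] := hE j j0.
  exact: (rank_gt_outside hn hchi dU r).
- exact: (full_rank_global hm hchi hX0).
have [G [c [[GL G0] cL c0 gE]]] := regular_structure hn hm hgamma sA.
have dimE : \dim {: 'M[F]_(m.+1, n.+1)} = \dim {: 'rV[F]_(n * m + n + m).+1}.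
  by rewrite !dimvf /dim /=; lia.
have [s [sL s0 Gs sG]] := lmap_inv GL G0 (lmap_surj GL G0 dimE).
have [b' [b'L b'0 bb' b'b]] := lmap_inv bL b0 (lmap_surj bL b0 erefl).
have [c' [c'L c'0 cc' c'c]] := lmap_inv cL c0 (lmap_surj cL c0 erefl).
(* [b] and [c] belong to [chi] and [gamma]. As [b (al y)] is proportional to [c y], the two Segre
   matrices agree up to a factor; [phi] recovers the matrix by [s] and applies the linear part [L]
   of [chi]. *)
pose al y := b' (c y); pose al' y := c' (b y).
exists (induced al), (fun P => opt psi (L (s (rep P)))).
split.
- apply: (@induced_collineation _ _ al al') => //.
  + exact: lmap_comp.
  + exact: lmap_comp.
  + by move=> v /b'0/c0.
  + by move=> v /c'0/b0.
  + move=> v; apply: par_trans (lmap_par b'L (cc' _)) (b'b v).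
  + move=> v; apply: par_trans (lmap_par c'L (bb' _)) (c'c v).
- apply: (alm_linear_morphism (f := fun v => opt psi (L (s v)))).
  exact: (lmap_alm hP' psiC (lmap_comp (hom_lmap L) sL)).
move=> X Y; rewrite gE chiE; set M := (_ *m _)%R.
have aN : al (rep Y) != 0%R by apply/eqP => /b'0/c0/eqP; rewrite (negPf (rep_neq0 Y)).
have -> : opt psi (L ((b (rep (induced al Y)))^T *m rep X)%R) = opt psi (L M).
  have [a a0 ->] := par_trans (lmap_par bL (rep_mkpt aN)) (bb' _).
  by rewrite [(_ *: _)^T%R]linearZ /= -scalemxAl homZ; apply: par_opt => //; apply: parZ.
have [GM|GM] := eqVneq (G M) 0%R; first by rewrite GM opt0 (G0 _ GM) hom0 opt0.
rewrite optN //=; apply: par_opt => //; apply: lmap_par (hom_lmap L) _.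
by apply: par_trans (sG M); apply: lmap_par sL (rep_mkpt GM).
Qed.
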